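(* For every $p\in(0,1)$, in the drainage network model with parameter $p$, $$\lim_{n\to\infty}\sqrt{n}\,\mathbb{P}\bigl(L(0,0)>n\bigr)=\frac{1}{\gamma_0\sqrt{\pi}},\qquad\text{where}\quad \gamma_0^2=\gamma_0^2(p)=\frac{(1-p)(2-2p+p^2)}{p^2(2-p)^2},\ \gamma_0>0.$$
   Context: Model. Fix $p\in(0,1)$. Let $\{B_{\mathbf u}:\mathbf u\in\mathbb Z^2\}$ be i.i.d. Bernoulli random variables with success probability $p$, and let $\{U_{\mathbf u}:\mathbf u\in\mathbb Z^2\}$ be i.i.d., independent of the $B_{\mathbf u}$, with $\mathbb P(U_{\mathbf u}=1)=\mathbb P(U_{\mathbf u}=-1)=1/2$. The set of open vertices is $V=\{\mathbf u\in\mathbb Z^2:B_{\mathbf u}=1\}$. For $(x,t)\in\mathbb Z^2$ let $k_0=\min\{|k|:k\in\mathbb Z,\ B_{(x+k,t+1)}=1\}$ (a.s. finite) and put $h(x,t)=(x+k_0,t+1)$ if $(x-k_0,t+1)\notin V$; $h(x,t)=(x-k_0,t+1)$ if $(x+k_0,t+1)\notin V$; and $h(x,t)=(x+U_{(x,t)}k_0,t+1)$ if both $(x\pm k_0,t+1)\in V$. Let $h^0(x,t)=(x,t)$ and $h^{k+1}(x,t)=h(h^k(x,t))$. Ancestors. For $k\ge 0$, $C_k(x,t)=\{(y,t-k)\in V:h^k(y,t-k)=(x,t)\}$ if $(x,t)\in V$ and $C_k(x,t)=\varnothing$ otherwise. The length of the channel is $L(x,t)=\inf\{k\ge 0:C_k(x,t)=\varnothing\}$.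 *)

(* Defs.v *)
From HB Require Import structures.
From mathcomp Require Import all_boot all_order all_algebra finmap.
From mathcomp Require Import all_classical all_reals all_analysis.

Set Implicit Arguments.
Unset Strict Implicit.
Unset Printing Implicit Defensive.

Import Order.TTheory GRing.Theory Num.Theory.
Import numFieldNormedType.Exports.

Local Open Scope classical_set_scope.
Local Open Scope ring_scope.

HB.instance Definition _ := isPointed.Build int 0.
HB.instance Definition _ := @isMeasurable.Build default_measure_display
  int discrete_measurable discrete_measurable0
  discrete_measurableC discrete_measurableU.

Notation vertex := (int * int)%type.

Section Independence.
Context d (T : measurableType d) (R : realType) (P : probability T R).

Definition sigma_of d' (T' : measurableType d') (X : T -> T') : set (set T) :=
  preimage_set_system setT X measurable.

Definition sigma_of_family d' (T' : measurableType d') (I : Type)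
    (X : I -> T -> T') : set (set T) :=
  <<s \bigcup_i sigma_of (X i) >>.

Definition mutually_independent d' (T' : measurableType d') (I : choiceType)
    (X : I -> T -> T') : Prop :=
  forall (J : {fset I}) (A : I -> set T),
    (forall i, i \in J -> sigma_of (X i) (A i)) ->
    P (\bigcap_(i in [set` J]) A i) = (\prod_(i <- J) P (A i))%E.

Definition independent_families d1 (T1 : measurableType d1) d2
    (T2 : measurableType d2) (I1 I2 : Type)
    (X : I1 -> T -> T1) (Y : I2 -> T -> T2) : Prop :=
  forall A1 A2 : set T,
    sigma_of_family X A1 -> sigma_of_family Y A2 ->
    P (A1 `&` A2) = (P A1 * P A2)%E.

End Independence.

Section DrainageNetwork.
Context (R : realType) d (T : measurableType d) (P : probability T R).

Record drainage_network (p : R) (B : vertex -> {RV P >-> bool})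
    (U : vertex -> {RV P >-> int}) : Prop := DrainageNetwork {
  B_law : forall u, distribution P (B u) =1 bernoulli_prob p ;
  B_indep : mutually_independent P (fun u => B u : T -> bool) ;
  U_law1 : forall u, P [set w | U u w = 1] = (2^-1)%:E ;
  U_lawN1 : forall u, P [set w | U u w = -1] = (2^-1)%:E ;
  U_indep : mutually_independent P (fun u => U u : T -> int) ;
  BU_indep : independent_families P
    (fun u => B u : T -> bool) (fun u => U u : T -> int) }.

End DrainageNetwork.

Section Configuration.
(* one realization of the families B and U *)
Variables (b : vertex -> bool) (s : vertex -> int).

Definition open_vertices : set vertex := [set u | b u].

Definition candidate_dist (u : vertex) : set nat :=
  [set `|k|%N | k in [set k : int | b (u.1 + k, u.2 + 1)]].

(* The minimum of candidate_dist u; the value is 0 when that set is empty,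
   an event of probability 0 for p in ]0, 1[ *)
Definition nearest_dist (u : vertex) : nat :=
  xget 0%N [set k | candidate_dist u k /\
                    forall j, candidate_dist u j -> (k <= j)%N].

Definition next_vertex (u : vertex) : vertex :=
  let k0 := (nearest_dist u)%:Z in
  if ~~ b (u.1 - k0, u.2 + 1) then (u.1 + k0, u.2 + 1)
  else if ~~ b (u.1 + k0, u.2 + 1) then (u.1 - k0, u.2 + 1)
  else (u.1 + s u * k0, u.2 + 1).

Definition ancestors (k : nat) (u : vertex) : set vertex :=
  [set v | [/\ open_vertices u, open_vertices v, v.2 = u.2 - k%:Z
             & iter k next_vertex v = u]].

Definition channel_length (R : realType) (u : vertex) : \bar R :=
  ereal_inf [set k%:R%:E | k in [set k : nat | ancestors k u = set0]].

End Configuration.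

Arguments channel_length b s R u : clear implicits.

Definition gamma0 (R : realType) (p : R) : R :=
  Num.sqrt ((1 - p) * (2 - 2 * p + p ^+ 2) / (p ^+ 2 * (2 - p) ^+ 2)).

(* Main.v *)
(* A walker goes straight up whenever the vertex above it is open, so almost
   surely L(0,0) > n if and only if some walker started at height -n-1 is at the
   origin at height 0. Steps preserve the order of the walkers. Counting each
   level set of the monotone flow by its greatest element, mass transport turns
   the probability of this event into the probability u(n+1) that walkers
   started at distance 1 have not met after n+1 steps.

   The gap between two walkers is a Markov chain absorbed at 0. The displacement
   of one walker has variance gamma0^2 and a finite third moment, and reflecting
   the configuration near one of two walkers at distance m shows that the
   covariance of their displacements is O(1/m). Hence exp(-a gap) is nearly an
   eigenfunction of the chain, with eigenvalue 1 + gamma0^2 a^2. For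
   x = 1 / (1 + gamma0^2 a^2) and a tending to 0 this yields
   sqrt(1 - x) sum_n u(n) x^n --> 1 / gamma0. The sequence v(n) = binom(2n, n) / 4^n
   has generating function (1 - x)^(-1/2) and satisfies sqrt(pi n) v(n) --> 1 by
   Wallis; comparing u with v / gamma0 on windows of indices proportional to n,
   the monotonicity of u gives sqrt(pi n) u(n) --> 1 / gamma0. *)

(* The expansion of the gap kernel at distance m has an error of order a^2 / m + a^3, and a^2 / m is
   not small compared with a^2 for bounded m. Small gaps are harmless for another reason: from each
   fixed m > 0 the walkers merge in one step with positive probability, so the expected time spent
   at positive gaps below a fixed level is finite. It contributes O(a^2), against a main term 1 -
   exp(-a) of order a. Above that level the error is at most eta a^2 times the survival probability,
   with eta as small as desired. The eigenvalue reflects the two displacements: their variances add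
   up to 2 gamma0^2, and the Taylor formula halves the sum.

   The Tauberian step compares [u] with an explicit sequence having the same singularity. The kernel
   (y (1 - y))^r at y = x^j is a polynomial in y without constant term, so only values of the
   generating functions at powers of x enter. Choosing x so that the peak y = 1/2 falls inside a
   window, and then r large, makes the indices outside the window negligible. *)
Require Import Defs.
From HB Require Import structures.
From mathcomp Require Import all_boot all_order all_algebra finmap.
From mathcomp Require Import all_classical all_reals all_analysis.
From mathcomp Require Import measurable_realfun.
From mathcomp Require Import zify ring lra.

Set Implicit Arguments.
Unset Strict Implicit.
Unset Printing Implicit Defensive.

Import Order.TTheory GRing.Theory Num.Theory.
Import numFieldNormedType.Exports.

Local Open Scope classical_set_scope.
Local Open Scope ring_scope.

(** * Wallis' inequalities for the ratios binom(2n, n) / 4^n *)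

Section Wallis.
Context {R : realType}.

Local Notation mu := (@lebesgue_measure R).

Definition sin_power_integral (n : nat) : R :=
  \int[mu]_(x in `[0, pi / 2]) sin x ^+ n.

Let pi2_gt0 : 0 < pi / 2 :> R. Proof. by rewrite divr_gt0 ?pi_gt0. Qed.

Lemma continuous_sin_power n : continuous (fun x : R => sin x ^+ n).
Proof.
move=> x; apply: (@continuous_comp _ _ _ sin (fun y : R => y ^+ n));
  [exact: continuous_sin | exact: exprn_continuous].
Qed.

Lemma integrable_sin_power n :
  mu.-integrable `[0, pi / 2] (EFin \o (fun x : R => sin x ^+ n)).
Proof.
apply: continuous_compact_integrable; first exact: segment_compact.
by apply: continuous_subspaceT => x; exact: continuous_sin_power.
Qed.

(** Integration by parts in disguise: [F] vanishes at 0 and at pi / 2, and writing cos^2 as 1 -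
    sin^2 in its derivative gives [f]. *)
Lemma sin_power_integral_rec n :
  n.+2%:R * sin_power_integral n.+2 = n.+1%:R * sin_power_integral n.
Proof.
pose F (x : R) := - (cos x * sin x ^+ n.+1).
pose f (x : R) := n.+2%:R * sin x ^+ n.+2 - n.+1%:R * sin x ^+ n.
have dF (x : R) : is_derive x (1 : R) F (f x).
  have h := is_deriveN (is_deriveM (is_derive_cos x) (is_deriveX n.+1 (is_derive_sin x))).
  have -> : F = - (cos * sin ^+ n.+1) by rewrite exprfctE.
  apply: (is_derive_eq h).
  rewrite exprfctE.
  rewrite /f /GRing.scale /=.
  have e := cos2Dsin2 x.
  transitivity (- (n.+1%:R * sin x ^+ n) * (cos x ^+ 2 + sin x ^+ 2 - 1)
    + n.+2%:R * sin x ^+ n.+2 - n.+1%:R * sin x ^+ n - 0); last by rewrite e; ring.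
  by rewrite !exprS -(natr1 n.+1) -(natr1 n); ring.
have csin k c : continuous (fun x : R => c * sin x ^+ k).
  by move=> x; apply: cvgM; [exact: cvg_cst | exact: continuous_sin_power].
have cf : continuous f by move=> x; apply: cvgB; exact: csin.
have cF : continuous F.
  by move=> x; apply: differentiable_continuous; apply/derivable1_diffP; case: (dF x).
have /(congr1 fine) := @continuous_FTC2 R f F 0 (pi / 2) pi2_gt0
  (continuous_subspaceT cf)
  ltac:(split; [by move=> x _; case: (dF x)
    | apply: cvg_at_right_filter; exact: cF
    | apply: cvg_at_left_filter; exact: cF])
  ltac:(by move=> x _; rewrite derive1E (@derive_val _ _ _ _ _ _ _ (dF x))).
rewrite /F /= cos_pihalf sin0 expr0n /= mul0r mulr0 oppr0 subrr.
rewrite -[fine _]/(\int[mu]_(x in `[0, pi / 2]) f x) /f RintegralB //; last 2 first.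
- apply: continuous_compact_integrable; first exact: segment_compact.
  exact: continuous_subspaceT (csin _ _).
- apply: continuous_compact_integrable; first exact: segment_compact.
  exact: continuous_subspaceT (csin _ _).
rewrite !RintegralZl//; [|exact: integrable_sin_power..].
by move/eqP; rewrite subr_eq0 => /eqP.
Qed.

Lemma sin_power_integral0 : sin_power_integral 0 = pi / 2.
Proof.
rewrite /sin_power_integral -[LHS]/(\int[mu]_(x in `[0, pi / 2]) 1).
by rewrite Rintegral_cst//= lebesgue_measure_itv/= lte_fin pi2_gt0 /= subr0 mul1r.
Qed.

Lemma sin_power_integral1 : sin_power_integral 1 = 1.
Proof.
have dF (x : R) : is_derive x (1 : R) (fun x : R => - cos x) (sin x ^+ 1).
  by apply: is_derive_eq; rewrite opprK expr1.
have cF : continuous (fun x : R => - cos x).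
  by move=> x; apply: differentiable_continuous; apply/derivable1_diffP; case: (dF x).
have /(congr1 fine) := @continuous_FTC2 R (fun x => sin x ^+ 1) _ 0 (pi / 2) pi2_gt0
  (continuous_subspaceT (@continuous_sin_power 1))
  ltac:(split; [by move=> x _; case: (dF x)
    | apply: cvg_at_right_filter; exact: cF
    | apply: cvg_at_left_filter; exact: cF])
  ltac:(by move=> x _; rewrite derive1E (@derive_val _ _ _ _ _ _ _ (dF x))).
by rewrite cos_pihalf cos0 /= oppr0 add0r opprK.
Qed.

Lemma sin_power_integral_le n : sin_power_integral n.+1 <= sin_power_integral n.
Proof.
apply: le_Rintegral => //; [exact: integrable_sin_power.. | move=> x].
rewrite /= in_itv /= => /andP[x0 x1].
have s0 : 0 <= sin x.
  by apply: sin_ge0_pi; rewrite x0 (le_trans x1)// ler_pdivrMr// ler_peMr ?pi_ge0 ?ler1n.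
by rewrite exprS ler_piMl ?exprn_ge0 ?sin_le1.
Qed.

Definition central_binomial_ratio (n : nat) : R :=
  \prod_(i < n) (i.*2.+1%:R / i.*2.+2%:R).
Local Notation v := central_binomial_ratio.

Lemma central_binomial_ratio_gt0 n : 0 < v n.
Proof. by apply: prodr_gt0 => i _; rewrite divr_gt0 ?ltr0n. Qed.

Lemma central_binomial_ratioS n : n.+1%:R * v n.+1 = (n%:R + 2^-1) * v n.
Proof.
rewrite /v big_ord_recr /= mulrCA [RHS]mulrC; congr (_ * _).
rewrite -muln2 -!natr1 natrM; field.
have : (0:R) <= n%:R by exact: ler0n.
by move=> ?; apply: lt0r_neq0; lra.
Qed.

Lemma central_binomial_ratio_sin_even n : sin_power_integral n.*2 = pi / 2 * v n.
Proof.
elim: n => [|n IH]; first by rewrite sin_power_integral0 /v big_ord0 mulr1.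
have := sin_power_integral_rec n.*2; rewrite IH doubleS => e.
rewrite /v big_ord_recr /= -/(v n).
apply: (@mulfI _ n.*2.+2%:R); first by rewrite pnatr_eq0.
by rewrite e; field; rewrite -natrD pnatr_eq0.
Qed.

Lemma central_binomial_ratio_sin_odd n : sin_power_integral n.*2.+1 = (n.*2.+1%:R * v n)^-1.
Proof.
elim: n => [|n IH].
  by rewrite sin_power_integral1 /v big_ord0 mulr1 invr1.
have := sin_power_integral_rec n.*2.+1; rewrite IH doubleS => e.
rewrite /v big_ord_recr /= -/(v n).
have vn := lt0r_neq0 (central_binomial_ratio_gt0 n).
apply: (@mulfI _ n.*2.+3%:R); first by rewrite pnatr_eq0.
by rewrite e; field; rewrite nat1r -!natrD !pnatr_eq0 vn.
Qed.

(** Compares the sine integrals of exponents 2n + 1 and 2n, which are explicit in [v n]. *)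
Lemma wallis_lower n : 1 <= pi * (n%:R + 2^-1) * v n ^+ 2.
Proof.
have := sin_power_integral_le n.*2.
rewrite central_binomial_ratio_sin_even central_binomial_ratio_sin_odd.
have vn := central_binomial_ratio_gt0 n.
have k0 : 0 < n.*2.+1%:R * v n by rewrite mulr_gt0.
rewrite -div1r ler_pdivrMr// => /le_trans; apply.
have -> : n.*2.+1%:R = 2 * n%:R + 1 :> R by rewrite -natr1 -muln2 natrM mulrC.
by rewrite expr2; nra.
Qed.

(** Compares exponents 2n + 2 and 2n + 1. The recursion for [v] turns the mixed product of [v n] and
    [v n.+1] into a square. *)
Lemma wallis_upper n : pi * n%:R * v n ^+ 2 <= 1.
Proof.
case: n => [|n]; first by rewrite mulr0 mul0r.
have := sin_power_integral_le n.*2.+1; rewrite -doubleS.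
rewrite central_binomial_ratio_sin_even central_binomial_ratio_sin_odd.
have vn := central_binomial_ratio_gt0 n.
have vn1 := central_binomial_ratio_gt0 n.+1.
have k0 : 0 < n.*2.+1%:R * v n by rewrite mulr_gt0.
rewrite -[leRHS]div1r ler_pdivlMr//; apply: le_trans.
have e := central_binomial_ratioS n.
have {}e : n.*2.+1%:R * v n = 2 * (n.+1%:R * v n.+1).
  have -> : n.*2.+1%:R = 2 * n%:R + 1 :> R by rewrite -natr1 -muln2 natrM mulrC.
  by rewrite e; field.
by rewrite e expr2; nra.
Qed.

End Wallis.

(** * A Tauberian theorem for nonincreasing sequences *)

Section GeneratingFunction.
Context {R : realType}.
Implicit Types (u : R^nat) (x : R).

Definition gen_fun u x : R := limn (series (fun j => u j * x ^+ j)).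

Definition unit_seq u := forall j, 0 <= u j <= 1.

Lemma cvg_gen_fun u x : unit_seq u -> 0 <= x < 1 ->
  series (fun j => u j * x ^+ j) @ \oo --> gen_fun u x.
Proof.
move=> u01 /andP[x0 x1]; apply: cvgP; apply: (@series_le_cvg _ _ (geometric 1 x)).
- by move=> n; rewrite mulr_ge0 ?exprn_ge0//; case/andP: (u01 n).
- by move=> n; rewrite geometric_ge0.
- move=> n; rewrite /geometric /= ler_wpM2r ?exprn_ge0//.
  by case/andP: (u01 n).
- by apply: is_cvg_geometric_series; rewrite ger0_norm.
Qed.

Lemma gen_fun_ge_partial u x n : unit_seq u -> 0 <= x < 1 ->
  \sum_(j < n) u j * x ^+ j <= gen_fun u x.
Proof.
move=> u01 x01; rewrite -(big_mkord xpredT (fun j => u j * x ^+ j)).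
apply: (@nondecreasing_cvgn_le _ (series (fun j => u j * x ^+ j))).
- apply: nondecreasing_series => i _ _; rewrite mulr_ge0 ?exprn_ge0//.
    by case/andP: (u01 i).
  by case/andP: x01.
- by apply: cvgP; exact: cvg_gen_fun.
Qed.

Lemma gen_fun_ge0 u x : unit_seq u -> 0 <= x < 1 -> 0 <= gen_fun u x.
Proof. by move=> u01 x01; have := gen_fun_ge_partial 0 u01 x01; rewrite big_ord0. Qed.

Local Notation v := (@central_binomial_ratio R).

Lemma central_binomial_ratio_unit : unit_seq v.
Proof.
move=> n; rewrite ltW ?central_binomial_ratio_gt0//=.
apply: prodr_ile1 => i _; rewrite divr_ge0//=.
by rewrite ler_pdivrMr ?ltr0n// mul1r ler_nat.
Qed.

(** This is V(x)^2 = 1 / (1 - x) read on coefficients. The induction weights the terms by i: the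
    symmetry between i and m - i evaluates the weighted sum as m / 2 times the plain one ([half]),
    and the recursion for [v] reduces it to the previous index. *)
Lemma central_binomial_ratio_convolution n : \sum_(i < n.+1) v i * v (n - i)%N = 1.
Proof.
elim: n => [|n IH]; first by rewrite big_ord1 /v big_ord0 mulr1.
have half m : \sum_(i < m.+1) i%:R * (v i * v (m - i)%N) =
    m%:R / 2 * \sum_(i < m.+1) v i * v (m - i)%N.
  have e : \sum_(i < m.+1) i%:R * (v i * v (m - i)%N) =
      \sum_(i < m.+1) (m%:R - i%:R) * (v i * v (m - i)%N).
    rewrite (reindex_inj rev_ord_inj); apply: eq_bigr => i _ /=.
    have im : (i <= m)%N by rewrite -ltnS.
    by rewrite subSS natrB// subKn// [v i * _]mulrC.
  have := erefl (\sum_(i < m.+1) i%:R * (v i * v (m - i)%N)).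
  rewrite [in RHS]e; under [in RHS]eq_bigr do rewrite mulrBl.
  by rewrite sumrB -mulr_sumr; lra.
apply: (@mulfI _ (n.+1%:R / 2)); first by rewrite mulf_neq0 ?invr_eq0 ?pnatr_eq0.
rewrite -half big_ord_recl mul0r add0r.
under eq_bigr do rewrite /= /bump /= add1n subSS mulrA central_binomial_ratioS mulrDl mulrDl -!mulrA.
rewrite big_split /= half -mulr_sumr IH -natr1; lra.
Qed.

Lemma sum_convolution (b : R^nat) n :
  \sum_(m < n) \sum_(i < m.+1) b i * b (m - i)%N =
  \sum_(i < n) b i * \sum_(j < n - i) b j.
Proof.
elim: n => [|n IH]; first by rewrite !big_ord0.
rewrite big_ord_recr /= IH big_ord_recr [RHS]big_ord_recr /= subnn subSnn big_ord1.
rewrite addrA; congr (_ + _).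
rewrite -big_split /=; apply: eq_bigr => i _.
by rewrite subSn 1?ltnW// big_ord_recr /= mulrDr.
Qed.

(** The square of index pairs i, j < n lies between the triangles i + j < n and i + j < 2n. The
    convolution identity sums both triangles explicitly, which squeezes the squared partial sums. *)
Lemma gen_fun_central_binomial_ratio x : 0 <= x < 1 ->
  gen_fun v x = (Num.sqrt (1 - x))^-1.
Proof.
move=> x01; have /andP[x0 x1] := x01.
have x1x : 0 < 1 - x by rewrite subr_gt0.
pose b j := v j * x ^+ j; pose S n := \sum_(j < n) b j.
have b0 j : 0 <= b j.
  by rewrite mulr_ge0 ?exprn_ge0// ltW// central_binomial_ratio_gt0.
have Smono m n : (m <= n)%N -> S m <= S n.
  move=> mn; rewrite /S -(subnKC mn) big_split_ord /= lerDl.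
  by rewrite sumr_ge0.
have T n : \sum_(i < n) b i * S (n - i)%N = (1 - x ^+ n) / (1 - x).
  rewrite -sum_convolution.
  rewrite (eq_bigr (fun m : 'I_n => x ^+ m)); last first.
    move=> m _; rewrite -[RHS]mul1r -(central_binomial_ratio_convolution m) mulr_suml.
    apply: eq_bigr => i _; rewrite /b mulrACA -exprD subnKC//.
    by rewrite -ltnS.
  apply: (@mulfI _ (1 - x)); first exact: lt0r_neq0.
  rewrite [RHS]mulrC divfK ?lt0r_neq0//.
  by have := subrX1 x n; lra.
have lo n : (1 - x ^+ n) / (1 - x) <= S n ^+ 2.
  rewrite -T expr2 {2}/S mulr_suml ler_sum// => i _.
  by rewrite ler_wpM2l// Smono// leq_subr.
have hi n : S n ^+ 2 <= (1 - x)^-1.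
  have -> : S n ^+ 2 = \sum_(i < n) b i * S n by rewrite expr2 {1}/S mulr_suml.
  apply: (@le_trans _ _ (\sum_(i < n + n) b i * S (n + n - i)%N)); last first.
    by rewrite T ler_pdivrMr// mulVf ?gt_eqF// lerBlDr lerDl exprn_ge0.
  rewrite big_split_ord /= -[leLHS]addr0 lerD//.
    by apply: ler_sum => i _; rewrite ler_wpM2l// Smono// -addnBA ?leq_addr// ltnW.
  by apply: sumr_ge0 => i _; rewrite mulr_ge0// /S sumr_ge0.
have cS : (S n ^+ 2) @[n --> \oo] --> gen_fun v x ^+ 2.
  rewrite expr2; under eq_fun do rewrite expr2.
  have cS : S @ \oo --> gen_fun v x.
    rewrite (_ : S = series b); last by apply/funext => n; rewrite /series /= big_mkord.
    exact: (cvg_gen_fun central_binomial_ratio_unit).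
  exact: cvgM.
have cx : (1 - x ^+ n) / (1 - x) @[n --> \oo] --> (1 - 0) / (1 - x).
  apply: cvgMr_tmp; apply: cvgB; first exact: cvg_cst.
  by apply: cvg_expr; rewrite ger0_norm.
rewrite subr0 div1r in cx.
have e : gen_fun v x ^+ 2 = (1 - x)^-1.
  apply: (norm_cvg_unique cS).
  apply: (squeeze_cvgr _ cx); last exact: cvg_cst.
  by apply: nearW => n; rewrite lo hi.
rewrite -sqrtrV 1?ltW// -e sqrtr_sqr ger0_norm// gen_fun_ge0//.
exact: central_binomial_ratio_unit.
Qed.

End GeneratingFunction.

(** * Sums of a sequence against a polynomial kernel in powers of x *)

Section Tauberian.
Context {R : realType}.
Implicit Types (u : R^nat) (x y : R).
Local Notation v := (@central_binomial_ratio R).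

Lemma cvgr_sum (I : Type) (s : seq I) (f : I -> R^nat) (l : I -> R) :
  (forall i, f i @ \oo --> l i) -> \sum_(i <- s) f i n @[n --> \oo] --> \sum_(i <- s) l i.
Proof.
move=> fl; elim: s => [|i s IH].
  by rewrite big_nil; under eq_fun do rewrite big_nil; exact: cvg_cst.
by rewrite big_cons; under eq_fun do rewrite big_cons; exact: cvgD.
Qed.

(* At [y = x ^+ j] this weight concentrates, for large [r], on the indices [j]
   such that [x ^+ j] is close to 1/2; expanding it in powers of [y] reduces the
   weighted sums of [u] to values of its generating function. *)
Definition bump_kernel (r : nat) (y : R) : R := (y * (1 - y)) ^+ r.

(** The series of [u j * bump_kernel r (x ^+ j)], evaluated by expanding (1 - y)^r and exchanging
    the exponents in (x^j)^k = (x^k)^j. *)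
Definition bump_sum u x (r : nat) : R :=
  \sum_(i < r.+1) ((-1) ^+ i * gen_fun u (x ^+ (r + i))) *+ 'C(r, i).

Lemma exprn_itv01 x k : 0 <= x < 1 -> (0 < k)%N -> 0 <= x ^+ k < 1.
Proof. by case/andP=> x0 x1 k0; rewrite exprn_ge0//= exprn_ilt1// -lt0n. Qed.

(** With [0 < r] every exponent [r + i] is positive, so all generating functions are taken at points
    strictly below 1. *)
Lemma cvg_bump_sum u x r : unit_seq u -> 0 <= x < 1 -> (0 < r)%N ->
  series (fun j => u j * bump_kernel r (x ^+ j)) @ \oo --> bump_sum u x r.
Proof.
move=> u01 x01 r0.
rewrite [X in X @ _](_ : _ = fun n => \sum_(i < r.+1)
    ((-1) ^+ i * series (fun j => u j * (x ^+ (r + i)) ^+ j) n) *+ 'C(r, i)).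
  apply: cvgr_sum => i; rewrite -mulr_natl; under eq_fun do rewrite -mulr_natl.
  do 2 apply: cvgMl_tmp.
  by apply: cvg_gen_fun => //; rewrite exprn_itv01// addn_gt0 r0.
apply/funext => n; rewrite /series /=.
under [RHS]eq_bigr do rewrite mulr_sumr -sumrMnl.
rewrite exchange_big /=; apply: eq_bigr => j _.
rewrite /bump_kernel exprMn exprBn !mulr_sumr; apply: eq_bigr => i _.
rewrite expr1n mulr1 !mulrnAr; congr (_ *+ _).
by rewrite -!exprM mulnDl exprD [(r * j)%N]mulnC [(i * j)%N]mulnC; ring.
Qed.

Lemma one_subX_le x k : 0 <= x <= 1 -> 1 - x ^+ k <= k%:R * (1 - x).
Proof.
case/andP=> x0 x1; elim: k => [|k IH]; first by rewrite subrr mul0r.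
have xk : x ^+ k <= 1 by rewrite exprn_ile1.
have xk0 : 0 <= x ^+ k by rewrite exprn_ge0.
by rewrite exprS -natr1; nra.
Qed.

(** A finite combination of the hypothesis at the points x^k with r <= k <= 2r. These points tend to
    1 with x because 1 - x^k <= 2r (1 - x), and the factor sqrt(1 - x) is dominated by sqrt(1 -
    x^k). *)
Lemma bump_sum_asymptotic u c r : unit_seq u -> (0 < r)%N ->
  (forall e, 0 < e -> exists2 h, 0 < h & forall x, 0 <= x -> 1 - h < x < 1 ->
    `|Num.sqrt (1 - x) * gen_fun u x - c| <= e) ->
  forall e, 0 < e -> exists2 h, 0 < h & forall x, 0 <= x -> 1 - h < x < 1 ->
    Num.sqrt (1 - x) * `|bump_sum u x r - c * bump_sum v x r| <= e.
Proof.
move=> u01 r0 H e e0.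
(* [M] is 2^r, written so that [e] splits into shares proportional to the binomial coefficients. *)
pose M : R := \sum_(i < r.+1) 1 *+ 'C(r, i).
have M0 : 0 < M.
  rewrite /M big_ord_recl bin0 ltr_pwDl//= sumr_ge0// => i _.
have [h h0 Hh] := H (e / M) (divr_gt0 e0 M0).
have r20 : 0 < (r + r)%:R :> R by rewrite ltr0n addn_gt0 r0.
exists (h / (r + r)%:R); first by rewrite divr_gt0.
move=> x x0 /andP[hx x1].
rewrite /bump_sum mulr_sumr -sumrB -[Num.sqrt _]ger0_norm ?sqrtr_ge0// -normrM mulr_sumr.
apply: (le_trans (ler_norm_sum _ _ _)).
have -> : e = \sum_(i < r.+1) e / M *+ 'C(r, i).
  rewrite -[LHS](@divfK _ M) ?gt_eqF// mulr_sumr; apply: eq_bigr => i _.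
  by rewrite mulrnAr mulr1.
apply: ler_sum => i _.
rewrite mulrnAr -mulrnBl mulrnAr normrMn lerMn2r; apply/orP; right.
set k := (r + i)%N.
have k0 : (0 < k)%N by rewrite addn_gt0 r0.
have /andP[xk0 xk1] := @exprn_itv01 x k ltac:(by rewrite x0) k0.
have kr : (k <= r + r)%N by rewrite leq_add2l -ltnS.
have hk : 1 - h < x ^+ k.
  have := @one_subX_le x k ltac:(by rewrite x0 ltW).
  have : k%:R * (1 - x) <= (r + r)%:R * (1 - x).
    by rewrite ler_wpM2r ?ler_nat// subr_ge0 ltW.
  have : (r + r)%:R * (1 - x) < h by rewrite mulrC -ltr_pdivlMr//; lra.
  by lra.
have := Hh (x ^+ k) xk0 ltac:(by rewrite hk).
rewrite [gen_fun v _]gen_fun_central_binomial_ratio ?xk0//.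
set s := Num.sqrt (1 - x); set sk := Num.sqrt (1 - x ^+ k).
have sk0 : 0 < sk by rewrite sqrtr_gt0 subr_gt0.
have ssk : s <= sk.
  have xkx : x ^+ k <= x by rewrite -[leRHS]expr1 ler_wiXn2l// ltW.
  by apply: ler_wsqrtr; rewrite lerD2l lerN2.
have t01 : 0 <= s / sk <= 1 by rewrite divr_ge0 ?sqrtr_ge0//= ler_pdivrMr// mul1r.
have -> : s * ((-1) ^+ i * gen_fun u (x ^+ k) - c * ((-1) ^+ i * sk^-1)) =
   (-1) ^+ i * (s / sk * (sk * gen_fun u (x ^+ k) - c)).
  by field; rewrite gt_eqF.
rewrite normrM normrX normrN1 expr1n mul1r; apply: le_trans.
by case/andP: t01 => t0 t1; rewrite normrM ler_piMl// ger0_norm.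
Qed.

(** Outside [W] the kernel of order [r.+1] is at most rho^r times y = x^j: one factor is kept back
    so that the tail sums to the generating function of [u]. *)
Lemma bump_sum_window u x r (W : pred nat) rho J :
  unit_seq u -> 0 <= x < 1 -> 0 <= rho -> (forall j, W j -> (j < J)%N) ->
  (forall j, ~~ W j -> x ^+ j * (1 - x ^+ j) <= rho) ->
  `|bump_sum u x r.+1 - \sum_(j < J | W j) u j * bump_kernel r.+1 (x ^+ j)|
    <= rho ^+ r * gen_fun u x.
Proof.
move=> u01 x01 rho0 WJ Wrho; have /andP[x0 x1] := x01.
pose f j := u j * bump_kernel r.+1 (x ^+ j).
have xj j : 0 <= x ^+ j <= 1 by rewrite exprn_ge0//= exprn_ile1// ltW.
have y0 j : 0 <= x ^+ j * (1 - x ^+ j).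
  by case/andP: (xj j) => a b; rewrite mulr_ge0// subr_ge0.
have uj0 j : 0 <= u j by case/andP: (u01 j).
have f0 j : 0 <= f j by rewrite mulr_ge0// exprn_ge0.
have split N : (J <= N)%N -> \sum_(j < N) f j =
    \sum_(j < J | W j) f j + \sum_(j < N | ~~ W j) f j.
  move=> JN; rewrite (bigID (fun j : 'I_N => W j)) /=; congr (_ + _).
  rewrite -(big_mkord W f) -(big_mkord W f) (big_cat_nat (n := J))//=.
  rewrite [X in _ + X]big_nat_cond [X in _ + X]big1 ?addr0// => j.
  by move=> /andP[/andP[Jj _] /WJ]; rewrite ltnNge Jj.
have lim := cvg_bump_sum u01 x01 (ltn0Sn r).
have lo : \sum_(j < J | W j) f j <= bump_sum u x r.+1.
  apply: (cvgr_to_ge lim); near=> N.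
  have JN : (J <= N)%N by near: N; exact: nbhs_infty_ge.
  by rewrite /series /= big_mkord split// lerDl sumr_ge0.
have hi : bump_sum u x r.+1 <= \sum_(j < J | W j) f j + rho ^+ r * gen_fun u x.
  apply: (cvgr_to_le lim); near=> N.
  have JN : (J <= N)%N by near: N; exact: nbhs_infty_ge.
  rewrite /series /= big_mkord split// lerD2l.
  apply: (@le_trans _ _ (\sum_(j < N | ~~ W j) rho ^+ r * (u j * x ^+ j))).
    apply: ler_sum => j Wj; rewrite /f /bump_kernel mulrCA ler_wpM2l//.
    rewrite exprS mulrC ler_pM ?exprn_ge0//; first by rewrite lerXn2r ?nnegrE ?Wrho.
    by case/andP: (xj j) => a b; rewrite ler_piMr// lerBlDr lerDl.
  rewrite -mulr_sumr ler_wpM2l ?exprn_ge0//.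
  apply: le_trans (gen_fun_ge_partial N u01 x01).
  rewrite [leRHS](bigID (fun j : 'I_N => ~~ W j)) /= lerDl sumr_ge0// => j _.
  by rewrite mulr_ge0//; case/andP: (xj j).
by rewrite -/(f _) ger0_norm ?subr_ge0// lerBlDl.
Unshelve. all: by end_near. Qed.

End Tauberian.

(** * Comparison of window averages and the resulting limit *)

Section TauberianLimit.
Context {R : realType}.
Implicit Types (u : R^nat) (x y : R).
Local Notation v := (@central_binomial_ratio R).

Lemma count_nat_interval (lo hi : R) : 0 <= lo -> lo <= hi ->
  exists a b : nat, [/\ (a <= b)%N, hi - lo - 1 <= (b - a)%:R &
    forall j, (a <= j < b)%N -> lo <= j%:R <= hi].
Proof.
move=> lo0 lohi; exists (Num.truncn lo).+1, (Num.truncn hi).+1.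
have hi0 := le_trans lo0 lohi.
have ab : (Num.truncn lo <= Num.truncn hi)%N.
  rewrite truncn_ge_nat//; apply: le_trans lohi.
  by case/andP: (truncn_itv lo0).
split=> //.
  have /andP[h1 h2] := truncn_itv lo0; have /andP[h3 h4] := truncn_itv hi0.
  by rewrite subSS natrB//; move: h1 h4; rewrite -!natr1; lra.
move=> j /andP[h1 h2]; apply/andP; split.
  by apply/ltW; rewrite -truncn_lt_nat.
by rewrite -truncn_ge_nat.
Qed.

Lemma logistic_le (s t : R) : s <= t -> s + t <= 1 -> s * (1 - s) <= t * (1 - t).
Proof. by move=> h1 h2; nra. Qed.

Lemma one_sub_expRN_ge (h : R) : 0 <= h <= 1 -> h / 2 <= 1 - expR (- h).
Proof.
move=> /andP[h0 h1]; have e1 := expR_ge1Dx h; have e2 := expRxMexpNx_1 h.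
have e3 := expR_gt0 (- h).
have le1 : expR (- h) * (1 + h) <= 1 by rewrite -[leRHS]e2 mulrC ler_wpM2r// ltW.
have h1' : 0 < 1 + h by lra.
suff : expR (- h) <= 1 - h / 2 by lra.
rewrite -(ler_pM2r h1'); apply: (le_trans le1); nra.
Qed.

Section Window.
Variables (u : R^nat) (c : R).
Hypothesis u01 : unit_seq u.
Hypothesis c0 : 0 <= c.
Hypothesis gen_fun_u : forall e, 0 < e ->
  exists2 h, 0 < h & forall x, 0 <= x -> 1 - h < x < 1 ->
    `|Num.sqrt (1 - x) * gen_fun u x - c| <= e.

(** The weights [Q] are the bump kernel at the powers of x = exp(-tau / n), so x^j depends only on j
    / n and the window occupies a fixed range of y as n grows. The total weight [A] is of order n,
    while each generating function is of order sqrt n, which explains the scale A / sqrt n of the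
    error. *)
Lemma tauberian_window (alpha beta : R) : 0 < alpha < beta ->
  forall e, 0 < e -> \forall n \near \oo,
  exists J (Q : R^nat), let W j := alpha * n%:R <= j%:R <= beta * n%:R in
  let A := \sum_(j < J | W j) Q j in
  [/\ forall j, 0 <= Q j, 0 < A &
   `|\sum_(j < J | W j) u j * Q j - c * \sum_(j < J | W j) v j * Q j|
     <= e * A / Num.sqrt n%:R].
Proof.
move=> /andP[al0 albe] e e0.
have be0 : 0 < beta by exact: lt_trans albe.
pose m := (alpha + beta) / 2.
have m0 : 0 < m by rewrite /m; lra.
pose L : R := ln 2.
have L0 : 0 < L by rewrite ln_gt0// ltr1n.
have eL : expR (- L) = 2^-1 by rewrite expRN lnK// posrE.
(* This choice gives x^j = 1/2, the peak of the kernel, at j = m n, the middle of the window. *)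
pose tau := L / m.
have tau0 : 0 < tau by rewrite divr_gt0.
have taum : tau * m = L by rewrite /tau divfK// gt_eqF.
clearbody tau.
(* Right of the window y is at most the first entry; left of it 1 - y is at most the second. Either
   way y (1 - y) <= [rho] outside the window. *)
pose Y1 := Num.max (expR (- (tau * beta))) (1 - expR (- (tau * alpha))).
have Y10 : 0 < Y1 by rewrite lt_max expR_gt0.
have Y1h : Y1 < 2^-1.
  rewrite gt_max; apply/andP; split.
    by rewrite -eL ltr_expR ltrN2 -taum ltr_pM2l// /m; lra.
  have : 2^-1 < expR (- (tau * alpha)).
    by rewrite -eL ltr_expR ltrN2 -taum ltr_pM2l// /m; lra.
  by lra.
(* A level strictly between [Y1] and the peak. It is reached at j = m' n, still inside the window,
   so the kernel is at least kap^(r+1) for j between m n and m' n, with rho < kap. *)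
pose Y2 := (Y1 + 2^-1) / 2.
have Y20 : 0 < Y2 by rewrite /Y2; lra.
have Y12 : Y1 < Y2 by rewrite /Y2; lra.
have Y2h : Y2 < 2^-1 by rewrite /Y2; lra.
pose m' := - ln Y2 / tau.
have taum' : expR (- (tau * m')) = Y2.
  by rewrite /m' mulrC divfK ?gt_eqF// opprK lnK.
have mm' : m < m'.
  by rewrite -(ltr_pM2l tau0) -ltrN2 -ltr_expR taum' taum eL.
have m'be : m' < beta.
  rewrite -(ltr_pM2l tau0) -ltrN2 -ltr_expR taum'; apply: le_lt_trans Y12.
  by rewrite le_max lexx.
pose rho := Y1 * (1 - Y1); pose kap := Y2 * (1 - Y2).
have rho0 : 0 < rho by rewrite mulr_gt0// subr_gt0; lra.
have rhokap : rho < kap by rewrite /rho /kap; nra.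
have kap0 : 0 < kap by exact: lt_trans rhokap.
(* Half the width, since counting integers in an interval loses up to 1 and (m' - m) n will be at
   least 2. *)
pose theta := (m' - m) / 2.
have theta0 : 0 < theta by rewrite /theta; lra.
pose K := Num.sqrt (2 / tau).
have K0 : 0 < K by rewrite sqrtr_gt0 divr_gt0.
(* The tails are of relative size (rho / kap)^r against the weight inside the window; they receive
   one half of [e], and [e'] below the other half. *)
have [r Hr] : exists r, rho ^+ r * (2 * c + 1) * K <= e / 2 * theta * kap ^+ r.+1.
  pose del := e / 2 * theta * kap / ((2 * c + 1) * K).
  have c21 : 0 < 2 * c + 1 by rewrite ltr_wpDl// mulr_ge0.
  have del0 : 0 < del by rewrite /del; do ?[assumption | apply: divr_gt0 | apply: mulr_gt0].
  have q0 : 0 <= rho / kap by apply: divr_ge0; exact: ltW.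
  have q1 : `|rho / kap| < 1 by rewrite ger0_norm// ltr_pdivrMr// mul1r.
  have := cvg_expr q1; move/cvgr0Pnorm_le => /(_ _ del0)[r _ /(_ r (leqnn r))] /=.
  rewrite normrX (ger0_norm q0) expr_div_n => h.
  exists r; move: h; rewrite ler_pdivrMr ?exprn_gt0// /del mulrAC ler_pdivlMr ?mulr_gt0//.
  by rewrite exprS !mulrA.
pose e' := e / 2 * theta * kap ^+ r.+1 / K.
have e'0 : 0 < e' by rewrite /e'; do ?[assumption | apply: divr_gt0 | apply: mulr_gt0 | apply: exprn_gt0].
have [h1 h10 H1] := bump_sum_asymptotic u01 (ltn0Sn r) gen_fun_u e'0.
(* Tolerance 1 is enough here: it serves only for the crude bound (c + 1) / s on the generating
   function of [u]. *)
have [h2 h20 H2] := gen_fun_u (@ltr01 R).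
near=> n.
have ntau : tau < n%:R * Num.min (Num.min h1 h2) 1.
  rewrite -ltr_pdivrMr ?lt_min ?h10 ?h20 ?ltr01//.
  by near: n; exact: nbhs_infty_gtr.
have nn0 : (0 : R) < n%:R by near: n; exact: nbhs_infty_gtr.
have nmm : 2 <= (m' - m) * n%:R.
  by rewrite mulrC -ler_pdivrMr ?subr_gt0//; near: n; exact: nbhs_infty_ger.
pose h := tau / n%:R.
have h0 : 0 < h by rewrite divr_gt0.
have hmin : h < Num.min (Num.min h1 h2) 1 by rewrite ltr_pdivrMr// mulrC.
move: hmin; rewrite !lt_min => /andP[/andP[hh1 hh2] hh3].
pose x := expR (- h).
have x0 : 0 <= x by exact: expR_ge0.
have x1 : x < 1 by rewrite expR_lt1 oppr_lt0.
have x01 : 0 <= x < 1 by rewrite x0.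
have xh : 1 - h <= x by exact: expR_ge1Dx.
have xj j : x ^+ j = expR (- (tau * (j%:R / n%:R))).
  by rewrite /x -expRM_natl /h; congr expR; ring.
have sq : (Num.sqrt (1 - x))^-1 <= K * Num.sqrt n%:R.
  have t20 : 0 <= 2 / tau by apply: divr_ge0 => //; exact: ltW.
  have x1x : 0 <= 1 - x by rewrite subr_ge0 ltW.
  rewrite -sqrtrM// -sqrtrV// ler_wsqrtr//.
  have -> : 2 / tau * n%:R = (h / 2)^-1.
    by rewrite /h; field; rewrite !gt_eqF.
  rewrite lef_pV2 ?posrE ?subr_gt0 ?divr_gt0//.
  by apply: one_sub_expRN_ge; rewrite !ltW.
pose W j := alpha * n%:R <= j%:R <= beta * n%:R.
pose Q j := bump_kernel r.+1 (x ^+ j).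
pose J := (Num.truncn (beta * n%:R)).+1.
have y01 j : 0 <= x ^+ j <= 1 by rewrite exprn_ge0//= exprn_ile1// ltW.
have y0 j : 0 <= x ^+ j * (1 - x ^+ j).
  by case/andP: (y01 j) => a b; rewrite mulr_ge0// subr_ge0.
have Q0 j : 0 <= Q j by rewrite exprn_ge0.
exists J; exists Q; cbv zeta.
have WJ j : W j -> (j < J)%N.
  by case/andP=> _; rewrite ltnS -truncn_ge_nat// mulr_ge0// ltW.
have Wrho j : ~~ W j -> x ^+ j * (1 - x ^+ j) <= rho.
  rewrite negb_and -!ltNge => /orP[] jn.
    have yj : expR (- (tau * alpha)) <= x ^+ j.
      by rewrite xj ler_expR lerN2 ler_wpM2l ?(ltW tau0)// ler_pdivrMr// ltW.
    have -> : x ^+ j * (1 - x ^+ j) = (1 - x ^+ j) * (1 - (1 - x ^+ j)) by ring.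
    have : 1 - expR (- (tau * alpha)) <= Y1 by rewrite le_max lexx orbT.
    by move=> h3; apply: logistic_le; move: h3 yj Y1h; clear -u01 c0 gen_fun_u; lra.
  have yj : x ^+ j <= expR (- (tau * beta)).
    by rewrite xj ler_expR lerN2 ler_wpM2l ?(ltW tau0)// ler_pdivlMr// ltW.
  have : expR (- (tau * beta)) <= Y1 by rewrite le_max lexx.
  by move=> h3; apply: logistic_le; move: h3 yj Y1h; clear -u01 c0 gen_fun_u; lra.
have AQ : theta * n%:R * kap ^+ r.+1 <= \sum_(j < J | W j) Q j.
  have [a [b [ab abn abj]]] := @count_nat_interval (m * n%:R) (m' * n%:R)
    ltac:(by rewrite mulr_ge0 ?ltW) ltac:(by rewrite ler_wpM2r ?ltW).
  have inW j : (a <= j < b)%N -> W j.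
    move/abj/andP=> [j1 j2]; apply/andP; split.
      by apply: le_trans j1; rewrite ler_wpM2r// /m; move: albe; clear -u01 c0 gen_fun_u; lra.
    by apply: (le_trans j2); rewrite ler_wpM2r// ltW.
  have Qk j : (a <= j < b)%N -> kap ^+ r.+1 <= Q j.
    move/abj/andP=> [j1 j2]; rewrite /Q /bump_kernel lerXn2r ?nnegrE ?(ltW kap0)//.
    rewrite -subr_ge0.
    have yj : x ^+ j <= 2^-1.
      by rewrite xj -eL -taum ler_expR lerN2 ler_wpM2l ?(ltW tau0)// ler_pdivlMr.
    have yj' : Y2 <= x ^+ j.
      by rewrite xj -taum' ler_expR lerN2 ler_wpM2l ?(ltW tau0)// ler_pdivrMr.
    by rewrite subr_ge0; apply: logistic_le => //; move: yj Y2h; clear -u01 c0 gen_fun_u; lra.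
  have {}ab : (a < b)%N.
    rewrite -subn_gt0 -(ltr_nat R); apply: lt_le_trans abn.
    by move: nmm; clear -u01 c0 gen_fun_u; lra.
  have bJ : (b <= J)%N.
    by case: b ab {abn} abj inW Qk => // b ab abj inW Qk; apply/WJ/inW; rewrite ltnSn andbT -ltnS.
  have aJ : (a <= J)%N by apply: leq_trans bJ; exact: ltnW.
  apply: (@le_trans _ _ (\sum_(a <= j < b) kap ^+ r.+1)).
    rewrite sumr_const_nat -[leRHS]mulr_natl ler_wpM2r ?exprn_ge0 ?(ltW kap0)//.
    by apply: le_trans abn; rewrite /theta; move: nmm; clear -u01 c0 gen_fun_u; lra.
  apply: (@le_trans _ _ (\sum_(a <= j < b) Q j)).
    rewrite big_nat_cond [leRHS]big_nat_cond; apply: ler_sum => j /andP[jab _].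
    exact: Qk.
  rewrite -(big_mkord W Q) (big_cat_nat (n := a) _ aJ)//=.
  rewrite (big_cat_nat (n := b) (ltnW ab) bJ)//=.
  have -> : \sum_(a <= j < b) Q j = \sum_(a <= j < b | W j) Q j.
    rewrite big_nat_cond [RHS]big_nat_cond; apply: eq_bigl => j.
    by rewrite andbT; case: (boolP (a <= j < b)%N) => // /inW ->.
  by rewrite addrCA lerDl addr_ge0// sumr_ge0.
have th0 : 0 < theta * n%:R * kap ^+ r.+1 by do ?[assumption | apply: mulr_gt0 | apply: exprn_gt0].
have A0 : 0 < \sum_(j < J | W j) Q j by exact: lt_le_trans AQ.
split=> //.
have B1 := bump_sum_window r u01 x01 (ltW rho0) WJ Wrho.
have B2 := bump_sum_window r central_binomial_ratio_unit x01 (ltW rho0) WJ Wrho.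
have xh1 : 1 - h1 < x < 1 by rewrite x1 andbT (lt_le_trans _ xh)// ltrD2l ltrN2.
have xh2 : 1 - h2 < x < 1 by rewrite x1 andbT (lt_le_trans _ xh)// ltrD2l ltrN2.
have B3 := H1 x x0 xh1.
have B4 := H2 x x0 xh2.
pose A := \sum_(j < J | W j) Q j.
pose Uw := \sum_(j < J | W j) u j * Q j; pose Vw := \sum_(j < J | W j) v j * Q j.
change (`|Uw - c * Vw| <= e * A / Num.sqrt n%:R).
rewrite -/Uw in B1; rewrite -/Vw gen_fun_central_binomial_ratio// in B2.
move: B1 B2 B3 B4.
set Su := bump_sum u x r.+1; set Sv := bump_sum v x r.+1.
set s := Num.sqrt (1 - x); set U := gen_fun u x => B1 B2 B3 B4.
have s0 : 0 < s by rewrite sqrtr_gt0 subr_gt0.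
have U1 : U <= (c + 1) / s.
  by rewrite ler_pdivlMr// mulrC; move: B4; rewrite ler_norml => /andP[_]; clear -u01 c0 gen_fun_u; lra.
have B3' : `|Su - c * Sv| <= e' / s by rewrite ler_pdivlMr// mulrC.
have rr0 : 0 <= rho ^+ r by rewrite exprn_ge0// ltW.
(* The factor 2c + 1 adds c + 1 from the tail of [u] to c from c times the tail of [v]. *)
have step1 : `|Uw - c * Vw| <= (e' + rho ^+ r * (2 * c + 1)) / s.
  have -> : Uw - c * Vw = (Su - c * Sv) - (Su - Uw) + c * (Sv - Vw) by ring.
  apply: (le_trans (ler_normD _ _)); apply: (le_trans (lerD (ler_normB _ _) (lexx _))).
  rewrite normrM (ger0_norm c0).
  have : `|Su - Uw| <= rho ^+ r * ((c + 1) / s) by apply: (le_trans B1); rewrite ler_wpM2l.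
  have : c * `|Sv - Vw| <= c * (rho ^+ r * s^-1) by rewrite ler_wpM2l.
  have -> : (e' + rho ^+ r * (2 * c + 1)) / s =
    e' / s + rho ^+ r * ((c + 1) / s) + c * (rho ^+ r * s^-1) by ring.
  by move=> i1 i2; rewrite !lerD.
apply: (le_trans step1).
have sn0 : 0 < Num.sqrt (n%:R : R) by rewrite sqrtr_gt0.
have e'r : 0 <= e' + rho ^+ r * (2 * c + 1).
  by rewrite addr_ge0 ?(ltW e'0)// mulr_ge0// addr_ge0// mulr_ge0.
apply: (le_trans (ler_wpM2l e'r sq)).
have e'K : e' * K = e / 2 * theta * kap ^+ r.+1 by rewrite /e' divfK// gt_eqF.
apply: (@le_trans _ _ (e * (theta * n%:R * kap ^+ r.+1) / Num.sqrt n%:R)); last first.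
  by rewrite ler_wpM2r ?invr_ge0 ?sqrtr_ge0// ler_wpM2l ?(ltW e0).
rewrite ler_pdivlMr//.
have -> : (e' + rho ^+ r * (2 * c + 1)) * (K * Num.sqrt n%:R) * Num.sqrt n%:R =
  (e' * K + rho ^+ r * (2 * c + 1) * K) * Num.sqrt n%:R ^+ 2 by ring.
rewrite sqr_sqrtr ?(ltW nn0)// e'K.
have -> : e * (theta * n%:R * kap ^+ r.+1) =
  (e / 2 * theta * kap ^+ r.+1 + e / 2 * theta * kap ^+ r.+1) * n%:R by field.
by rewrite ler_wpM2r ?(ltW nn0)// lerD2l.
Unshelve. all: by end_near. Qed.

Hypothesis u_noninc : nonincreasing_seq u.

(** On the window from n / b^2 to n, monotonicity gives u j >= u n, while Wallis gives v j <= b /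
    sqrt(pi n). *)
Lemma tauberian_upper (b e : R) : 1 < b -> 0 < e ->
  \forall n \near \oo, Num.sqrt n%:R * u n <= c / Num.sqrt pi * b + e.
Proof.
move=> b1 e0; have b0 : 0 < b by exact: lt_trans b1.
have ab : 0 < b ^- 2 < 1 by rewrite invr_gt0 exprn_gt0//= invf_lt1 ?exprn_gt0// exprn_egt1.
have sp0 : 0 < Num.sqrt (pi : R) by rewrite sqrtr_gt0 pi_gt0.
have win := tauberian_window ab e0.
apply: filterS2 win (nbhs_infty_gtr (0 : R)) => n [J [Q H]] n0.
have sn0 : 0 < Num.sqrt (n%:R : R) by rewrite sqrtr_gt0.
pose A := \sum_(j < J | b ^- 2 * n%:R <= j%:R <= (1 : R) * n%:R) Q j.
move: H; cbv zeta; rewrite -/A => -[Q0 A0 H].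
rewrite mulrC -ler_pdivlMr// -(ler_pM2r A0).
have h1 : u n * A <= \sum_(j < J | b ^- 2 * n%:R <= j%:R <= (1 : R) * n%:R) u j * Q j.
  rewrite /A mulr_sumr; apply: ler_sum => j /andP[_ jn].
  by rewrite ler_wpM2r//; apply: u_noninc; rewrite mul1r ler_nat in jn.
have h2 : \sum_(j < J | b ^- 2 * n%:R <= j%:R <= (1 : R) * n%:R) v j * Q j <=
    b / (Num.sqrt pi * Num.sqrt n%:R) * A.
  rewrite /A mulr_sumr; apply: ler_sum => j /andP[jn _].
  rewrite ler_wpM2r// -(@ler_pXn2r _ 2) ?nnegrE ?(ltW (central_binomial_ratio_gt0 _))//; last first.
    by rewrite divr_ge0 ?mulr_ge0 ?sqrtr_ge0// ltW.
  rewrite expr_div_n exprMn !sqr_sqrtr ?pi_ge0 ?(ltW n0)//.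
  have j0 : (0 : R) < j%:R by apply: lt_le_trans jn; rewrite mulr_gt0//; case/andP: ab.
  rewrite ler_pdivlMr ?mulr_gt0 ?pi_gt0//.
  have w := @wallis_upper R j.
  have nj : n%:R <= b ^+ 2 * j%:R by rewrite -ler_pdivrMl// exprn_gt0.
  apply: (@le_trans _ _ (v j ^+ 2 * pi * (b ^+ 2 * j%:R))).
    by rewrite [leLHS]mulrA ler_wpM2l// mulr_ge0 ?pi_ge0// sqr_ge0.
  have -> : v j ^+ 2 * pi * (b ^+ 2 * j%:R) = b ^+ 2 * (pi * j%:R * v j ^+ 2) by ring.
  by rewrite ler_piMr// sqr_ge0.
have h3 := ler_wpM2l c0 h2.
move: H; rewrite ler_norml => /andP[_ H].
apply: (le_trans h1).
have -> : (c / Num.sqrt pi * b + e) / Num.sqrt n%:R * A =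
  c * (b / (Num.sqrt pi * Num.sqrt n%:R) * A) + e * A / Num.sqrt n%:R.
  by field; rewrite !gt_eqF.
by lra.
Qed.

(** On the window from n to b n, monotonicity gives u j <= u n, while Wallis gives v j >= 1 / (b
    sqrt(pi n)). *)
Lemma tauberian_lower (b e : R) : 1 < b -> 0 < e ->
  \forall n \near \oo, c / Num.sqrt pi / b - e <= Num.sqrt n%:R * u n.
Proof.
move=> b1 e0; have b0 : 0 < b by exact: lt_trans b1.
have ab : (0 : R) < 1 < b by rewrite ltr01.
have sp0 : 0 < Num.sqrt (pi : R) by rewrite sqrtr_gt0 pi_gt0.
have bb : 0 < b * (b - 1) by rewrite mulr_gt0// subr_gt0.
have win := tauberian_window ab e0.
(* The threshold on n makes b n + 1/2 <= b^2 n, which absorbs the 1/2 of the lower Wallis bound. *)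
apply: filterS3 win (nbhs_infty_gtr (0 : R))
  (nbhs_infty_ger (2^-1 / (b * (b - 1)) : R)) => n [J [Q H]] n0.
rewrite ler_pdivrMr// => nb.
have sn0 : 0 < Num.sqrt (n%:R : R) by rewrite sqrtr_gt0.
pose A := \sum_(j < J | (1 : R) * n%:R <= j%:R <= b * n%:R) Q j.
move: H; cbv zeta; rewrite -/A => -[Q0 A0 H].
rewrite [leRHS]mulrC -ler_pdivrMr// -(ler_pM2r A0).
have h1 : \sum_(j < J | (1 : R) * n%:R <= j%:R <= b * n%:R) u j * Q j <= u n * A.
  rewrite /A mulr_sumr; apply: ler_sum => j /andP[jn _].
  by rewrite ler_wpM2r//; apply: u_noninc; rewrite mul1r ler_nat in jn.
have h2 : 1 / (b * (Num.sqrt pi * Num.sqrt n%:R)) * A <=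
    \sum_(j < J | (1 : R) * n%:R <= j%:R <= b * n%:R) v j * Q j.
  rewrite /A mulr_sumr; apply: ler_sum => j /andP[_ jn].
  rewrite ler_wpM2r// -(@ler_pXn2r _ 2) ?nnegrE ?(ltW (central_binomial_ratio_gt0 _))//; last first.
    by rewrite divr_ge0 ?mulr_ge0 ?sqrtr_ge0// ltW.
  rewrite expr_div_n expr1n !exprMn !sqr_sqrtr ?pi_ge0 ?(ltW n0)//.
  rewrite ler_pdivrMr ?mulr_gt0 ?exprn_gt0 ?pi_gt0//.
  apply: (le_trans (@wallis_lower R j)).
  rewrite [leLHS]mulrC ler_wpM2l ?sqr_ge0// mulrCA ler_wpM2l ?pi_ge0//.
  by apply: (@le_trans _ _ (b * n%:R + 2^-1)); rewrite ?lerD2r// expr2; lra.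
have h3 := ler_wpM2l c0 h2.
move: H; rewrite ler_norml => /andP[H _].
apply: le_trans h1.
have -> : (c / Num.sqrt pi / b - e) / Num.sqrt n%:R * A =
  c * (1 / (b * (Num.sqrt pi * Num.sqrt n%:R)) * A) - e * A / Num.sqrt n%:R.
  by field; rewrite !gt_eqF.
by lra.
Qed.

Theorem tauberian : Num.sqrt n%:R * u n @[n --> \oo] --> c / Num.sqrt pi.
Proof.
apply/cvgrPdist_le => e e0.
have sp0 : 0 < Num.sqrt (pi : R) by rewrite sqrtr_gt0 pi_gt0.
set k := c / Num.sqrt pi.
have k0 : 0 <= k by rewrite divr_ge0 ?sqrtr_ge0.
have k1 : 0 < k + 1 by rewrite ltr_wpDl.
pose del := e / 2 / (k + 1).
have del0 : 0 < del by rewrite /del; do 2 apply: divr_gt0 => //.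
have kdel : k * del <= e / 2.
  by rewrite /del mulrCA ler_piMr ?divr_ge0 ?(ltW e0)// ler_pdivrMr// mul1r lerDl.
have b1 : 1 < 1 + del by rewrite ltrDl.
have e20 : 0 < e / 2 by rewrite divr_gt0.
near=> n.
have hi : Num.sqrt n%:R * u n <= k * (1 + del) + e / 2.
  by near: n; exact: tauberian_upper.
have lo : k / (1 + del) - e / 2 <= Num.sqrt n%:R * u n.
  by near: n; exact: tauberian_lower.
have inv : k * (1 - del) <= k / (1 + del).
  rewrite ler_wpM2l// -[leRHS]div1r ler_pdivlMr ?(lt_trans _ b1)//.
  by have := mulr_gt0 del0 del0; lra.
by rewrite ler_norml; lra.
Unshelve. all: by end_near. Qed.

End Window.
End TauberianLimit.

(** * Generating functions from approximate eigenfunctions *)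

Section PerturbedEigenfunction.
Context {R : realType}.
Variables (u : R^nat) (phi : R -> R^nat) (g : R).
Hypothesis g0 : 0 < g.
Hypothesis u01 : unit_seq u.
Hypothesis u_0 : u 0%N = 1.
Hypothesis phi01 : forall a n, 0 < a -> 0 <= phi a n <= 1.
Hypothesis phi_0 : forall a, phi a 0%N = expR (- a).

(* In the application [u n] is the probability that the gap is positive after n
   steps and [phi a n] the expectation of [expR (- a * gap)] on that event. If
   [expR (- a * _)] were an eigenfunction for the eigenvalue [lam] away from 0,
   the summand would vanish. *)
Lemma sum_perturbed_eigenfunction (x lam a : R) n : lam * x = 1 ->
  \sum_(k < n) x ^+ k.+1 * (phi a k.+1 - u k.+1 + u k - lam * phi a k) =
  x ^+ n * (phi a n - u n) - expR (- a) + 1 - (1 - x) * \sum_(k < n) u k * x ^+ k.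
Proof.
move=> lx; elim: n => [|n IH].
  by rewrite !big_ord0 expr0 phi_0 u_0; ring.
rewrite big_ord_recr /= IH [in RHS]big_ord_recr /= exprS.
transitivity (x ^+ n * (phi a n - u n) - expR (- a) + 1 -
   (1 - x) * (\sum_(i < n) u i * x ^+ i) +
   x * x ^+ n * (phi a n.+1 - u n.+1 + u n) - lam * x * (x ^+ n * phi a n)); first by ring.
by rewrite lx; ring.
Qed.

(** In the limit of the summed identity the boundary term in x^n disappears. The weights x^(k+1) are
    bounded by x^k in front of [u k], which rebuilds the generating function, and by 1 in front of
    [w k]. *)
Lemma gen_fun_perturbed_eigenfunction (x lam a : R) (eta C : R) (w : R^nat) :
  0 < a -> 0 <= x < 1 -> lam * x = 1 -> 0 <= eta ->
  (forall n, 0 <= w n) -> (forall n, \sum_(k < n) w k <= C) ->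
  (forall n, `|phi a n.+1 - u n.+1 + u n - lam * phi a n| <= a ^+ 2 * (eta * u n + w n)) ->
  `|1 - expR (- a) - (1 - x) * gen_fun u x| <= a ^+ 2 * (eta * gen_fun u x + C).
Proof.
move=> a0 x01 lx eta0 w0 wC H; have /andP[x0 x1] := x01.
have lim : x ^+ n * (phi a n - u n) - expR (- a) + 1 -
    (1 - x) * series (fun j => u j * x ^+ j) n @[n --> \oo] -->
    0 - expR (- a) + 1 - (1 - x) * gen_fun u x.
  apply: cvgB; last by apply: cvgMl_tmp; exact: cvg_gen_fun.
  apply: cvgD; last exact: cvg_cst.
  apply: cvgB; last exact: cvg_cst.
  have x1n : `|x| < 1 by rewrite ger0_norm.
  apply/cvgr0Pnorm_le => e e0; have /cvgr0Pnorm_le/(_ _ e0) := cvg_expr x1n.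
  apply: filterS => n; apply: le_trans; rewrite normrM ler_piMr//.
  have /andP[p1 p2] := phi01 n a0; have /andP[u1 u2] := u01 n.
  by rewrite ler_norml; lra.
have -> : 1 - expR (- a) - (1 - x) * gen_fun u x =
  0 - expR (- a) + 1 - (1 - x) * gen_fun u x by ring.
apply: (cvgr_to_le (cvg_norm lim)); apply: nearW => n.
rewrite /series /= big_mkord -(sum_perturbed_eigenfunction _ _ lx).
apply: (le_trans (ler_norm_sum _ _ _)).
apply: (@le_trans _ _ (\sum_(k < n) a ^+ 2 * (eta * (u k * x ^+ k) + w k))).
  apply: ler_sum => k _; rewrite normrM ger0_norm ?exprn_ge0//.
  apply: (le_trans (ler_wpM2l (exprn_ge0 _ x0) (H k))).
  rewrite mulrCA ler_wpM2l ?sqr_ge0//.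
  have /andP[u1 u2] := u01 k.
  have xk1 : x ^+ k.+1 <= 1 by rewrite exprn_ile1// ltW.
  rewrite mulrDr lerD ?ler_piMl ?exprn_ge0//.
  rewrite mulrCA ler_wpM2l// mulrC ler_wpM2l//.
  by rewrite exprS ler_piMl ?exprn_ge0// ltW.
rewrite -mulr_sumr ler_wpM2l ?sqr_ge0// big_split /= -mulr_sumr lerD//.
  by rewrite ler_wpM2l// gen_fun_ge_partial.
exact: wC.
Qed.

(** With q = sqrt x and P = sqrt(1 - x) U one has (1 - x) U = a g q P, so the hypothesis can be
    divided by a. It first yields the crude bound g P <= 8, and that bound makes its own error terms
    small: 8 (1 - x) pays for replacing q by 1, the next term for eta, the last one for C and for 1
    - exp(-a) against a. *)
Lemma sqrt_gen_fun_bound (x a eta C U : R) : 0 < a -> 4^-1 <= x < 1 ->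
  1 - x = g ^+ 2 * a ^+ 2 * x -> 0 <= U -> 0 <= eta -> 8 * eta <= g ^+ 2 -> a * C <= 1 ->
  `|1 - expR (- a) - (1 - x) * U| <= a ^+ 2 * (eta * U + C) ->
  `|g * (Num.sqrt (1 - x) * U) - 1| <=
    8 * (1 - x) + 16 * eta / g ^+ 2 + a * (C + 1).
Proof.
move=> a0 /andP[x4 x1] e U0 eta0 etag aC.
have x0 : 0 < x by lra.
pose q := Num.sqrt x.
have q2 : q ^+ 2 = x by rewrite sqr_sqrtr// ltW.
have q0 : 0 < q by rewrite sqrtr_gt0.
have qh : 2^-1 <= q.
  rewrite -(@ler_pXn2r _ 2) ?nnegrE ?(ltW q0)// q2.
  by apply: le_trans x4; rewrite expr2 -invfM -natrM.
have q1 : q <= 1 by rewrite -(@ler_pXn2r _ 2) ?nnegrE ?(ltW q0)// q2 expr1n ltW.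
have s : Num.sqrt (1 - x) = g * a * q.
  by rewrite e -q2 -!exprMn sqrtr_sqr ger0_norm// !mulr_ge0// ltW.
rewrite s; set P := g * a * q * U.
have P0 : 0 <= P by rewrite !mulr_ge0// ltW.
have eU : (1 - x) * U = a * (g * q * P) by rewrite e -q2 /P; ring.
have aU : a ^+ 2 * (eta * U + C) = a * (eta / (g * q) * P + a * C).
  by rewrite /P; field; rewrite !gt_eqF.
rewrite eU aU => H.
have e1 : 1 - expR (- a) <= a by have := expR_ge1Dx (- a); lra.
have e2 : a * (1 - a) <= 1 - expR (- a).
  have := expRxMexpNx_1 a; have := expR_ge1Dx a; have := expR_ge1Dx (- a).
  have := expR_gt0 (- a); move=> i1 i2 i3 i4.
  have : expR (- a) * (1 + a) <= 1 by rewrite -[leRHS]i4 [leLHS]mulrC ler_wpM2r// ltW.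
  by nra.
have etaq : eta / (g * q) * P <= 2 * eta / g * P.
  rewrite ler_wpM2r// ler_pdivrMr ?mulr_gt0//.
  have -> : 2 * eta / g * (g * q) = eta * (2 * q) by field; rewrite gt_eqF.
  by rewrite ler_peMr//; lra.
have H1 : g * q * P <= 1 + 2 * eta / g * P + a * C.
  move: H; rewrite ler_norml => /andP[H _].
  have : a * (g * q * P) <= a * (1 + 2 * eta / g * P + a * C).
    by have := ler_wpM2l (ltW a0) etaq; lra.
  by rewrite ler_pM2l.
have H1' : 1 - a - 2 * eta / g * P - a * C <= g * q * P.
  move: H; rewrite ler_norml => /andP[_ H].
  have : a * (1 - a - 2 * eta / g * P - a * C) <= a * (g * q * P).
    by have := ler_wpM2l (ltW a0) etaq; lra.
  by rewrite ler_pM2l.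
have gP : g * P <= 8.
  have k1 : g * P / 2 <= g * q * P.
    by rewrite [leRHS]mulrAC ler_wpM2l// mulr_ge0// ltW.
  have k2 : 2 * eta / g * P <= g * P / 4.
    rewrite -[leRHS]mulrAC ler_wpM2r// ler_pdivrMr// mulrAC -expr2; lra.
  by lra.
have k3 : 2 * eta / g * P <= 16 * eta / g ^+ 2.
  have -> : 2 * eta / g * P = 2 * eta / g ^+ 2 * (g * P) by field; rewrite gt_eqF.
  have : 2 * eta / g ^+ 2 * (g * P) <= 2 * eta / g ^+ 2 * 8.
    by rewrite ler_wpM2l// divr_ge0 ?sqr_ge0// mulr_ge0.
  by lra.
have k4 : g * P * (1 - q) <= 8 * (1 - x).
  have : g * P * (1 - q) <= 8 * (1 - q) by rewrite ler_wpM2r// subr_ge0.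
  have : x <= q by rewrite -q2 expr2 ler_piMl// ltW.
  by lra.
have k5 : 0 <= g * P * (1 - q)
  by apply: mulr_ge0; [rewrite mulr_ge0 ?(ltW g0) | rewrite subr_ge0].
rewrite ler_norml; apply/andP; split; lra.
Qed.

(** The order of quantifiers matters: [w] and [C] may depend on [eta] but not on [a], so that a C
    tends to 0. The term in [eta] accounts for large gaps, [w] for small ones. *)
Hypothesis perturbed : forall eta, 0 < eta -> exists (w : R^nat) (C a1 : R),
  [/\ 0 < a1, forall n, 0 <= w n, forall n, \sum_(k < n) w k <= C &
      forall a, 0 < a < a1 -> forall n,
      `|phi a n.+1 - u n.+1 + u n - (1 + g ^+ 2 * a ^+ 2) * phi a n|
        <= a ^+ 2 * (eta * u n + w n)].

Lemma gen_fun_asymptotic e : 0 < e -> exists2 h, 0 < h & forall x, 0 <= x -> 1 - h < x < 1 ->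
    `|Num.sqrt (1 - x) * gen_fun u x - 1 / g| <= e.
Proof.
move=> e0.
have eg : 0 < e * g by rewrite mulr_gt0.
have g2 : 0 < g ^+ 2 by rewrite exprn_gt0.
pose eta := Num.min (g ^+ 2 / 8) (e * g * g ^+ 2 / 64).
have eta0 : 0 < eta by rewrite lt_min !divr_gt0// mulr_gt0.
have eta1 : 8 * eta <= g ^+ 2.
  have : eta <= g ^+ 2 / 8 by rewrite ge_min lexx.
  by lra.
have eta2 : 16 * eta / g ^+ 2 <= e * g / 4.
  rewrite ler_pdivrMr//.
  have : eta <= e * g * g ^+ 2 / 64 by rewrite ge_min lexx orbT.
  by lra.
have [w [C [a1 [a10 w0 wC H]]]] := perturbed eta0.
have C0 : 0 <= C by apply: le_trans (wC 0%N); rewrite big_ord0.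
pose del := Num.min a1 (Num.min (C + 1)^-1 (e * g / 4 / (C + 1))).
have C1 : 0 < C + 1 by rewrite ltr_wpDl.
have del0 : 0 < del by rewrite !lt_min a10 invr_gt0 C1 !divr_gt0.
pose h := Num.min (Num.min (3 / 4) (e * g / 32)) ((del * g / 2) ^+ 2).
exists h; first by rewrite !lt_min exprn_gt0 ?divr_gt0 ?mulr_gt0.
move=> x x0 /andP[xh x1].
have h1 : 1 - x < h by lra.
move: h1; rewrite !lt_min => /andP[/andP[h1 h2] h3].
have x4 : 4^-1 <= x by lra.
have xp : 0 < x by lra.
(* The solution of (1 + g^2 a^2) x = 1. *)
pose a := Num.sqrt ((1 - x) / x) / g.
have xx : 0 < (1 - x) / x by rewrite divr_gt0// subr_gt0.
have a0 : 0 < a by rewrite divr_gt0// sqrtr_gt0.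
have ga : g ^+ 2 * a ^+ 2 = (1 - x) / x.
  by rewrite -exprMn /a mulrC divfK ?gt_eqF// sqr_sqrtr// ltW.
have ea : 1 - x = g ^+ 2 * a ^+ 2 * x by rewrite ga divfK// gt_eqF.
have adel : a < del.
  rewrite ltr_pdivrMr// -(@ltr_pXn2r _ 2) ?nnegrE ?sqrtr_ge0 ?mulr_ge0 ?(ltW del0) ?(ltW g0)//.
  rewrite sqr_sqrtr ?(ltW xx)// ltr_pdivrMr//.
  apply: (@lt_le_trans _ _ ((del * g) ^+ 2 / 4)).
    by move: h3; rewrite !exprMn exprVn; lra.
  by rewrite ler_wpM2l ?sqr_ge0.
move: adel; rewrite !lt_min => /andP[aa1 /andP[aC1 aC2]].
have aC : a * (C + 1) <= 1 by rewrite -ler_pdivlMr// div1r ltW.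
have aC' : a * (C + 1) <= e * g / 4 by rewrite -ler_pdivlMr// ltW.
have lx : (1 + g ^+ 2 * a ^+ 2) * x = 1 by rewrite mulrDl mul1r -ea; ring.
have a01 : 0 < a < a1 by rewrite a0.
have x01 : 0 <= x < 1 by rewrite x0.
have x41 : 4^-1 <= x < 1 by rewrite x4.
have B := gen_fun_perturbed_eigenfunction a0 x01 lx (ltW eta0) w0 wC (H a a01).
have aC'' : a * C <= 1 by lra.
have := sqrt_gen_fun_bound a0 x41 ea (gen_fun_ge0 u01 x01) (ltW eta0) eta1 aC'' B.
set P := Num.sqrt (1 - x) * gen_fun u x => K.
have -> : P - 1 / g = (g * P - 1) / g by field; rewrite gt_eqF.
rewrite normrM normfV (gtr0_norm g0) ler_pdivrMr//.
by apply: (le_trans K); lra.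
Qed.

End PerturbedEigenfunction.

(** * The monotone flow *)

Section Steps.
Implicit Types (b : vertex -> bool) (s : vertex -> int) (t x y : int) (n : nat).

Definition step b s t x : int := (next_vertex b s (x, t)).1.

Fixpoint flow b s t n x : int :=
  if n is n'.+1 then step b s (t + n'%:Z) (flow b s t n' x) else x.

Lemma next_vertexE b s t x : next_vertex b s (x, t) = (step b s t x, t + 1).
Proof. by rewrite /step /next_vertex; case: ifP => // _; case: ifP. Qed.

Lemma iter_next_vertex b s t x n :
  iter n (next_vertex b s) (x, t) = (flow b s t n x, t + n%:Z).
Proof.
elim: n => [|n IH]; first by rewrite /= addr0.
by rewrite iterS IH next_vertexE; congr (_, _); rewrite -addn1 PoszD addrA.
Qed.

Lemma flowSr b s t n x : flow b s t n.+1 x = flow b s (t + 1) n (step b s t x).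
Proof.
elim: n => [|n IH]; first by rewrite /= addr0.
rewrite [LHS]/= -/(flow b s t n.+1 x) IH /=; congr step.
by rewrite -addn1 PoszD; lia.
Qed.

Lemma candidate_distP b t x n :
  candidate_dist b (x, t) n <-> b (x + n%:Z, t + 1) \/ b (x - n%:Z, t + 1).
Proof.
split=> [[k /= bk <-]|[bk|bk]]; [|by exists n%:Z|].
  case: (leP 0 k) => k0; [left|right].
    by rewrite gez0_abs.
  by rewrite ltz0_abs// opprK.
by exists (- n%:Z) => //=; rewrite abszN.
Qed.

Definition row_open b t := exists x, b (x, t).

Lemma nearest_distP b t x : row_open b (t + 1) ->
  candidate_dist b (x, t) (nearest_dist b (x, t)) /\
  forall j, candidate_dist b (x, t) j -> (nearest_dist b (x, t) <= j)%N.
Proof.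
move=> [y by1]; rewrite /nearest_dist.
have ex : exists j, `[< candidate_dist b (x, t) j >].
  exists `|y - x|%N; apply/asboolP; exists (y - x) => //=.
  by rewrite addrC subrK.
case: xgetP => [j -> //|].
case: (ex_minnP ex) => j /asboolP cj jmin /(_ j) [].
by split=> // i /asboolP; exact: jmin.
Qed.

Lemma nearest_dist_closed b t x : ~ row_open b (t + 1) -> nearest_dist b (x, t) = 0%N.
Proof.
move=> nb; rewrite /nearest_dist; case: xgetP => // j _ [/candidate_distP[] bj];
  by exfalso; apply: nb; eexists; exact: bj.
Qed.

(** The default distance 0 leaves the walker in its column, so the flow stays monotone on
    configurations with closed rows too. *)
Lemma step_closed b s t x : ~ row_open b (t + 1) -> step b s t x = x.
Proof.
move=> nb; rewrite /step /next_vertex nearest_dist_closed// subr0.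
case: ifPn => [_|/negPn bx] //.
by exfalso; apply: nb; exists x.
Qed.

Definition signs s := forall u, s u = 1 \/ s u = -1.

(* A description of [step b s t x = y] that only involves the vertices of the
   row at distance at most [|y - x|] from [x]. *)
Definition step_rel b s t x y : Prop :=
  [/\ b (y, t + 1),
      forall z, (`|z - x| < `|y - x|)%N -> ~~ b (z, t + 1) &
      b (x + x - y, t + 1) -> y = x + s (x, t) * `|y - x|%N%:Z].

Lemma step_relP b s t x : signs s -> row_open b (t + 1) ->
  step_rel b s t x (step b s t x).
Proof.
move=> sg ro; have [/candidate_distP c cmin] := nearest_distP x ro.
rewrite /step /next_vertex /=; set k := nearest_dist b (x, t) in c cmin *.
have closed z : (`|z - x| < k)%N -> ~~ b (z, t + 1).
  move=> zk; apply/negP => bz; have : candidate_dist b (x, t) `|z - x|%N.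
    by exists (z - x) => //=; rewrite addrC subrK.
  by move/cmin; rewrite leqNgt zk.
have ap : x + k%:Z - x = k%:Z by rewrite addrC addKr.
have am : x - k%:Z - x = - k%:Z by rewrite addrC addKr.
have rp : x + x - (x + k%:Z) = x - k%:Z by lia.
have rm : x + x - (x - k%:Z) = x + k%:Z by lia.
case: ifPn => [nb|/negPn bm] /=.
  have bp : b (x + k%:Z, t + 1) by case: c => // bm; rewrite bm in nb.
  split=> //; rewrite ?ap ?rp //.
  by move=> bm; rewrite bm in nb.
case: ifPn => [nb|/negPn bp] /=.
  split=> //; rewrite ?am ?rm ?abszN //.
  by move=> bp; rewrite bp in nb.
by case: (sg (x, t)) => e; rewrite e ?mul1r ?mulN1r;
  split=> //; rewrite ?ap ?am ?rp ?rm ?abszN ?e ?mul1r ?mulN1r.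
Qed.

(** Both targets are at the same minimal distance. If they differ they are mirror images, both open,
    and the sign at (x, t) decides for both. *)
Lemma step_rel_uniq b s t x y y' : step_rel b s t x y -> step_rel b s t x y' -> y = y'.
Proof.
move=> [by1 cy sy] [by2 cy' sy'].
have d1 : (`|y - x| <= `|y' - x|)%N.
  by rewrite leqNgt; apply/negP => /cy; rewrite by2.
have d2 : (`|y' - x| <= `|y - x|)%N.
  by rewrite leqNgt; apply/negP => /cy'; rewrite by1.
have dd : `|y - x|%N = `|y' - x|%N by apply/eqP; rewrite eqn_leq d1 d2.
have [//|e] : y = y' \/ x + x - y = y' by lia.
have e' : x + x - y' = y by lia.
have h1 : y = x + s (x, t) * `|y - x|%N%:Z by apply: sy; rewrite e.
have h2 : y' = x + s (x, t) * `|y' - x|%N%:Z by apply: sy'; rewrite e'.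
by rewrite h1 [RHS]h2 dd.
Qed.

Lemma step_eq b s t x y : signs s -> row_open b (t + 1) ->
  step_rel b s t x y -> step b s t x = y.
Proof. by move=> sg ro; apply: step_rel_uniq; exact: step_relP. Qed.

Lemma step_open b s t x : signs s -> row_open b (t + 1) -> b (step b s t x, t + 1).
Proof. by move=> sg ro; case: (step_relP x sg ro). Qed.

Lemma step_above b s t x : signs s -> b (x, t + 1) -> step b s t x = x.
Proof.
move=> sg bx; apply: step_eq => //; first by exists x.
split=> //; rewrite subrr; first by move=> z; rewrite absz0.
by move=> _; rewrite absz0 mulr0 addr0.
Qed.

(** If the images crossed, the two nearest-site inequalities would have to be equalities, and the
    same pair of sites would have both x and y as its midpoint. *)
Lemma step_mono b s t x y : signs s -> x <= y -> step b s t x <= step b s t y.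
Proof.
move=> sg xy; have [ro|nro] := pselect (row_open b (t + 1)); last by rewrite !step_closed.
have [<-//|/eqP xny] := eqVneq x y.
have [b1 c1 _] := step_relP x sg ro; have [b2 c2 _] := step_relP y sg ro.
rewrite leNgt; apply/negP => lt.
have h1 : ~ (`|step b s t y - x| < `|step b s t x - x|)%N by move/c1; rewrite b2.
have h2 : ~ (`|step b s t x - y| < `|step b s t y - y|)%N by move/c2; rewrite b1.
by lia.
Qed.

Lemma flow_mono b s t n x y : signs s -> x <= y -> flow b s t n x <= flow b s t n y.
Proof. by move=> sg xy; elim: n => //= n; exact: step_mono. Qed.

Lemma flow_open b s t n x : signs s -> (forall t', row_open b t') ->
  b (flow b s t n.+1 x, t + n.+1%:Z).
Proof.
by move=> sg ro; rewrite /= -addn1 PoszD addrA; exact: step_open.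
Qed.

Lemma next_vertex_local b s b' s' t x :
  (forall y, b (y, t + 1) = b' (y, t + 1)) -> s (x, t) = s' (x, t) ->
  next_vertex b s (x, t) = next_vertex b' s' (x, t).
Proof.
move=> eb es; have ec : candidate_dist b (x, t) = candidate_dist b' (x, t).
  by apply/seteqP; split=> k /candidate_distP; [rewrite !eb|rewrite -!eb] => ?;
    apply/candidate_distP.
by rewrite /next_vertex /nearest_dist ec /= !eb es.
Qed.

(** Openness is read on rows t + 1 to t + n but signs on rows t to t + n - 1; the same offset
    reappears where past and future are separated. *)
Lemma flow_local b s b' s' t n x :
  (forall y t', t < t' <= t + n%:Z -> b (y, t') = b' (y, t')) ->
  (forall y t', t <= t' < t + n%:Z -> s (y, t') = s' (y, t')) ->
  flow b s t n x = flow b' s' t n x.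
Proof.
elim: n => //= n IH eb es; rewrite IH => [|y t' ?|y t' ?]; last 2 first.
- by apply: eb; lia.
- by apply: es; lia.
by rewrite /step (@next_vertex_local b s b' s')// => [y|]; [apply: eb|apply: es]; lia.
Qed.

Lemma step_shift b s (z r : int) t x :
  step (fun u => b (u.1 + z, u.2 + r)) (fun u => s (u.1 + z, u.2 + r)) t x =
  step b s (t + r) (x + z) - z.
Proof.
rewrite /step.
set b' := (fun u : vertex => b _); set s' := (fun u : vertex => s _).
have eb y : b' (y, t + 1) = b (y + z, t + r + 1) by rewrite /b' /= addrAC.
have ec : candidate_dist b' (x, t) = candidate_dist b (x + z, t + r).
  by apply/seteqP; split=> k /candidate_distP h; apply/candidate_distP;
    move: h; rewrite !eb addrAC [x - _ + _]addrAC.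
have en : nearest_dist b' (x, t) = nearest_dist b (x + z, t + r).
  by rewrite /nearest_dist ec.
rewrite /next_vertex /= en.
set k := nearest_dist _ _; rewrite !eb /s' /=.
rewrite [x - k%:Z + z]addrAC [x + k%:Z + z]addrAC.
by case: ifP => _ /=; [|case: ifP => _ /=]; rewrite ?addrK// addrAC ?addrK//.
Qed.

End Steps.

(** * Law of the configuration *)

Section MeasurablePredicates.
Context d (T : measurableType d).
Implicit Types (Q : T -> Prop).

(** Measurability for predicates in [Prop]: with closure under connectives and countable
    quantifiers, events are handled by their logical form. *)
Definition mpred Q := measurable [set x | Q x].

Lemma mpred_cst (A : Prop) : mpred (fun=> A).
Proof.
rewrite /mpred; have [a|na] := pselect A.
  by rewrite (_ : [set _ | _] = setT)//; apply/seteqP; split.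
by rewrite (_ : [set _ | _] = set0)//; apply/seteqP; split.
Qed.

Lemma mpred_not Q : mpred Q -> mpred (fun x => ~ Q x).
Proof. exact: measurableC. Qed.

Lemma mpred_and Q1 Q2 : mpred Q1 -> mpred Q2 -> mpred (fun x => Q1 x /\ Q2 x).
Proof. exact: measurableI. Qed.

Lemma mpred_or Q1 Q2 : mpred Q1 -> mpred Q2 -> mpred (fun x => Q1 x \/ Q2 x).
Proof. exact: measurableU. Qed.

Lemma mpred_ext Q1 Q2 : (forall x, Q1 x <-> Q2 x) -> mpred Q1 -> mpred Q2.
Proof.
move=> e; rewrite /mpred (_ : [set x | Q2 x] = [set x | Q1 x])//.
by apply/seteqP; split=> x /= /e.
Qed.

Lemma mpred_exists (I : countType) (Q : I -> T -> Prop) :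
  (forall i, mpred (Q i)) -> mpred (fun x => exists i, Q i x).
Proof.
move=> mQ; pose A n := if @choice.unpickle I n is Some i then [set x | Q i x] else set0.
rewrite /mpred (_ : [set x | _] = \bigcup_n A n).
  by apply: bigcupT_measurable => n; rewrite /A; case: choice.unpickle.
apply/seteqP; split=> x /=.
  by case=> i Qi; exists (choice.pickle i) => //; rewrite /A choice.pickleK.
by case=> n _; rewrite /A; case: choice.unpickle => // i Qi; exists i.
Qed.

Lemma mpred_imp Q1 Q2 : mpred Q1 -> mpred Q2 -> mpred (fun x => Q1 x -> Q2 x).
Proof.
move=> m1 m2; apply: mpred_ext (mpred_or (mpred_not m1) m2) => x.
split=> [[nq q|//]|h]; first by [].
by have [/h|] := pselect (Q1 x); [right|left].
Qed.

Lemma mpred_forall (I : countType) (Q : I -> T -> Prop) :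
  (forall i, mpred (Q i)) -> mpred (fun x => forall i, Q i x).
Proof.
move=> mQ; apply: mpred_ext (mpred_not (mpred_exists (fun i => mpred_not (mQ i)))) => x.
split=> [nex i|h [i]]; last by apply; exact: h.
by apply: contrapT => nQ; apply: nex; exists i.
Qed.

Lemma mpred_comp (I : countType) (f : T -> I) (A : I -> Prop) :
  (forall i, mpred (fun x => f x = i)) -> mpred (fun x => A (f x)).
Proof.
move=> mf; have := mpred_exists (fun i => mpred_and (mf i) (mpred_cst (A i))).
by apply: mpred_ext => x; split=> [[i [<-]]//|Af]; exists (f x).
Qed.

Lemma measurable_fun_countable (I : countType) d' (Y : measurableType d') (f : T -> I)
    (g : I -> Y) :
  (forall i, mpred (fun x => f x = i)) -> measurable_fun setT (fun x => g (f x)).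
Proof.
by move=> mf _ A mA; rewrite setTI; exact: (mpred_comp (fun i => A (g i)) mf).
Qed.

Lemma mpred_measurable_fun (I : countType) (f : T -> I) (h : I -> T -> Prop) :
  (forall i, mpred (fun x => f x = i)) -> (forall i, mpred (h i)) ->
  mpred (fun x => h (f x) x).
Proof.
move=> mf mh; have := mpred_exists (fun i => mpred_and (mf i) (mh i)).
by apply: mpred_ext => x; split=> [[i [<-]]//|hx]; exists (f x).
Qed.

End MeasurablePredicates.

Section CountableUnions.
Context (R : realType) d (T : measurableType d) (mu : {measure set T -> \bar R}).

Lemma countable_unionE (I : countType) (Q : I -> T -> Prop) :
  [set x | exists i, Q i x] = \bigcup_n
    (if @choice.pickle_inv I n is Some i then [set x | Q i x] else set0).
Proof.
apply/seteqP; split=> x /=.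
  by case=> i Qi; exists (choice.pickle i) => //; rewrite choice.pickleK_inv.
by case=> n _; case: choice.pickle_inv => // i Qi; exists i.
Qed.

Lemma null_exists (I : countType) (Q : I -> T -> Prop) :
  (forall i, mpred (Q i)) -> (forall i, mu [set x | Q i x] = 0%E) ->
  mu [set x | exists i, Q i x] = 0%E.
Proof.
move=> mQ Q0; apply/negligibleP; first exact: mpred_exists.
rewrite countable_unionE; apply: negligible_bigcup => n.
case: choice.pickle_inv => [i|]; last exact: negligible_set0.
by apply/negligibleP; [exact: mQ|exact: Q0].
Qed.

Lemma measure_exists_eq (I : countType) (Q Q' : I -> T -> Prop) :
  (forall i, mpred (Q i)) -> (forall i, mpred (Q' i)) ->
  (forall i j x, Q i x -> Q j x -> i = j) ->
  (forall i j x, Q' i x -> Q' j x -> i = j) ->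
  (forall i, mu [set x | Q i x] = mu [set x | Q' i x]) ->
  mu [set x | exists i, Q i x] = mu [set x | exists i, Q' i x].
Proof.
move=> mQ mQ' dQ dQ' e.
have key (V : I -> T -> Prop) : (forall i, mpred (V i)) ->
    (forall i j x, V i x -> V j x -> i = j) ->
    mu [set x | exists i, V i x] = (\sum_(n <oo | n \in [set: nat]) mu
      (if @choice.pickle_inv I n is Some i then [set x | V i x] else set0))%E.
  move=> mV dV; rewrite countable_unionE measure_bigcup//.
  - by move=> n _; case: choice.pickle_inv.
  - move=> n m _ _ [x []] /=.
    case en : (choice.pickle_inv n) => [i|//]; case em : (choice.pickle_inv m) => [j|//] Vi Vj.
    have ij := dV _ _ _ Vi Vj; rewrite -{}ij in em.
    by have := @choice.pickle_invK I n; have := @choice.pickle_invK I m; rewrite en em /= => -> ->.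
rewrite !key//; apply: eq_eseriesr => n _.
by case: choice.pickle_inv.
Qed.

Lemma measure_eq_ae (N A B : T -> Prop) :
  mpred N -> mu [set w | N w] = 0%E -> mpred A -> mpred B ->
  (forall w, ~ N w -> (A w <-> B w)) -> mu [set w | A w] = mu [set w | B w].
Proof.
move=> mN N0 mA mB AB.
have key (A' B' : T -> Prop) : mpred A' -> mpred B' ->
    (forall w, ~ N w -> A' w -> B' w) -> (mu [set w | A' w] <= mu [set w | B' w])%E.
  move=> mA' mB' h; apply: (@le_trans _ _ (mu ([set w | B' w] `|` [set w | N w]))).
    apply: le_measure; rewrite ?inE//; first exact: measurableU.
    move=> w /= Aw; have [Nw|nNw] := pselect (N w); [by right|left; exact: h].
  by apply: (le_trans (measureU2 _ _ _)) => //; rewrite [X in (_ + X)%E]N0 adde0.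
by apply/eqP; rewrite eq_le !key// => w nN /AB; exact.
Qed.

End CountableUnions.

Section MeasurableSteps.
Context d (T : measurableType d).
Variables (b : T -> vertex -> bool) (s : T -> vertex -> int).
Hypothesis mb : forall u, mpred (fun w => b w u).
Hypothesis ms : forall u k, mpred (fun w => s w u = k).

Lemma mpred_row_open t : mpred (fun w => row_open (b w) t).
Proof. exact: mpred_exists. Qed.

Lemma mpred_nearest_dist t x k : mpred (fun w => nearest_dist (b w) (x, t) = k).
Proof.
pose c j w := b w (x + j%:Z, t + 1) \/ b w (x - j%:Z, t + 1).
have mc j : mpred (c j) by exact: mpred_or.
apply: (@mpred_ext _ _ (fun w => (c k w /\ forall j, c j w -> (k <= j)%N) \/
   (k = 0%N /\ ~ row_open (b w) (t + 1)))); last first.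
  apply: mpred_or; apply: mpred_and => //.
  - by apply: mpred_forall => j; apply: mpred_imp => //; exact: mpred_cst.
  - exact: mpred_cst.
  - by apply: mpred_not; exact: mpred_row_open.
move=> w; split.
  case=> [[ck kmin]|[-> nro]]; last exact: nearest_dist_closed.
  have ro : row_open (b w) (t + 1) by case: ck => h; eexists; exact: h.
  have [/candidate_distP c1 c2] := nearest_distP x ro.
  apply/eqP; rewrite eqn_leq kmin// andbT.
  by apply/c2/candidate_distP.
move=> <-; have [ro|nro] := pselect (row_open (b w) (t + 1)); last first.
  by right; rewrite nearest_dist_closed.
have [/candidate_distP c1 c2] := nearest_distP x ro; left; split=> // j cj.
by apply/c2/candidate_distP.
Qed.

Lemma mpred_step t x y : mpred (fun w => step (b w) (s w) t x = y).
Proof.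
pose Q k w := (~ b w (x - k%:Z, t + 1) /\ x + k%:Z = y) \/
  ((b w (x - k%:Z, t + 1) /\ (~ b w (x + k%:Z, t + 1) /\ x - k%:Z = y)) \/
   (b w (x - k%:Z, t + 1) /\ (b w (x + k%:Z, t + 1) /\ x + s w (x, t) * k%:Z = y))).
apply: (@mpred_ext _ _ (fun w => Q (nearest_dist (b w) (x, t)) w)) => [w|].
  rewrite /Q /step /next_vertex /=; set k := nearest_dist _ _.
  case: ifPn => [/negP nb|/negPn bm] /=.
    by split=> [[[]//|[[]//|[]//]]|?]; left.
  case: ifPn => [/negP nb|/negPn bp] /=.
    by split=> [[[]//|[[_ []]//|[_ []]//]]|?]; right; left.
  by split=> [[[]//|[[_ []]//|[_ []]//]]|?]; right; right.
apply: mpred_measurable_fun => [k|k]; first exact: mpred_nearest_dist.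
apply: mpred_or; first by apply: mpred_and; [exact: mpred_not|exact: mpred_cst].
apply: mpred_or; apply: mpred_and => //; apply: mpred_and => //.
- exact: mpred_not.
- exact: mpred_cst.
- exact: (mpred_comp (fun r : int => x + r * k%:Z = y) (ms _)).
Qed.

Lemma mpred_flow t n x y : mpred (fun w => flow (b w) (s w) t n x = y).
Proof.
elim: n y => [|n IH] y; first exact: (@mpred_cst _ _ (x = y)).
rewrite /=; apply: (mpred_measurable_fun (h := fun z w => step (b w) (s w) _ z = y)) => // z.
exact: mpred_step.
Qed.

Lemma ancestors_neq0 w n : ancestors (b w) (s w) n (0, 0) <> set0 <->
  b w (0, 0) /\ exists x, b w (x, - n%:Z) /\ flow (b w) (s w) (- n%:Z) n x = 0.
Proof.
have -> : (ancestors (b w) (s w) n (0, 0) <> set0) <->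
    (ancestors (b w) (s w) n (0, 0) !=set0).
  by split=> [/eqP/set0P|/set0P/eqP].
split=> [[[x y]] [/= b0 bv]|[b0 [x [bx fx]]]].
  rewrite /= sub0r => yn; rewrite {}yn in bv *; rewrite iter_next_vertex addNr => -[fx].
  by split=> //; exists x.
exists (x, - n%:Z); split=> //=; first by rewrite sub0r.
by rewrite iter_next_vertex addNr fx.
Qed.

Lemma channel_length_gt (R : realType) w n :
  (n%:R%:E < channel_length (b w) (s w) R (0, 0)%R)%E <->
  forall k, (k <= n)%N -> ancestors (b w) (s w) k (0, 0) <> set0.
Proof.
rewrite /channel_length; split=> [|h].
  rewrite ltNge => /negP lt k kn ak; apply: lt.
  apply: (@le_trans _ _ (k%:R%:E : \bar R)); last by rewrite lee_fin ler_nat.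
  by apply: ereal_inf_lbound; exists k.
apply: (@lt_le_trans _ _ (n.+1%:R%:E : \bar R)); first by rewrite lte_fin ltr_nat.
apply: le_ereal_inf_tmp => _ [k ak <-]; rewrite lee_fin ler_nat ltnNge.
by apply/negP => /h.
Qed.

Lemma mpred_channel_length_gt (R : realType) n :
  mpred (fun w => (n%:R%:E < channel_length (b w) (s w) R (0, 0)%R)%E).
Proof.
apply: (@mpred_ext _ _ (fun w => forall k, (k <= n)%N -> b w (0, 0) /\
   exists x, b w (x, - k%:Z) /\ flow (b w) (s w) (- k%:Z) k x = 0)).
  move=> w; rewrite channel_length_gt.
  by split=> h k /h /ancestors_neq0.
apply: mpred_forall => k; apply: mpred_imp; first exact: mpred_cst.
apply: mpred_and => //; apply: mpred_exists => x; apply: mpred_and => //.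
exact: mpred_flow.
Qed.

(** An open ancestor at height -n is reached by going straight up from the vertex below it, so
    starting one row lower absorbs the openness of the start. Conversely, after its first step a
    walker always sits on an open vertex, so its path meets an ancestor at every depth k <= n. *)
Lemma channel_length_flow (R : realType) w n :
  signs (s w) -> (forall t, row_open (b w) t) ->
  (n%:R%:E < channel_length (b w) (s w) R (0, 0)%R)%E <->
  exists x, flow (b w) (s w) (- n.+1%:Z) n.+1 x = 0.
Proof.
move=> sg ro; rewrite channel_length_gt; split=> [/(_ n (leqnn n))|].
  move/ancestors_neq0 => [_ [x [bx fx]]]; exists x.
  have e : - n.+1%:Z + 1 = - n%:Z by rewrite -addn1 PoszD opprD subrK.
  by rewrite flowSr step_above ?e.
move=> [x fx] k kn; apply/ancestors_neq0; split.
  by have := flow_open (- n.+1%:Z) n x sg ro; rewrite fx addNr.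
have nk : (n.+1 = k + (n - k).+1)%N by lia.
exists (flow (b w) (s w) (- n.+1%:Z) (n - k).+1 x); split.
  have -> : - k%:Z = - n.+1%:Z + (n - k).+1%:Z by lia.
  exact: flow_open.
have e : iter n.+1 (next_vertex (b w) (s w)) (x, - n.+1%:Z) =
    iter k (next_vertex (b w) (s w)) (iter (n - k).+1 (next_vertex (b w) (s w)) (x, - n.+1%:Z)).
  by rewrite -iterD -nk.
move: e; rewrite !iter_next_vertex fx => -[/esym fe _].
have ek : - k%:Z = - n.+1%:Z + (n - k).+1%:Z by lia.
by rewrite ek; exact: fe.
Qed.

End MeasurableSteps.

(** * The canonical space of configurations *)

Section Configurations.

Definition cylinder (J1 : {fset vertex}) (beta : vertex -> bool) (J2 : {fset vertex})
    (eps : vertex -> bool) : set ((vertex -> bool) * (vertex -> bool)) :=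
  [set w | (forall u, u \in J1 -> w.1 u = beta u) /\
           (forall u, u \in J2 -> w.2 u = eps u)].

(** Prescribing only the value [true] rules out conflicting constraints, so the family is closed
    under intersection; the remaining cylinders follow by complements. *)
Definition true_cylinders : set (set ((vertex -> bool) * (vertex -> bool))) :=
  [set cylinder J.1 (fun=> true) J.2 (fun=> true) | J in setT].

(* The second component encodes the signs: [true] stands for 1 and [false] for -1. *)
Definition config := g_sigma_algebraType true_cylinders.

Definition opens (w : config) : vertex -> bool := w.1.
Definition sign_of (w : config) (u : vertex) : int := if w.2 u then 1 else -1.

Lemma signs_sign_of w : signs (sign_of w).
Proof. by move=> u; rewrite /sign_of; case: ifP; [left|right]. Qed.

Lemma true_cylindersI : setI_closed true_cylinders.
Proof.
move=> _ _ [[J1 J2] _ <-] [[K1 K2] _ <-].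
exists (J1 `|` K1, J2 `|` K2)%fset => //=.
apply/seteqP; split=> w /=.
  by case=> h1 h2; split; split=> u uJ; (apply: h1 || apply: h2); rewrite inE uJ ?orbT.
by case=> -[h1 h2] [h3 h4]; split=> u; rewrite inE => /orP[]; auto.
Qed.

Lemma mpred_opens u : mpred (fun w => opens w u).
Proof.
apply: sub_sigma_algebra; exists ([fset u], fset0)%fset => //=.
apply/seteqP; split=> w /=; first by case=> h _; apply: h; rewrite inE.
by move=> wu; split=> v; rewrite !inE // => /eqP ->.
Qed.

Lemma mpred_sign u : mpred (fun w : config => w.2 u).
Proof.
apply: sub_sigma_algebra; exists (fset0, [fset u])%fset => //=.
apply/seteqP; split=> w /=; first by case=> _ h; apply: h; rewrite inE.
by move=> wu; split=> v; rewrite !inE // => /eqP ->.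
Qed.

Lemma mpred_sign_of u k : mpred (fun w => sign_of w u = k).
Proof.
have := mpred_comp (fun e : bool => (if e then 1 else -1) = k)
  (f := fun w : config => w.2 u).
apply=> -[].
  exact: mpred_sign.
by apply: mpred_ext (mpred_not (mpred_sign u)) => w; split; [move/negP/negbTE|move->].
Qed.

Lemma mpred_cylinder d (T : measurableType d) (h : T -> config) J1 beta J2 eps :
  (forall u, mpred (fun x => (h x).1 u)) -> (forall u, mpred (fun x => (h x).2 u)) ->
  measurable (h @^-1` cylinder J1 beta J2 eps).
Proof.
move=> m1 m2.
have mb (f : T -> bool) e : mpred (fun x => f x) -> mpred (fun x => f x = e).
  case: e => // mf; apply: mpred_ext (mpred_not mf) => x.
  by split; [move/negP/negbTE|move->].
by apply: mpred_and; apply: mpred_forall => u; apply: mpred_imp;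
  (exact: mpred_cst || exact: mb).
Qed.

Lemma measurable_config d (T : measurableType d) (h : T -> config) :
  (forall u, mpred (fun x => (h x).1 u)) -> (forall u, mpred (fun x => (h x).2 u)) ->
  measurable_fun setT h.
Proof.
move=> m1 m2; apply: (@measurability _ _ T config setT h true_cylinders) => //.
move=> _ [_ [[J1 J2] _ <-] <-]; rewrite setTI.
exact: mpred_cylinder.
Qed.

Lemma config_measure_unique (R : realType) (m1 m2 : {measure set config -> \bar R}) :
  (m1 setT < +oo)%E ->
  (forall J1 J2, m1 (cylinder J1 (fun=> true) J2 (fun=> true)) =
     m2 (cylinder J1 (fun=> true) J2 (fun=> true))) ->
  forall A, measurable A -> m1 A = m2 A.
Proof.
move=> m1oo m12.
pose S (n : nat) : set config := setT.
have GT n : true_cylinders (S n).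
  exists (fset0, fset0)%fset => //=.
  by apply/seteqP; split=> // w _; split=> u; rewrite inE.
have cover : \bigcup_n S n = setT :> set config.
  by apply/seteqP; split=> // w _; exists 0%N.
apply: (@measure_unique _ R config true_cylinders _ erefl true_cylindersI GT cover) => //.
by move=> _ [[J1 J2] _ <-]; exact: m12.
Qed.

Definition cylinder_weight (R : realType) (p : R) (J1 : {fset vertex})
    (beta : vertex -> bool) (J2 : {fset vertex}) : R :=
  (\prod_(u <- J1) (if beta u then p else 1 - p)) * \prod_(u <- J2) 2^-1.

Definition config_law (R : realType) (p : R) (m : set config -> \bar R) :=
  forall J1 beta J2 eps, m (cylinder J1 beta J2 eps) =
    (cylinder_weight p J1 beta J2)%:E.

End Configurations.

Section LawOfNetwork.
Context (R : realType) (p : R) d (T : measurableType d) (P : probability T R).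
Variables (B : vertex -> {RV P >-> bool}) (U : vertex -> {RV P >-> int}).
Hypothesis hp : 0 < p < 1.
Hypothesis hBU : drainage_network p B U.

(** A value of [U u] other than 1 and -1 is encoded as -1; this happens on a null set only. *)
Definition network_config (x : T) : config := (fun u => B u x, fun u => U u x == 1).

Lemma mpred_B u : mpred (fun x => B u x).
Proof.
rewrite /mpred (_ : [set x | _] = B u @^-1` [set true]); last by apply/seteqP; split.
by rewrite -[_ @^-1` _]setTI; exact: measurable_funP.
Qed.

Lemma mpred_U u k : mpred (fun x => U u x = k).
Proof.
rewrite /mpred (_ : [set x | _] = U u @^-1` [set k]); last by apply/seteqP; split.
by rewrite -[_ @^-1` _]setTI; exact: measurable_funP.
Qed.

Lemma measurable_network_config : measurable_fun setT network_config.
Proof.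
apply: measurable_config => u; first exact: mpred_B.
by apply: mpred_ext (mpred_U u 1) => x /=; split=> [->|/eqP].
Qed.

Lemma sigma_of_family_bigcap d' (T' : measurableType d') (X : vertex -> T -> T')
   (J : {fset vertex}) (A : vertex -> set T') :
  (forall u, measurable (A u)) ->
  sigma_of_family X (\bigcap_(u in [set` J]) (X u @^-1` A u)).
Proof.
move=> mA; rewrite /sigma_of_family.
set G := \bigcup_i _.
suff : G.-sigma.-measurable (\bigcap_(u in [set` J]) (X u @^-1` A u)) by [].
apply: (@fin_bigcap_measurable _ (g_sigma_algebraType G)) => // u _.
by apply: sub_sigma_algebra; exists u => //; exists (A u) => //; rewrite setTI.
Qed.

Lemma network_config_law J1 beta J2 eps :
  P (network_config @^-1` cylinder J1 beta J2 eps) =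
    (cylinder_weight p J1 beta J2)%:E.
Proof.
pose A1 := \bigcap_(u in [set` J1]) (B u @^-1` [set beta u]).
pose A2 := \bigcap_(u in [set` J2]) (U u @^-1` [set k | (k == 1) = eps u]).
have -> : network_config @^-1` cylinder J1 beta J2 eps = A1 `&` A2 by [].
rewrite (BU_indep hBU); last 2 first.
- exact: sigma_of_family_bigcap.
- exact: sigma_of_family_bigcap.
rewrite (B_indep hBU); last by move=> u _; exists [set beta u] => //; rewrite setTI.
rewrite (U_indep hBU); last first.
  by move=> u _; exists [set k | (k == 1) = eps u] => //; rewrite setTI.
rewrite /cylinder_weight EFinM -!prodEFin; congr (_ * _)%E; apply: eq_bigr => u _.
  have /(_ [set beta u]) := B_law hBU u; rewrite /distribution /pushforward => ->.
  rewrite bernoulli_probE; last by case/andP: hp => h0 h1; rewrite !ltW.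
  rewrite !diracE; case: (beta u).
    by rewrite mem_set// memNset//= mule1 mule0 adde0.
  by rewrite memNset// mem_set//= mule1 mule0 add0e.
have m1 := mpred_U u 1.
have e1 := U_law1 hBU u.
case: (eps u).
  rewrite -e1; congr (P _); apply/seteqP; split=> x /=; first by move/eqP.
  by move=> ->.
have -> : U u @^-1` [set k | (k == 1) = false] = ~` [set w | U u w = 1].
  by apply/seteqP; split=> x /=; [move/eqP|move/eqP/negbTE].
rewrite probability_setC// e1 -EFinB; congr EFin; lra.
Qed.

Lemma mpred_invalid_sign : mpred (fun x => exists u, U u x <> 1 /\ U u x <> -1).
Proof.
by apply: mpred_exists => u; apply: mpred_and; apply: mpred_not; exact: mpred_U.
Qed.

Lemma invalid_sign_null : P [set x | exists u, U u x <> 1 /\ U u x <> -1] = 0%E.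
Proof.
have mN u : mpred (fun x => U u x <> 1 /\ U u x <> -1).
  by apply: mpred_and; apply: mpred_not; exact: mpred_U.
apply: null_exists => // u.
transitivity (P (~` ([set x | U u x = 1] `|` [set x | U u x = -1]))).
  congr (P _); apply/seteqP; split=> x /=; first by case=> h1 h2 [].
  by move/not_orP.
have m1 := mpred_U u 1; have m2 := mpred_U u (-1).
rewrite (@probability_setC _ _ _ P); last exact: measurableU.
rewrite measureU//; last by apply/seteqP; split=> x //= -[->].
rewrite [X in (_ - (X + _))%E](U_law1 hBU u) [X in (_ - (_ + X))%E](U_lawN1 hBU u).
have e : 1 - (2^-1 + 2^-1) = 0 :> R by lra.
exact: (congr1 EFin e).
Qed.

Lemma sign_of_network_config x : ~ (exists u, U u x <> 1 /\ U u x <> -1) ->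
  sign_of (network_config x) = (fun u => U u x).
Proof.
move=> /forallNP h; apply/funext => u; rewrite /sign_of /=; case: eqP => // u1.
by have /not_andP[] := h u => /contrapT.
Qed.

End LawOfNetwork.

(** * Transformations preserving the law of the configuration *)

Section LawInvariance.
Context (R : realType) (p : R) (mu : probability config R).
Hypothesis mu_law : config_law p mu.

Section Transfer.
Context d (X : measurableType d) (m : {measure set X -> \bar R}) (h : X -> config).
Hypothesis mh : measurable_fun setT h.
Hypothesis h_law : forall J1 J2,
  m (h @^-1` cylinder J1 (fun=> true) J2 (fun=> true)) =
  (cylinder_weight p J1 (fun=> true) J2)%:E.
Let h_mfun : {mfun X >-> config} := mfun_Sub (mem_set mh).

Lemma transfer_measure (A : set config) : measurable A -> m (h @^-1` A) = mu A.
Proof.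
move=> mA; have -> : m (h @^-1` A) = pushforward m h_mfun A by [].
have mu1 : (mu setT < +oo)%E by rewrite probability_setT ltry.
apply/esym/(config_measure_unique mu1) => //.
move=> J1 J2; apply: (etrans (mu_law J1 (fun=> true) J2 (fun=> true))).
exact/esym/h_law.
Qed.

Lemma transfer_integral (f : config -> \bar R) : measurable_fun setT f ->
  (\int[m]_x f (h x) = \int[mu]_w f w)%E.
Proof.
move=> mf; have key (k : config -> \bar R) : measurable_fun setT k ->
    (forall w, 0 <= k w)%E -> (\int[m]_x k (h x) = \int[mu]_w k w)%E.
  move=> mk k0.
  have := @ge0_integral_pushforward _ _ X config R h mh m setT k measurableT mk
    (fun w _ => k0 w).
  rewrite preimage_setT => <-.
  apply: (@eq_measure_integral _ config R setT mu (pushforward m h_mfun)) => A mA _.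
  exact: transfer_measure.
rewrite [LHS]integralE [RHS]integralE; congr (_ - _)%E.
  rewrite -(key _ (measurable_funepos mf) (funepos_ge0 f)).
  by apply: eq_integral => x _; rewrite !funeposE.
rewrite -(key _ (measurable_funeneg mf) (funeneg_ge0 f)).
by apply: eq_integral => x _; rewrite !funenegE.
Qed.

End Transfer.

Lemma opens_measurable d (X : measurableType d) (h : X -> config) u :
  measurable_fun setT h -> mpred (fun x => opens (h x) u).
Proof. by move=> mh; have := mh measurableT _ (mpred_opens u); rewrite setTI. Qed.

Lemma sign_measurable d (X : measurableType d) (h : X -> config) u :
  measurable_fun setT h -> mpred (fun x => (h x).2 u).
Proof. by move=> mh; have := mh measurableT _ (mpred_sign u); rewrite setTI. Qed.

Section Remap.
Variables (sigma sigma' tau tau' : vertex -> vertex) (flip : vertex -> bool).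
Hypotheses (sigmaK : cancel sigma sigma') (sigmaK' : cancel sigma' sigma).
Hypotheses (tauK : cancel tau tau') (tauK' : cancel tau' tau).

(** Covers both translations and reflections. Flipping signs preserves the law because the two signs
    are equally likely. *)
Definition remap (w : config) : config :=
  (fun u => w.1 (sigma u), fun u => w.2 (tau u) (+) flip u).

Lemma measurable_remap : measurable_fun setT remap.
Proof.
apply: measurable_config => u; first exact: mpred_opens.
rewrite /remap /=; case: (flip u).
  apply: mpred_ext (mpred_not (mpred_sign (tau u))) => w; rewrite addbT.
  by split=> /negP.
by apply: mpred_ext (mpred_sign (tau u)) => w; rewrite addbF.
Qed.

Lemma remap_law J1 J2 : mu (remap @^-1` cylinder J1 (fun=> true) J2 (fun=> true)) =
  (cylinder_weight p J1 (fun=> true) J2)%:E.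
Proof.
have -> : remap @^-1` cylinder J1 (fun=> true) J2 (fun=> true) =
  cylinder (sigma @` J1)%fset (fun=> true) (tau @` J2)%fset (fun u => ~~ flip (tau' u)).
  apply/seteqP; split=> w /=.
    case=> h1 h2; split=> _ /imfsetP[u uJ ->]; first exact: h1.
    by rewrite tauK; have := h2 u uJ; rewrite /=; case: (w.2 _); case: (flip u).
  case=> h1 h2; split=> u uJ; first by apply: h1; apply/imfsetP; exists u.
  by rewrite /= h2 ?tauK; [case: (flip u)|apply/imfsetP; exists u].
rewrite mu_law /cylinder_weight; congr (_ * _)%:E.
  by rewrite big_imfset//= => u v _ _; exact: (can_inj sigmaK).
by rewrite big_imfset//= => u v _ _; exact: (can_inj tauK).
Qed.

Lemma remap_measure A : measurable A -> mu (remap @^-1` A) = mu A.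
Proof. by apply: transfer_measure; [exact: measurable_remap|exact: remap_law]. Qed.

Lemma remap_integral (f : config -> \bar R) : measurable_fun setT f ->
  (\int[mu]_w f (remap w) = \int[mu]_w f w)%E.
Proof. by apply: transfer_integral; [exact: measurable_remap|exact: remap_law]. Qed.

End Remap.

Section Splice.
Variables (D1 D2 : vertex -> bool).

(** Independence of disjoint sets of coordinates in a form suited to Fubini: the two parts come from
    independent copies, and the result has the original law. *)
Definition splice (w : config * config) : config :=
  (fun u => if D1 u then w.1.1 u else w.2.1 u,
   fun u => if D2 u then w.1.2 u else w.2.2 u).

Lemma measurable_splice : measurable_fun setT splice.
Proof.
have m1 : measurable_fun setT (fst : config * config -> config) by exact: measurable_fst.
have m2 : measurable_fun setT (snd : config * config -> config) by exact: measurable_snd.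
apply: measurable_config => u; rewrite /splice /=.
  by case: (D1 u); [exact: (opens_measurable u m1)|exact: (opens_measurable u m2)].
by case: (D2 u); [exact: (sign_measurable u m1)|exact: (sign_measurable u m2)].
Qed.

Lemma splice_law J1 J2 :
  (mu \x mu)%E (splice @^-1` cylinder J1 (fun=> true) J2 (fun=> true)) =
  (cylinder_weight p J1 (fun=> true) J2)%:E.
Proof.
pose K1 := [fset u in J1 | D1 u]%fset; pose K1' := [fset u in J1 | ~~ D1 u]%fset.
pose K2 := [fset u in J2 | D2 u]%fset; pose K2' := [fset u in J2 | ~~ D2 u]%fset.
have -> : splice @^-1` cylinder J1 (fun=> true) J2 (fun=> true) =
  cylinder K1 (fun=> true) K2 (fun=> true) `*` cylinder K1' (fun=> true) K2' (fun=> true).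
  apply/seteqP; split=> -[w w'] /=.
    case=> h1 h2; split; split=> u; rewrite !inE /= => /andP[uJ Du].
    - by have := h1 u uJ; rewrite /= Du.
    - by have := h2 u uJ; rewrite /= Du.
    - by have := h1 u uJ; rewrite /= (negbTE Du).
    - by have := h2 u uJ; rewrite /= (negbTE Du).
  case=> -[h1 h2] [h3 h4]; split=> u uJ /=; case: ifPn => Du.
  - by apply: h1; rewrite !inE /= uJ.
  - by apply: h3; rewrite !inE /= uJ.
  - by apply: h2; rewrite !inE /= uJ.
  - by apply: h4; rewrite !inE /= uJ.
have mc L1 L2 : measurable (cylinder L1 (fun=> true) L2 (fun=> true) : set config).
  apply: (@mpred_cylinder _ _ id) => u; first exact: mpred_opens.
  exact: mpred_sign.
rewrite product_measure1E//.
rewrite [X in (X * _)%E](mu_law K1) [X in (_ * X)%E](mu_law K1') -EFinM; congr EFin.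
rewrite /cylinder_weight /K1 /K1' /K2 /K2' !big_fset /= mulrACA.
by congr (_ * _); [rewrite [RHS](bigID D1)|rewrite [RHS](bigID D2)].
Qed.

Lemma splice_integral (f : config -> \bar R) : measurable_fun setT f ->
  (forall w, 0 <= f w)%E ->
  (\int[mu]_w f w = \int[mu]_w \int[mu]_w' f (splice (w, w')))%E.
Proof.
move=> mf f0.
rewrite -(transfer_integral measurable_splice splice_law mf) fubini_tonelli1//=.
by apply: measurableT_comp => //; exact: measurable_splice.
Qed.

End Splice.

End LawInvariance.

(** * The gap between two walkers *)

Section Markov.
Context (R : realType) (p : R) (mu : probability config R).
Hypothesis mu_law : config_law p mu.
Implicit Types (w : config) (t x y : int) (n : nat).

Definition cstep t x w := step (opens w) (sign_of w) t x.
Definition cflow t n x w := flow (opens w) (sign_of w) t n x.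
Definition gap t n w : nat := `|cflow t n 1 w - cflow t n 0 w|%N.
Definition one_gap (m : nat) w : nat := `|cstep 0 m%:Z w - cstep 0 0 w|%N.

Lemma cflowS t n x w : cflow t n.+1 x w = cstep (t + n%:Z) (cflow t n x w) w.
Proof. by []. Qed.

Lemma mpred_cstep t x y : mpred (fun w => cstep t x w = y).
Proof. by apply: mpred_step => [u|u k]; [exact: mpred_opens|exact: mpred_sign_of]. Qed.

Lemma mpred_cflow t n x y : mpred (fun w => cflow t n x w = y).
Proof. by apply: mpred_flow => [u|u k]; [exact: mpred_opens|exact: mpred_sign_of]. Qed.

Lemma mpred_pair d (T : measurableType d) (I J : countType) (f : T -> I) (g : T -> J) k :
  (forall i, mpred (fun a => f a = i)) -> (forall j, mpred (fun a => g a = j)) ->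
  mpred (fun a => (f a, g a) = k).
Proof.
move=> mf mg; apply: mpred_ext (mpred_and (mf k.1) (mg k.2)) => a.
by case: k => i j /=; split=> [[-> ->]|[-> ->]].
Qed.

Lemma mpred_gap t n k : mpred (fun w => gap t n w = k).
Proof.
apply: (mpred_comp (fun z : int * int => `|z.1 - z.2|%N = k)
  (f := fun w => (cflow t n 1 w, cflow t n 0 w))) => z.
by apply: mpred_pair => y; exact: mpred_cflow.
Qed.

Lemma mpred_one_gap m k : mpred (fun w => one_gap m w = k).
Proof.
apply: (mpred_comp (fun z : int * int => `|z.1 - z.2|%N = k)
  (f := fun w => (cstep 0 m%:Z w, cstep 0 0 w))) => z.
by apply: mpred_pair => y; exact: mpred_cstep.
Qed.

Definition vshift (z : vertex) (u : vertex) : vertex := (u.1 + z.1, u.2 + z.2).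

Lemma vshiftK z : cancel (vshift z) (vshift (- z.1, - z.2)).
Proof. by case=> x t; rewrite /vshift /= !addrK. Qed.

Definition shift_config z : config -> config := remap (vshift z) (vshift z) (fun=> false).

Lemma sign_of_shift z w u : sign_of (shift_config z w) u = sign_of w (vshift z u).
Proof. by rewrite /sign_of /shift_config /remap /= addbF. Qed.

Lemma cstep_shift z t x w :
  cstep t x (shift_config z w) = cstep (t + z.2) (x + z.1) w - z.1.
Proof.
rewrite /cstep -step_shift; congr step.
by apply/funext => u; rewrite sign_of_shift.
Qed.

Lemma cflow_shift z t n x w :
  cflow t n x (shift_config z w) = cflow (t + z.2) n (x + z.1) w - z.1.
Proof.
elim: n => [|n IH]; first by rewrite /cflow /= addrK.
by rewrite !cflowS IH cstep_shift subrK addrAC.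
Qed.

Lemma shift_measure z (A : set config) : measurable A ->
  mu (shift_config z @^-1` A) = mu A.
Proof. exact: (remap_measure mu_law _ (@vshiftK z) (@vshiftK z)). Qed.

Lemma shift_integral z (f : config -> \bar R) : measurable_fun setT f ->
  (\int[mu]_w f (shift_config z w) = \int[mu]_w f w)%E.
Proof. exact: (remap_integral mu_law _ (@vshiftK z) (@vshiftK z)). Qed.

Definition gap_kernel (g : nat -> \bar R) (m : nat) : \bar R :=
  (\int[mu]_w g (one_gap m w))%E.

(** Resampling everything after height t + n keeps the first n steps and makes the next one
    independent of them. A translation then brings the left walker to the origin. *)
Lemma gap_markov (g : nat -> \bar R) t n : (forall m, 0 <= g m)%E ->
  (\int[mu]_w g (gap t n.+1 w) = \int[mu]_w gap_kernel g (gap t n w))%E.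
Proof.
move=> g0.
(* The row at height t + n is past for openness, since the n-th step landed on it, but future for
   signs, since the next step consults them. *)
pose D1 (u : vertex) := u.2 <= t + n%:Z; pose D2 (u : vertex) := u.2 < t + n%:Z.
rewrite (splice_integral mu_law D1 D2); last 2 first.
- exact: (measurable_fun_countable g (mpred_gap _ _)).
- by move=> w; exact: g0.
apply: eq_integral => w _.
set x := cflow t n 0 w; set y := cflow t n 1 w.
have xy : x <= y by apply: flow_mono => //; exact: signs_sign_of.
have fl z w' : cflow t n z (splice D1 D2 (w, w')) = cflow t n z w.
  apply: flow_local => [v t'|v t'] /andP[h1 h2].
    by rewrite /opens /splice /= /D1 /= h2.
  by rewrite /sign_of /splice /= /D2 /= h2.
have st z w' : cstep (t + n%:Z) z (splice D1 D2 (w, w')) = cstep (t + n%:Z) z w'.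
  rewrite /cstep /step (@next_vertex_local _ _ (opens w') (sign_of w'))// => [v|].
    by rewrite /opens /splice /= /D1 /= ifF//; apply/negbTE; rewrite -ltNge; lia.
  by rewrite /sign_of /splice /= /D2 /= ltxx.
have mg := measurable_fun_countable g (mpred_one_gap (gap t n w)).
rewrite /gap_kernel -(shift_integral (x, t + n%:Z) mg).
apply: eq_integral => w' _; congr g.
rewrite /gap !cflowS !fl !st /one_gap !cstep_shift /= !add0r.
rewrite -/x -/y gez0_abs ?subr_ge0// subrK.
by congr absz; ring.
Qed.

End Markov.

(** * Tails and moments of one displacement *)

Section Tails.
Context (R : realType) (p : R) (mu : probability config R).
Hypothesis hp : 0 < p < 1.
Hypothesis mu_law : config_law p mu.
Implicit Types (w : config) (t x y a : int) (n k : nat).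

Fixpoint row_interval t a n : {fset vertex} :=
  if n is n'.+1 then (((a + n'%:Z)%R, t) |` row_interval t a n')%fset else fset0.

Lemma in_row_interval t a n u :
  (u \in row_interval t a n) = (u.2 == t) && (a <= u.1 < a + n%:Z).
Proof.
case: u => x t'; elim: n => [|n IH]; first by rewrite inE /=; lia.
rewrite /= !inE IH xpair_eqE /=.
by case: (t' == t) => /=; lia.
Qed.

Lemma prod_row_interval t a n (F : vertex -> R) :
  \prod_(u <- row_interval t a n) F u = \prod_(i < n) F (a + i%:Z, t).
Proof.
elim: n => [|n IH]; first by rewrite big_ord0 big_seq_fset0.
rewrite big_ord_recr /= big_fsetU1; first by rewrite IH mulrC.
by rewrite in_row_interval /= eqxx /= ltxx andbF.
Qed.

Lemma measure_closed_interval t a n :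
  mu [set w | forall x, a <= x < a + n%:Z -> ~~ opens w (x, t)] = ((1 - p) ^+ n)%:E.
Proof.
transitivity (mu (cylinder (row_interval t a n) (fun=> false) fset0 (fun=> true))).
  congr (mu _); apply/seteqP; split=> w /=.
    move=> h; split=> u; last by rewrite inE.
    rewrite in_row_interval => /andP[/eqP e /h]; rewrite -e /opens -surjective_pairing.
    by move/negbTE.
  case=> h _ x ax; apply/negbT/h.
  by rewrite in_row_interval /= eqxx.
rewrite mu_law /cylinder_weight big_seq_fset0 mulr1 prod_row_interval.
by rewrite prodr_const card_ord.
Qed.

Lemma mpred_closed_interval t a n :
  mpred (fun w => forall x, a <= x < a + n%:Z -> ~~ opens w (x, t)).
Proof.
apply: mpred_forall => x; apply: mpred_imp; first exact: mpred_cst.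
by apply: mpred_ext (mpred_not (mpred_opens (x, t))) => w; split=> /negP.
Qed.

Lemma row_closed_null t : mu [set w | ~ row_open (opens w) t] = 0%E.
Proof.
have mro : mpred (fun w => ~ row_open (opens w) t).
  by apply/mpred_not/mpred_row_open => u; exact: mpred_opens.
have q1 : `|1 - p| < 1 by case/andP: hp => h0 h1; rewrite ger0_norm; lra.
have le n : (mu [set w | ~ row_open (opens w) t] <= ((1 - p) ^+ n)%:E)%E.
  rewrite -(measure_closed_interval t 0); apply: le_measure; rewrite ?inE//.
    exact: mpred_closed_interval.
  by move=> w /= nro x _; apply/negP => bx; apply: nro; exists x.
apply/eqP; rewrite eq_le measure_ge0 andbT.
have fin : mu [set w | ~ row_open (opens w) t] \is a fin_num.
  exact: fin_num_measure.
rewrite -(fineK fin) lee_fin; apply: (cvgr_to_ge (cvg_expr q1)).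
by apply: nearW => n; rewrite -lee_fin (fineK fin).
Qed.

Definition displacement (m : nat) w : int := cstep 0 m%:Z w - m%:Z.

Lemma mpred_displacement m x : mpred (fun w => displacement m w = x).
Proof.
apply: mpred_ext (mpred_cstep 0 m%:Z (x + m%:Z)) => w; rewrite /displacement.
by split=> [->|<-]; rewrite ?addrK// subrK.
Qed.

Lemma displacement_shift m w : displacement m w = displacement 0 (shift_config (m%:Z, 0) w).
Proof. by rewrite /displacement cstep_shift /= !add0r subr0. Qed.

(** On nonempty rows the event says that the 2k + 1 sites at distance at most k are closed. *)
Lemma displacement_tail k :
  mu [set w | (k < `|displacement 0 w|)%N] = ((1 - p) ^+ k.*2.+1)%:E.
Proof.
rewrite -(measure_closed_interval 1 (- k%:Z)).
apply: (measure_eq_ae _ (row_closed_null 1)).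
- by apply/mpred_not/mpred_row_open => u; exact: mpred_opens.
- exact: (mpred_comp (fun z : int => (k < `|z|)%N) (mpred_displacement 0)).
- exact: mpred_closed_interval.
move=> w /contrapT ro.
have [b1 c1 _] := @step_relP (opens w) (sign_of w) 0 0 (signs_sign_of w) ro.
rewrite /displacement /cstep subr0; set y := step _ _ _ _ in b1 c1 *.
rewrite !subr0 in c1; split=> [ky x xk|h].
  by apply: c1; rewrite subr0; lia.
by rewrite ltnNge; apply/negP => yk; have := h y; rewrite -[1]add0r b1 => /(_ _); lia.
Qed.

(** If 0 is open and 1, ..., 2m are closed, both walkers go to 0. The site 2m is included to exclude
    a tie for the walker at m. *)
Lemma coalescence_positive (m : nat) : (0 < m)%N ->
  (0 < mu [set w | one_gap m w = 0%N])%E.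
Proof.
move=> m0; case/andP: hp => p0 p1.
pose J := row_interval 1 0 m.*2.+1.
pose beta (u : vertex) := u.1 == 0.
apply: (@lt_le_trans _ _ (mu (cylinder J beta fset0 (fun=> true)))).
  rewrite mu_law /cylinder_weight big_seq_fset0 mulr1 lte_fin prod_row_interval.
  by apply: prodr_gt0 => i _; case: ifP => _; lra.
apply: le_measure; rewrite ?inE.
- apply: (@mpred_cylinder _ _ id) => u; [exact: mpred_opens|exact: mpred_sign].
- exact: mpred_one_gap.
move=> w [h _] /=.
have bw x : 0 <= x <= m.*2%:Z -> opens w (x, 0 + 1) = (x == 0).
  by move=> x0; rewrite add0r; apply: h; rewrite in_row_interval /=; lia.
have ro : row_open (opens w) (0 + 1) by exists 0; rewrite bw//; lia.
have sg := signs_sign_of w.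
have e0 : cstep 0 0 w = 0.
  apply: step_eq => //; split; first by rewrite bw//; lia.
    by move=> z; rewrite subr0 absz0.
  by move=> _; rewrite subr0 absz0 mulr0 addr0.
have em : cstep 0 m%:Z w = 0.
  apply: step_eq => //; split; first by rewrite bw//; lia.
    by move=> z zm; rewrite bw; lia.
  by rewrite bw; lia.
by rewrite /one_gap e0 em.
Qed.

End Tails.

Section DisplacementMoments.
Context (R : realType) (p : R) (mu : probability config R).
Hypothesis hp : 0 < p < 1.
Hypothesis mu_law : config_law p mu.
Local Notation q := (1 - p).
Let disp (w : config) : nat := `|displacement 0 w|%N.

Lemma mpred_disp k : mpred (fun w => disp w = k).
Proof. exact: (mpred_comp (fun z : int => `|z|%N = k) (mpred_displacement 0)). Qed.

(** Here [c] is the discrete derivative of the function of the displacement being integrated: 2i + 1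
    for the square, 3i^2 + 3i + 1 for the cube. *)
Lemma layer_cake (c : nat -> R) : (forall i, 0 <= c i) ->
  (\int[mu]_w (\sum_(i < disp w) c i)%:E = \sum_(i <oo) (c i * q ^+ i.*2.+1)%:E)%E.
Proof.
move=> c0.
pose f i w : \bar R := (c i * (i < disp w)%N%:R)%:E.
have f0 i w : (0 <= f i w)%E by rewrite lee_fin mulr_ge0.
have mf i : measurable_fun setT (f i).
  exact: (measurable_fun_countable (fun k => (c i * (i < k)%N%:R)%:E) mpred_disp).
transitivity (\int[mu]_w (\sum_(i <oo) f i w))%E.
  apply: eq_integral => w _; rewrite (nneseries_split 0 (disp w))// add0n.
  rewrite eseries0 ?adde0; last first.
    by move=> i di _; rewrite /f ltnNge di mulr0.
  rewrite -sumEFin big_mkord; apply: eq_bigr => i _.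
  by rewrite /f ltn_ord mulr1.
rewrite integral_nneseries//; apply: eq_eseriesr => i _.
pose A : set config := [set w | (i < disp w)%N].
have mA : measurable A.
  exact: (mpred_comp (fun k => (i < k)%N) mpred_disp).
transitivity (\int[mu]_w ((c i)%:E * (\1_A w)%:E))%E.
  apply: eq_integral => w _; rewrite /f EFinM indicE; congr (_ * (_%:R)%:E)%E.
  by congr nat_of_bool; apply/idP/idP; rewrite inE.
rewrite ge0_integralZl//; last 2 first.
- exact/measurable_EFinP/measurable_indic.
- by rewrite lee_fin.
rewrite integral_indic// setIT EFinM; congr (_ * _)%E.
exact: (displacement_tail hp mu_law).
Qed.

Lemma sum_odd_geometric (r : R) n : r != 1 ->
  \sum_(i < n) (2 * i%:R + 1) * r ^+ i =
  (1 + r - r ^+ n * (2 * n%:R + 1 - (2 * n%:R - 1) * r)) / (1 - r) ^+ 2.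
Proof.
move=> r1; have r10 : 1 - r != 0 by rewrite subr_eq0 eq_sym.
elim: n => [|n IH]; first by rewrite big_ord0 expr0; field.
by rewrite big_ord_recr /= IH (exprS r n) -(natr1 n); field.
Qed.

Lemma series_odd_geometric (r : R) : 0 <= r < 1 ->
  series (fun i => (2 * i%:R + 1) * r ^+ i) @ \oo --> (1 + r) / (1 - r) ^+ 2.
Proof.
move=> /andP[r0 r1].
have r10 : 0 < 1 - r by rewrite subr_gt0.
set a := fun i : nat => (2 * i%:R + 1) * r ^+ i.
have a0 i : 0 <= a i by rewrite mulr_ge0 ?exprn_ge0// addr_ge0// mulr_ge0.
have sE : series a = fun n =>
    (1 + r) / (1 - r) ^+ 2 - (a n * (1 - r) + 2 * (r * r ^+ n)) / (1 - r) ^+ 2.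
  apply/funext => n; rewrite /series /= big_mkord sum_odd_geometric ?lt_eqF// /a.
  by field; rewrite gt_eqF.
(* The closed form bounds the increasing partial sums, hence the series converges and its term tends
   to 0. This limit is what the remainder in [sE] requires. *)
have ca : cvgn (series a).
  apply: (@nondecreasing_is_cvgn _ _).
    by apply: nondecreasing_series => i _ _; exact: a0.
  exists ((1 + r) / (1 - r) ^+ 2) => _ [n _ <-]; rewrite sE lerBlDr lerDl.
  rewrite divr_ge0 ?sqr_ge0// addr_ge0 ?mulr_ge0 ?exprn_ge0//; exact: ltW.
have a_0 := cvg_series_cvg_0 ca.
rewrite sE -[X in _ --> X]subr0; apply: cvgB; first exact: cvg_cst.
rewrite -[X in _ --> X](mul0r ((1 - r) ^+ 2)^-1); apply: cvgMr_tmp.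
rewrite -[X in _ --> X](addr0 0) -{1}(mul0r (1 - r)).
apply: cvgD; first exact: cvgMr_tmp.
have r1' : `|r| < 1 by rewrite ger0_norm.
rewrite -[X in _ --> X](mulr0 2) -(mulr0 r).
by apply: cvgMl_tmp; apply: cvgMl_tmp; exact: cvg_expr.
Qed.

Lemma sum_cubic_geometric_le (r : R) : 0 <= r < 1 -> exists M, forall n,
  \sum_(i < n) (3 * i%:R ^+ 2 + 3 * i%:R + 1) * r ^+ i <= M.
Proof.
move=> /andP[r0 r1]; have r10 : 0 < 1 - r by rewrite subr_gt0.
(* The summand telescopes as [V i - V i.+1] with [V i = (al i^2 + be i + ga) r^i]. *)
pose al := 3 / (1 - r); pose be := (3 + 2 * al * r) / (1 - r).
pose ga := (1 + r * (al + be)) / (1 - r).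
have al0 : 0 <= al by rewrite divr_ge0// ltW.
have be0 : 0 <= be by rewrite divr_ge0 ?(ltW r10)// addr_ge0// mulr_ge0// mulr_ge0.
have ga0 : 0 <= ga by rewrite divr_ge0 ?(ltW r10)// addr_ge0// mulr_ge0// addr_ge0.
exists ga => n.
have -> : \sum_(i < n) (3 * i%:R ^+ 2 + 3 * i%:R + 1) * r ^+ i =
    ga - (al * n%:R ^+ 2 + be * n%:R + ga) * r ^+ n.
  elim: n => [|n IH]; first by rewrite big_ord0 expr0; ring.
  rewrite big_ord_recr /= IH (exprS r n) -(natr1 n) /ga /be /al; field.
  by rewrite gt_eqF.
rewrite gerBl mulr_ge0 ?exprn_ge0// addr_ge0// addr_ge0//.
  by rewrite mulr_ge0// sqr_ge0.
by rewrite mulr_ge0.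
Qed.

Lemma disp_sqr w : \sum_(i < disp w) (2 * i%:R + 1) = (disp w)%:R ^+ 2 :> R.
Proof.
elim: (disp w) => [|n IH]; first by rewrite big_ord0 expr0n.
by rewrite big_ord_recr /= IH -(natr1 n); ring.
Qed.

Lemma disp_cube w : \sum_(i < disp w) (3 * i%:R ^+ 2 + 3 * i%:R + 1) = (disp w)%:R ^+ 3 :> R.
Proof.
elim: (disp w) => [|n IH]; first by rewrite big_ord0 expr0n.
by rewrite big_ord_recr /= IH -(natr1 n); ring.
Qed.

Let q01 : 0 <= q ^+ 2 < 1.
Proof. by case/andP: hp => h0 h1; rewrite sqr_ge0/= exprn_ilt1//; lra. Qed.

Lemma second_moment : (\int[mu]_w ((disp w)%:R ^+ 2)%:E = (gamma0 p ^+ 2)%:E)%E.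
Proof.
case/andP: (hp) => p0 p1.
under eq_integral do rewrite -disp_sqr.
rewrite (@layer_cake (fun i => 2 * i%:R + 1)); last first.
  by move=> i; rewrite addr_ge0// mulr_ge0.
(* With q = 1 - p one has 1 + q^2 = 2 - 2p + p^2 and 1 - q^2 = p (2 - p). *)
have -> : gamma0 p ^+ 2 = q * ((1 + q ^+ 2) / (1 - q ^+ 2) ^+ 2).
  rewrite /gamma0 sqr_sqrtr; last first.
    by rewrite divr_ge0 ?mulr_ge0 ?sqr_ge0//; nra.
  by field; rewrite !gt_eqF//; nra.
apply/cvg_lim => //.
rewrite [X in X @ _](_ : _ = EFin \o
   (fun n => q * series (fun i => (2 * i%:R + 1) * (q ^+ 2) ^+ i) n)); last first.
  apply/funext => n; rewrite /= sumEFin /series /= mulr_sumr; congr EFin.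
  by apply: eq_bigr => i _; rewrite -exprM mul2n exprS; ring.
apply: cvg_EFin; first exact: nearW.
by apply: cvgMl_tmp; exact: series_odd_geometric.
Qed.

Lemma third_moment : exists M : R, (\int[mu]_w ((disp w)%:R ^+ 3)%:E <= M%:E)%E.
Proof.
have [M HM] := sum_cubic_geometric_le q01.
case/andP: (hp) => p0 p1; exists (q * M).
under eq_integral do rewrite -disp_cube.
have c0 i : 0 <= 3 * (i%:R : R) ^+ 2 + 3 * i%:R + 1.
  by rewrite addr_ge0// addr_ge0// mulr_ge0// sqr_ge0.
rewrite (@layer_cake (fun i => 3 * i%:R ^+ 2 + 3 * i%:R + 1))//.
apply: lime_le; first by apply: is_cvg_nneseries => i _ _; rewrite lee_fin mulr_ge0 ?exprn_ge0//; lra.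
apply: nearW => n; rewrite sumEFin lee_fin big_mkord.
apply: (@le_trans _ _ (q * \sum_(i < n) (3 * i%:R ^+ 2 + 3 * i%:R + 1) * (q ^+ 2) ^+ i)).
  rewrite mulr_sumr; apply: ler_sum => i _; by rewrite -exprM mul2n (exprS q i.*2) mulrCA.
by rewrite ler_wpM2l//; lra.
Qed.

End DisplacementMoments.

(** * Second-order Taylor bounds for the exponential *)

Section TaylorExp.
Context {R : realType}.

Lemma nonincreasing_from0 (f df : R -> R) (x : R) :
  (forall y : R, is_derive y (1 : R) f (df y)) -> (forall y, 0 <= y -> df y <= 0) ->
  0 <= x -> f x <= f 0.
Proof.
move=> df_ df0 x0; apply: (@ler0_derive1_nincry R f 0 _ _ _ 0 x) => //.
- move=> y; rewrite in_itv /= andbT => y0.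
  by rewrite derive1E (@derive_val _ _ _ _ _ _ _ (df_ y)) df0// ltW.
- apply: continuous_subspaceT => y.
  by apply: differentiable_continuous; apply/derivable1_diffP; case: (df_ y).
Qed.

Let expN (z : R) := expR (- z).

Let is_derive_expN (y : R) : is_derive y (1 : R) expN (- expR (- y)).
Proof.
apply: (is_derive_eq (is_derive1_comp (is_derive_expR (- y)) (is_deriveNid y 1))).
by rewrite mulrN1.
Qed.

Let is_derive_pow (c : R) n (y : R) :
  is_derive y (1 : R) (fun z : R => c * z ^+ n.+1) (c * n.+1%:R * y ^+ n).
Proof.
have h := is_deriveZ c (is_deriveX n.+1 (is_derive_id y (1 : R))).
rewrite (_ : (fun z : R => c * z ^+ n.+1) = c \*: (id ^+ n.+1)); last first.
  by rewrite exprfctE.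
by apply: (is_derive_eq h); rewrite /GRing.scale /= mulr1 mulrA.
Qed.

Lemma expRN_le2 (h : R) : 0 <= h -> expR (- h) <= 1 - h + h ^+ 2 / 2.
Proof.
move=> h0.
pose f (z : R) := expN z + (1 * z ^+ 1 + (- 2^-1) * z ^+ 2).
have := @nonincreasing_from0 f (fun z => - expR (- z) + (1 * 1%:R * z ^+ 0 + - 2^-1 * 2%:R * z ^+ 1)) h.
rewrite /f /expN oppr0 expR0 !expr0n /= !mulr0 !addr0 => H.
have : expR (- h) + (1 * h ^+ 1 + - 2^-1 * h ^+ 2) <= 1.
  apply: H => // [y|y y0].
    exact: is_deriveD (is_derive_expN y) (is_deriveD (is_derive_pow 1 0 y) (is_derive_pow (- 2^-1) 1 y)).
  by rewrite expr0 expr1; have := expR_ge1Dx (- y); lra.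
by rewrite expr1; lra.
Qed.

Lemma expRN_ge3 (h : R) : 0 <= h -> 1 - h + h ^+ 2 / 2 - h ^+ 3 / 6 <= expR (- h).
Proof.
move=> h0.
pose f (z : R) := - expN z + (-1 * z ^+ 1 + (2^-1 * z ^+ 2 + (- 6^-1) * z ^+ 3)).
have := @nonincreasing_from0 f (fun z => - - expR (- z) + (-1 * 1%:R * z ^+ 0 +
   (2^-1 * 2%:R * z ^+ 1 + - 6^-1 * 3%:R * z ^+ 2))) h.
rewrite /f /expN oppr0 expR0 !expr0n /= !mulr0 !addr0 => H.
have : - expR (- h) + (-1 * h ^+ 1 + (2^-1 * h ^+ 2 + - 6^-1 * h ^+ 3)) <= - 1.
  apply: H => // [y|y y0].
    exact: is_deriveD (is_deriveN (is_derive_expN y)) (is_deriveD (is_derive_pow (-1) 0 y)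
      (is_deriveD (is_derive_pow 2^-1 1 y) (is_derive_pow (- 6^-1) 2 y))).
  by rewrite expr0 expr1; have := expRN_le2 y0; lra.
by rewrite expr1; lra.
Qed.

(** As x and y are nonnegative, a factor exp(-min(x, y)) <= 1 can be taken out on either side of y.
    The constant 1 in place of 1/6 leaves room for crude estimates. *)
Lemma expR_taylor2 (x y : R) : 0 <= x -> 0 <= y ->
  `|expR (- x) - expR (- y) * (1 - (x - y) + (x - y) ^+ 2 / 2)| <= `|x - y| ^+ 3.
Proof.
move=> x0 y0; have [yx|xy] := leP y x.
  pose h := x - y; have h0 : 0 <= h by rewrite subr_ge0.
  have -> : x = y + h by rewrite /h addrC subrK.
  have -> : y + h - y = h by ring.
  rewrite opprD expRD -mulrBr normrM (ger0_norm (expR_ge0 _)) (ger0_norm h0).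
  have e1 : expR (- y) <= 1 by rewrite expR_le1 oppr_le0.
  have h3 : 0 <= h ^+ 3 by rewrite exprn_ge0.
  rewrite -[leRHS]mul1r ler_pM//.
  have := expRN_le2 h0; have := expRN_ge3 h0.
  by move=> i1 i2; rewrite ler_norml; apply/andP; split; lra.
(* It remains to bound 1 - exp(-k) (1 + k + k^2 / 2). The terms of degree 4 and 5 are below k^3 only
   for k <= 1, hence the case splits. *)
pose k := y - x; have k0 : 0 <= k by rewrite subr_ge0 ltW.
have -> : y = x + k by rewrite /k addrC subrK.
have -> : x - (x + k) = - k by ring.
rewrite opprD expRD opprK sqrrN -mulrA -{1}[expR (- x)]mulr1 -mulrBr normrM.
rewrite (ger0_norm (expR_ge0 _)) normrN (ger0_norm k0).
have e1 : expR (- x) <= 1 by rewrite expR_le1 oppr_le0.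
have k3 : 0 <= k ^+ 3 by rewrite exprn_ge0.
rewrite -[leRHS]mul1r ler_pM//.
have i1 := expRN_le2 k0; have i2 := expRN_ge3 k0.
have i3 := expR_gt0 (- k).
have i4 : expR (- k) * (1 + k) <= 1.
  rewrite -[leRHS](expRxMexpNx_1 k) [leLHS]mulrC ler_wpM2r ?expR_ge0//.
  exact: expR_ge1Dx.
rewrite ler_norml; apply/andP; split.
  have [k1|k1] := leP k 1.
    have : expR (- k) * (1 + k + k ^+ 2 / 2) <=
        (1 - k + k ^+ 2 / 2) * (1 + k + k ^+ 2 / 2).
      by rewrite ler_wpM2r// addr_ge0 ?divr_ge0 ?sqr_ge0// addr_ge0.
    have -> : (1 - k + k ^+ 2 / 2) * (1 + k + k ^+ 2 / 2) = 1 + k ^+ 4 / 4 by field.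
    have : k ^+ 4 <= k ^+ 3 by rewrite ler_wiXn2l.
    by lra.
  have : expR (- k) * (k ^+ 2 / 2) <= k / 2.
    have : expR (- k) * (1 + k) * (k / 2) <= 1 * (k / 2).
      by rewrite ler_wpM2r// divr_ge0.
    have : 0 <= expR (- k) * (k / 2) by rewrite mulr_ge0 ?divr_ge0// ltW.
    by rewrite expr2; lra.
  have : k <= k ^+ 3 by rewrite -[leLHS]expr1 ler_weXn2l// ltW.
  by lra.
have [k1|k1] := leP k 1.
  have : (1 - k + k ^+ 2 / 2 - k ^+ 3 / 6) * (1 + k + k ^+ 2 / 2) <=
      expR (- k) * (1 + k + k ^+ 2 / 2).
    by rewrite ler_wpM2r// addr_ge0 ?divr_ge0 ?sqr_ge0// addr_ge0.
  have -> : (1 - k + k ^+ 2 / 2 - k ^+ 3 / 6) * (1 + k + k ^+ 2 / 2) =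
    1 + k ^+ 4 / 12 - k ^+ 3 / 6 - k ^+ 5 / 12 by field.
  have : k ^+ 5 <= k ^+ 3 by rewrite ler_wiXn2l.
  have : 0 <= k ^+ 4 by rewrite exprn_ge0.
  by lra.
have : 0 <= expR (- k) * (1 + k + k ^+ 2 / 2).
  by rewrite mulr_ge0 ?expR_ge0// addr_ge0 ?divr_ge0 ?sqr_ge0// addr_ge0.
have : 1 <= k ^+ 3 by rewrite exprn_ege1// ltW.
by lra.
Qed.

End TaylorExp.

(** * Expansion of the one-step kernel *)

Section KernelExpansion.
Context (R : realType) (p : R) (mu : probability config R).
Hypothesis hp : 0 < p < 1.
Hypothesis mu_law : config_law p mu.

Local Notation D m w := ((displacement m w)%:~R : R).

Lemma measurable_displacement2 d (Y : measurableType d) m m' (G : int -> int -> Y) :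
  measurable_fun setT (fun w => G (displacement m w) (displacement m' w)).
Proof.
apply: (measurable_fun_countable (fun z : int * int => G z.1 z.2)
  (f := fun w => (displacement m w, displacement m' w))) => z.
by apply: mpred_pair => y; exact: mpred_displacement.
Qed.

Lemma displacement_integral m (f : int -> \bar R) :
  (\int[mu]_w f (displacement m w) = \int[mu]_w f (displacement 0 w))%E.
Proof.
rewrite -(shift_integral mu_law (m%:Z, 0) (measurable_displacement2 0 0 (fun x _ => f x))).
by apply: eq_integral => w _; rewrite displacement_shift.
Qed.

Lemma displacement_Rintegral m (f : int -> R) :
  \int[mu]_w f (displacement m w) = \int[mu]_w f (displacement 0 w).
Proof. by congr fine; exact: (displacement_integral m (EFin \o f)). Qed.

Lemma normr_displacement m w : `|D m w| = (`|displacement m w|%N)%:R.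
Proof. by rewrite -intr_norm -abszE. Qed.

Lemma integrable_cube m : mu.-integrable setT (fun w => (`|D m w| ^+ 3)%:E).
Proof.
apply/integrableP; split.
  exact: (measurable_displacement2 m m (fun x _ => (`|x%:~R| ^+ 3)%:E)).
have [M HM] := third_moment hp mu_law.
apply: (@le_lt_trans _ _ M%:E); last by rewrite ltry.
apply: le_trans HM; rewrite le_eqVlt; apply/orP; left; apply/eqP.
rewrite -(displacement_integral m (fun x => ((`|x|%N)%:R ^+ 3)%:E)).
apply: eq_integral => w _.
by rewrite abse_EFin normrX normr_id normr_displacement.
Qed.

Lemma third_moment_bound : exists2 M : R, 0 <= M & forall m,
  \int[mu]_w (`|D m w| ^+ 3) <= M.
Proof.
exists (\int[mu]_w (`|D 0 w| ^+ 3)); first by apply: Rintegral_ge0 => w _; rewrite exprn_ge0.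
by move=> m; rewrite (displacement_Rintegral m (fun x => `|x%:~R| ^+ 3)).
Qed.

Lemma integrable_displacement m (G : int -> int -> R) (c : R) :
  (forall x y, `|G x y| <= c * (1 + `|x%:~R| ^+ 3 + `|y%:~R| ^+ 3)) ->
  mu.-integrable setT (fun w => (G (displacement m w) (displacement 0 w))%:E).
Proof.
move=> Gc.
apply: (@le_integrable _ _ _ mu setT measurableT _
   (fun w => (c%:E * (1%:E + (`|D m w| ^+ 3)%:E + (`|D 0 w| ^+ 3)%:E))%E)).
- exact: (measurable_displacement2 m 0 (fun x y => (G x y)%:E)).
- move=> w _; rewrite -!EFinD -EFinM !abse_EFin lee_fin.
  by apply: le_trans (ler_norm _); exact: Gc.
apply: integrableZl => //; apply: integrableD => //; last exact: integrable_cube.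
apply: integrableD => //; last exact: integrable_cube.
exact: (finite_measure_integrable_cst mu 1 measurableT).
Qed.

Lemma cube_bound1 (x : R) : 0 <= x -> x <= 1 + x ^+ 3.
Proof.
move=> x0; have [x1|x1] := leP x 1; first by have := exprn_ge0 3 x0; lra.
have : x <= x ^+ 3 by rewrite -[leLHS]expr1 ler_weXn2l// ltW.
by lra.
Qed.

Lemma cube_bound2 (x : R) : 0 <= x -> x ^+ 2 <= 1 + x ^+ 3.
Proof.
move=> x0; have [x1|x1] := leP x 1.
  have := exprn_ge0 3 x0; have : x ^+ 2 <= 1 by rewrite exprn_ile1.
  by lra.
have : x ^+ 2 <= x ^+ 3 by rewrite ler_weXn2l// ltW.
by lra.
Qed.

Lemma mean_displacement m : \int[mu]_w D m w = \int[mu]_w D 0 w.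
Proof. exact: (displacement_Rintegral m (fun x => x%:~R)). Qed.

Lemma square_displacement m : \int[mu]_w (D m w ^+ 2) = gamma0 p ^+ 2.
Proof.
rewrite (displacement_Rintegral m (fun x => x%:~R ^+ 2)).
have /(congr1 fine) := second_moment hp mu_law; rewrite /= => <-.
by congr fine; apply: eq_integral => w _; rewrite -normr_displacement real_normK ?num_real.
Qed.

Section Reflection.
Variables (m r : nat).
Hypothesis rm : (r.*2 < m)%N.

(* The configuration is reflected inside a window around [m] that the walker
   started at 0 does not see if it moves by at most [r]. *)
Definition window_reflection (u : vertex) : vertex :=
  if (u.2 == 1) && (`|u.1 - m%:Z| <= r)%N then (m%:Z + m%:Z - u.1, u.2) else u.

Lemma window_reflectionK : involutive window_reflection.
Proof.
case=> x t; rewrite /window_reflection /=.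
case: (boolP ((t == 1) && (`|x - m%:Z| <= r)%N)) => [h|h] /=; last by rewrite (negbTE h).
have h' : (t == 1) && (`|(m%:Z + m%:Z - x - m%:Z)%R| <= r)%N.
  by case/andP: h => -> xr /=; lia.
by rewrite h'; congr (_, _); lia.
Qed.

(** The sign at (m, 0) is flipped as well, so that a tie seen from [m] is broken in the mirrored
    direction. *)
Definition reflect_config : config -> config :=
  remap window_reflection id (fun u => u == (m%:Z, 0)).

Lemma reflect_configK : involutive reflect_config.
Proof.
move=> [b s]; rewrite /reflect_config /remap /=; congr (_, _); apply/funext => u.
  by rewrite window_reflectionK.
by rewrite addbK.
Qed.

Lemma opens_reflect w x : opens (reflect_config w) (x, 0 + 1) =
  if (`|x - m%:Z| <= r)%N then opens w (m%:Z + m%:Z - x, 0 + 1) else opens w (x, 0 + 1).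
Proof. by rewrite /opens /= /window_reflection /=; case: ifP. Qed.

Lemma sign_of_reflect_center w :
  sign_of (reflect_config w) (m%:Z, 0) = - sign_of w (m%:Z, 0).
Proof. by rewrite /sign_of /= eqxx; case: (w.2 _). Qed.

Lemma sign_of_reflect_origin w : sign_of (reflect_config w) (0, 0) = sign_of w (0, 0).
Proof.
have m0 : ((0, 0) == (m%:Z, 0) :> vertex) = false by rewrite xpair_eqE; lia.
by rewrite /sign_of /= m0 addbF.
Qed.

Lemma row_open_reflect w : row_open (opens w) (0 + 1) ->
  row_open (opens (reflect_config w)) (0 + 1).
Proof.
case=> x bx; have [xr|xr] := leqP `|x - m%:Z| r.
  exists (m%:Z + m%:Z - x); rewrite opens_reflect ifT; last by lia.
  by rewrite (_ : m%:Z + m%:Z - (m%:Z + m%:Z - x) = x)//; lia.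
by exists x; rewrite opens_reflect leqNgt xr.
Qed.

Lemma displacement_reflect_center w : row_open (opens w) (0 + 1) ->
  (`|displacement m w| <= r)%N -> displacement m (reflect_config w) = - displacement m w.
Proof.
move=> ro; rewrite /displacement; set y := cstep 0 m%:Z w => yr.
have [by_ cy sy] := @step_relP (opens w) (sign_of w) 0 m%:Z (signs_sign_of w) ro.
rewrite -/(cstep 0 m%:Z w) -/y in by_ cy sy.
suff -> : cstep 0 m%:Z (reflect_config w) = m%:Z + m%:Z - y by ring.
apply: step_eq; [exact: signs_sign_of|exact: row_open_reflect|split].
- rewrite opens_reflect ifT; last by lia.
  by rewrite (_ : m%:Z + m%:Z - (m%:Z + m%:Z - y) = y)//; lia.
- move=> z zy; rewrite opens_reflect ifT; last by lia.
  by apply: cy; lia.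
- rewrite opens_reflect ifT; last by lia.
  rewrite (_ : m%:Z + m%:Z - (m%:Z + m%:Z - (m%:Z + m%:Z - y)) = m%:Z + m%:Z - y); last by lia.
  move/sy; rewrite sign_of_reflect_center.
  have -> : (`|(m%:Z + m%:Z - y - m%:Z)%R| = `|(y - m%:Z)%R|)%N by lia.
  by move=> {1}->; ring.
Qed.

Lemma displacement_reflect_origin w : row_open (opens w) (0 + 1) ->
  (`|displacement 0 w| <= r)%N -> displacement 0 (reflect_config w) = displacement 0 w.
Proof.
move=> ro; rewrite /displacement !subr0; set y := cstep 0 0 w => yr.
have [by_ cy sy] := @step_relP (opens w) (sign_of w) 0 0 (signs_sign_of w) ro.
rewrite -/(cstep 0 0 w) -/y in by_ cy sy.
have far z : (`|z| <= r)%N -> opens (reflect_config w) (z, 0 + 1) = opens w (z, 0 + 1).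
  by move=> zr; rewrite opens_reflect ifF//; apply/negbTE; lia.
apply: step_eq; [exact: signs_sign_of|exact: row_open_reflect|split].
- by rewrite far.
- by move=> z zy; rewrite far; [exact: cy|lia].
- by rewrite far; [rewrite sign_of_reflect_origin|lia].
Qed.

Let G (x y : int) : R := if (`|x| <= r)%N && (`|y| <= r)%N then x%:~R * y%:~R else 0.

(** While both displacements stay within r, the reflection negates the one at [m] and fixes the one
    at 0, as their windows are disjoint. Being an involution, it also preserves the truncation. *)
Lemma truncated_reflect w :
  G (displacement m (reflect_config w)) (displacement 0 (reflect_config w)) =
  - G (displacement m w) (displacement 0 w).
Proof.
have [ro|nro] := pselect (row_open (opens w) (0 + 1)); last first.
  have nro' : ~ row_open (opens (reflect_config w)) (0 + 1).
    by move/row_open_reflect; rewrite reflect_configK.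
  by rewrite /displacement /cstep !step_closed// !subrr /G /= mul0r oppr0.
rewrite /G; case: ifPn => [/andP[h1 h2]|h].
  have ro' := row_open_reflect ro.
  have e1 := displacement_reflect_center ro' h1.
  have e2 := displacement_reflect_origin ro' h2.
  rewrite reflect_configK in e1 e2.
  by rewrite e1 e2 abszN h1 h2 /= intrN mulNr opprK.
case: ifPn => [/andP[h1 h2]|_]; last by rewrite oppr0.
move: h; rewrite displacement_reflect_center// displacement_reflect_origin//.
by rewrite abszN h1 h2.
Qed.

Lemma truncated_covariance : \int[mu]_w G (displacement m w) (displacement 0 w) = 0.
Proof.
have mG := measurable_displacement2 m 0 (fun x y => (G x y)%:E).
have H : \int[mu]_w G (displacement m w) (displacement 0 w) =
    \int[mu]_w (- 1 * G (displacement m w) (displacement 0 w)).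
  congr fine; rewrite -(remap_integral mu_law (fun u => u == (m%:Z, 0))
    window_reflectionK (fun u => erefl : id (id u) = u) mG).
  by apply: eq_integral => w _; rewrite truncated_reflect mulN1r.
move: H; rewrite RintegralZl//; first by lra.
apply: (integrable_displacement m (c := (r%:R ^+ 2))) => x y; rewrite /G.
case: ifPn => [/andP[xr yr]|_]; last first.
  by rewrite normr0 mulr_ge0 ?sqr_ge0// addr_ge0 ?exprn_ge0// addr_ge0 ?exprn_ge0.
apply: (@le_trans _ _ (r%:R ^+ 2)).
  rewrite normrM expr2 ler_pM// -intr_norm -abszE ler_nat//.
by rewrite ler_peMr ?sqr_ge0// -addrA lerDl addr_ge0 ?exprn_ge0.
Qed.

End Reflection.

End KernelExpansion.

Section KernelAsymptotics.
Context (R : realType) (p : R) (mu : probability config R).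
Hypothesis hp : 0 < p < 1.
Hypothesis mu_law : config_law p mu.

Local Notation D m w := ((displacement m w)%:~R : R).
Local Notation integrable f := (mu.-integrable setT (EFin \o f)).

Let intD (f g : config -> R) : integrable f -> integrable g ->
  integrable (fun w => f w + g w).
Proof. by move=> mf mg; have := integrableD measurableT mf mg; apply. Qed.

Let intZ (c : R) (f : config -> R) : integrable f -> integrable (fun w => c * f w).
Proof. by move=> mf; have := integrableZl measurableT c mf; apply. Qed.

Let int1 m : integrable (fun w => D m w).
Proof.
have := integrable_displacement hp mu_law m (G := fun x _ => x%:~R) (c := 1); apply.
move=> x y; have := @cube_bound1 R `|x%:~R| (normr_ge0 _).
by have := exprn_ge0 3 (normr_ge0 (y%:~R : R)); lra.
Qed.

Let int2 m : integrable (fun w => D m w ^+ 2).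
Proof.
have := integrable_displacement hp mu_law m (G := fun x _ => x%:~R ^+ 2) (c := 1); apply.
move=> x y; have := @cube_bound2 R `|x%:~R| (normr_ge0 _); rewrite normrX.
by have := exprn_ge0 3 (normr_ge0 (y%:~R : R)); lra.
Qed.

Let int11 m : integrable (fun w => D m w * D 0 w).
Proof.
have := integrable_displacement hp mu_law m (G := fun x y => x%:~R * y%:~R) (c := 1); apply.
move=> x y; have := @cube_bound2 R `|x%:~R| (normr_ge0 _).
have := @cube_bound2 R `|y%:~R| (normr_ge0 _); rewrite normrM.
set a := `|x%:~R|; set b := `|y%:~R|.
by have := sqr_ge0 (a - b); have := exprn_ge0 3 (normr_ge0 (x%:~R : R));
  have := exprn_ge0 3 (normr_ge0 (y%:~R : R)); rewrite -/a -/b sqrrB; lra.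
Qed.

Let int3 m : integrable (fun w => `|D m w| ^+ 3 + `|D 0 w| ^+ 3).
Proof. by apply: intD; exact: (integrable_cube hp mu_law). Qed.

Lemma sqr_mul_le_cubes (a b : R) : 0 <= a -> 0 <= b -> a ^+ 2 * b <= a ^+ 3 + b ^+ 3.
Proof.
move=> a0 b0; have a3 := exprn_ge0 3 a0; have b3 := exprn_ge0 3 b0.
have [ab|ba] := leP b a.
  have : a ^+ 2 * b <= a ^+ 3 by rewrite [leRHS]exprSr ler_wpM2l ?sqr_ge0.
  by lra.
have : a ^+ 2 * b <= b ^+ 3 by rewrite [leRHS]exprSr ler_wpM2r// lerXn2r ?nnegrE// ltW.
by lra.
Qed.

(** The truncated part vanishes by reflection. Elsewhere one displacement exceeds r, hence is at
    least m / 2, and this extra factor is paid for by third moments. *)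
Lemma covariance_bound : exists2 C : R, 0 <= C & forall m, (0 < m)%N ->
  `|\int[mu]_w (D m w * D 0 w)| <= C / m%:R.
Proof.
have [M M0 HM] := third_moment_bound mu_law.
exists (2 * (M + M)); first by lra.
move=> m m0; have mR : (0 : R) < m%:R by rewrite ltr0n.
(* The largest radius for which the windows around 0 and m are disjoint. *)
pose r := m.-1./2.
have rm : (r.*2 < m)%N by rewrite /r; lia.
pose G (x y : int) : R := if (`|x| <= r)%N && (`|y| <= r)%N then x%:~R * y%:~R else 0.
have G0 := truncated_covariance hp mu_law rm; rewrite -/(G _ _) in G0.
have iG : integrable (fun w => G (displacement m w) (displacement 0 w)).
  apply: (integrable_displacement hp mu_law m (c := (r%:R ^+ 2))) => x y; rewrite /G.
  case: ifPn => [/andP[xr yr]|_]; last first.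
    by rewrite normr0 mulr_ge0 ?sqr_ge0// addr_ge0 ?exprn_ge0// addr_ge0 ?exprn_ge0.
  apply: (@le_trans _ _ (r%:R ^+ 2)).
    rewrite normrM expr2 ler_pM// -intr_norm -abszE ler_nat//.
  by rewrite ler_peMr ?sqr_ge0// -addrA lerDl addr_ge0 ?exprn_ge0.
rewrite -[X in `|X|]subr0 -[X in _ - X]G0 -RintegralB//.
apply: (le_trans (le_normr_Rintegral _ _)) => //.
  have := intD (int11 m) (intZ (-1) iG).
  by congr (mu.-integrable _ _); apply/funext => w /=; rewrite mulN1r.
apply: (@le_trans _ _ (\int[mu]_w (2 / m%:R * (`|D m w| ^+ 3 + `|D 0 w| ^+ 3)))); last first.
  rewrite RintegralZl// RintegralD//; [|exact: (integrable_cube hp mu_law)..].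
  have := HM m; have := HM 0%N => h1 h2.
  have : 2 / m%:R * (\int[mu]_w (`|D m w| ^+ 3) + \int[mu]_w (`|D 0 w| ^+ 3)) <= 2 / m%:R * (M + M).
    by rewrite ler_wpM2l ?divr_ge0// lerD.
  by move/le_trans; apply; rewrite mulrAC.
apply: le_Rintegral => //.
- have := integrable_abse (intD (int11 m) (intZ (-1) iG)).
  by congr (mu.-integrable _ _); apply/funext => w /=; rewrite mulN1r.
- exact: intZ.
move=> w _; set x := displacement m w; set y := displacement 0 w.
rewrite /G; case: ifPn => [_|].
  by rewrite subrr normr0 mulr_ge0 ?divr_ge0// addr_ge0 ?exprn_ge0.
rewrite negb_and -!ltnNge subr0 normrM => xy.
rewrite mulrAC ler_pdivlMr//.
set a := `|x%:~R|; set b := `|y%:~R|.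
have a0 : 0 <= a by exact: normr_ge0.
have b0 : 0 <= b by exact: normr_ge0.
have ab := sqr_mul_le_cubes a0 b0; have ba := sqr_mul_le_cubes b0 a0.
have big z : (r < `|z|)%N -> m%:R <= 2 * `|z%:~R| :> R.
  rewrite -intr_norm -abszE -natrM ler_nat /r; clear; lia.
case/orP: xy => /big h.
  have : a * b * m%:R <= a * b * (2 * a) by rewrite ler_wpM2l// mulr_ge0.
  by rewrite expr2 in ab; lra.
have : a * b * m%:R <= a * b * (2 * b) by rewrite ler_wpM2l// mulr_ge0.
by rewrite expr2 in ba; lra.
Qed.

Definition laplace_kernel (a : R) (m : nat) : R :=
  \int[mu]_w expR (- (a * (one_gap m w)%:R)).

Lemma one_gapE m w : (one_gap m w)%:R = m%:R + (D m w - D 0 w).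
Proof.
have mono : cstep 0 0 w <= cstep 0 m%:Z w by apply: step_mono => //; exact: signs_sign_of.
rewrite /one_gap /displacement natr_absz ger0_norm ?subr_ge0// !intrB subr0.
by rewrite -!pmulrn; ring.
Qed.

(** Second-order expansion around the current gap m. The increment [Del] has mean 0 and second
    moment 2 gamma0^2 - 2c, with c = O(1 / m) the mixed moment; the cubic remainder gives the term C
    a^3. *)
Lemma laplace_kernel_expansion : exists2 C : R, 0 <= C & forall a m, 0 < a -> (0 < m)%N ->
  `|laplace_kernel a m - (1 + gamma0 p ^+ 2 * a ^+ 2) * expR (- (a * m%:R))|
    <= a ^+ 2 * (C / m%:R + C * a).
Proof.
have [M M0 HM] := third_moment_bound mu_law.
have [C C0 HC] := covariance_bound.
exists (C + 8 * M); first by rewrite addr_ge0// mulr_ge0.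
move=> a m a0 m0; have mR : (0 : R) < m%:R by rewrite ltr0n.
pose c := \int[mu]_w (D m w * D 0 w).
pose Del w := D m w - D 0 w.
have iDel : integrable Del.
  have := intD (int1 m) (intZ (-1) (int1 0)).
  by congr (mu.-integrable _ _); apply/funext => w /=; rewrite mulN1r.
have E1 : \int[mu]_w Del w = 0.
  by rewrite RintegralB// (mean_displacement mu_law m) subrr.
have DelE w : Del w ^+ 2 = D m w ^+ 2 + D 0 w ^+ 2 + (-2) * (D m w * D 0 w).
  by rewrite /Del; ring.
have iDel2 : integrable (fun w => Del w ^+ 2).
  have := intD (intD (int2 m) (int2 0)) (intZ (-2) (int11 m)).
  by congr (mu.-integrable _ _); apply/funext => w /=; rewrite DelE.
have E2 : \int[mu]_w (Del w ^+ 2) = 2 * gamma0 p ^+ 2 - 2 * c.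
  under eq_Rintegral do rewrite DelE.
  rewrite RintegralD//; [|exact: intD|exact: intZ].
  rewrite RintegralD// RintegralZl// !(square_displacement hp mu_law) -/c; ring.
pose q := expR (- (a * m%:R)).
pose T w := q * (1 + ((- a) * Del w + a ^+ 2 / 2 * Del w ^+ 2)).
have icst : integrable (fun=> 1) by exact: (finite_measure_integrable_cst mu 1 measurableT).
have iT0 : integrable (fun w => (- a) * Del w + a ^+ 2 / 2 * Del w ^+ 2).
  by apply: intD; exact: intZ.
have iT : integrable T by apply: intZ; exact: intD.
have ET : \int[mu]_w T w = q * (1 + a ^+ 2 / 2 * (2 * gamma0 p ^+ 2 - 2 * c)).
  rewrite RintegralZl//; last exact: intD.
  rewrite RintegralD// RintegralD//; [|exact: intZ..].
  rewrite !RintegralZl// E1 E2 mulr0 add0r Rintegral_cst// mul1r.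
  have muT : fine (mu setT) = 1 by rewrite probability_setT.
  by congr (_ * (_ + _)); exact: muT.
have iL : integrable (fun w => expR (- (a * (one_gap m w)%:R))).
  apply: (@le_integrable _ _ _ mu setT measurableT _ (EFin \o (fun=> 1))) => //.
    exact: (measurable_fun_countable (fun k => (expR (- (a * k%:R)))%:E) (mpred_one_gap m)).
  move=> w _; rewrite !abse_EFin lee_fin normr1 ger0_norm ?expR_ge0//.
  by rewrite expR_le1 oppr_le0 mulr_ge0// ltW.
have close : `|laplace_kernel a m - \int[mu]_w T w| <= a ^+ 3 * (8 * M).
  rewrite /laplace_kernel -RintegralB//.
  apply: (le_trans (le_normr_Rintegral _ _)) => //.
    have := intD iL (intZ (-1) iT).
    by congr (mu.-integrable _ _); apply/funext => w /=; rewrite mulN1r.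
  (* The 4 comes from (x + y)^3 <= 4 (x^3 + y^3); the two third moments then give 8 M. *)
  apply: (@le_trans _ _ (\int[mu]_w (a ^+ 3 * 4 * (`|D m w| ^+ 3 + `|D 0 w| ^+ 3)))); last first.
    rewrite RintegralZl// RintegralD//; [|exact: (integrable_cube hp mu_law)..].
    have := HM m; have := HM 0%N => h1 h2; rewrite -mulrA ler_wpM2l ?exprn_ge0 ?(ltW a0)//.
    by lra.
  apply: le_Rintegral => //.
  - have := integrable_abse (intD iL (intZ (-1) iT)).
    by congr (mu.-integrable _ _); apply/funext => w /=; rewrite mulN1r.
  - exact: intZ.
  move=> w _; rewrite /T.
  have x0 : 0 <= a * (one_gap m w)%:R by rewrite mulr_ge0// ltW.
  have y0 : 0 <= a * m%:R by rewrite mulr_ge0// ltW.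
  have e : a * (one_gap m w)%:R - a * m%:R = a * Del w by rewrite one_gapE /Del; ring.
  have := expR_taylor2 x0 y0; rewrite e -/q => H.
  have -> : 1 + (- a * Del w + a ^+ 2 / 2 * Del w ^+ 2) = 1 - a * Del w + (a * Del w) ^+ 2 / 2.
    by field.
  apply: (le_trans H); rewrite normrM exprMn (gtr0_norm a0) -mulrA.
  rewrite ler_wpM2l ?exprn_ge0 ?(ltW a0)//.
  have := ler_normB (D m w) (D 0 w); rewrite -/(Del w).
  set x := `|D m w|; set y := `|D 0 w| => xy.
  have x00 : 0 <= x by exact: normr_ge0.
  have y00 : 0 <= y by exact: normr_ge0.
  apply: (@le_trans _ _ ((x + y) ^+ 3)).
    by rewrite lerXn2r ?nnegrE// addr_ge0.
  have := sqr_mul_le_cubes x00 y00; have := sqr_mul_le_cubes y00 x00.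
  have : 0 <= (x + y) * (x - y) ^+ 2 by rewrite mulr_ge0 ?sqr_ge0// addr_ge0.
  have -> : (x + y) * (x - y) ^+ 2 = x ^+ 3 + y ^+ 3 - x ^+ 2 * y - y ^+ 2 * x by ring.
  have -> : (x + y) ^+ 3 = x ^+ 3 + y ^+ 3 + 3 * (x ^+ 2 * y) + 3 * (y ^+ 2 * x) by ring.
  by lra.
have q0 : 0 <= q by exact: expR_ge0.
have q1 : q <= 1 by rewrite expR_le1 oppr_le0 mulr_ge0// ltW.
have main : `|\int[mu]_w T w - (1 + gamma0 p ^+ 2 * a ^+ 2) * q| <= a ^+ 2 * (C / m%:R).
  have -> : \int[mu]_w T w - (1 + gamma0 p ^+ 2 * a ^+ 2) * q = - (a ^+ 2 * (q * c)).
    by rewrite ET; field.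
  rewrite normrN normrM (ger0_norm (sqr_ge0 a))// ler_wpM2l ?sqr_ge0//.
  rewrite normrM (ger0_norm q0); apply: le_trans (HC m m0).
  by rewrite ler_piMl.
rewrite -/q.
have -> : laplace_kernel a m - (1 + gamma0 p ^+ 2 * a ^+ 2) * q =
  (laplace_kernel a m - \int[mu]_w T w) + (\int[mu]_w T w - (1 + gamma0 p ^+ 2 * a ^+ 2) * q) by ring.
apply: (le_trans (ler_normD _ _)); apply: (le_trans (lerD close main)).
have k1 : 0 <= a ^+ 2 * (8 * M / m%:R).
  by rewrite mulr_ge0 ?sqr_ge0// divr_ge0// mulr_ge0.
have k2 : 0 <= a ^+ 3 * C by rewrite mulr_ge0// exprn_ge0// ltW.
have -> : a ^+ 2 * ((C + 8 * M) / m%:R + (C + 8 * M) * a) =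
  a ^+ 2 * (C / m%:R) + a ^+ 2 * (8 * M / m%:R) + a ^+ 3 * C + a ^+ 3 * (8 * M) by ring.
by lra.
Qed.

End KernelAsymptotics.

(** * The absorbed gap chain and its survival probability *)

Section GapProcess.
Context (R : realType) (p : R) (mu : probability config R).
Hypothesis hp : 0 < p < 1.
Hypothesis mu_law : config_law p mu.
Implicit Types (f g : nat -> R) (n m : nat) (w : config).

Local Notation gap0 := (gap 0).

Definition gap_mean n f : R := \int[mu]_w f (gap0 n w).

Lemma bounded_integrable (h : config -> nat) f c : (forall k, mpred (fun w => h w = k)) ->
  (forall k, `|f k| <= c) -> mu.-integrable setT (EFin \o (fun w => f (h w))).
Proof.
move=> mh fc.
apply: (@le_integrable _ _ _ mu setT measurableT _ (EFin \o (fun=> c))) => //.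
- exact: (measurable_fun_countable (fun k => (f k)%:E) mh).
- by move=> w _; rewrite !abse_EFin lee_fin; apply: (le_trans (fc _)); exact: ler_norm.
- exact: (finite_measure_integrable_cst mu c measurableT).
Qed.

Lemma gap_integrable n f c : (forall k, `|f k| <= c) ->
  mu.-integrable setT (EFin \o (fun w => f (gap0 n w))).
Proof. by apply: bounded_integrable => k; exact: mpred_gap. Qed.

Definition bounded_fun f := exists c, forall k, `|f k| <= c.

Lemma gap_meanD n f g : bounded_fun f -> bounded_fun g ->
  gap_mean n (fun k => f k + g k) = gap_mean n f + gap_mean n g.
Proof. by move=> [c fc] [c' gc]; apply: RintegralD => //; exact: gap_integrable. Qed.

Lemma gap_meanZ n c f : bounded_fun f -> gap_mean n (fun k => c * f k) = c * gap_mean n f.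
Proof. by move=> [c' fc]; apply: RintegralZl => //; exact: gap_integrable. Qed.

Lemma gap_mean_le n f g : bounded_fun f -> bounded_fun g -> (forall k, f k <= g k) ->
  gap_mean n f <= gap_mean n g.
Proof. by move=> [c fc] [c' gc] fg; apply: le_Rintegral => //; exact: gap_integrable. Qed.

Lemma gap_mean1 n : gap_mean n (fun=> 1) = 1.
Proof.
rewrite /gap_mean Rintegral_cst// mul1r.
have muT : fine (mu setT) = 1 by rewrite probability_setT.
exact: muT.
Qed.

Lemma bounded_cst c : bounded_fun (fun=> c).
Proof. by exists `|c|. Qed.

Lemma bounded_add f g : bounded_fun f -> bounded_fun g -> bounded_fun (fun k => f k + g k).
Proof.
move=> [c fc] [c' gc]; exists (c + c') => k.
by apply: (le_trans (ler_normD _ _)); exact: lerD.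
Qed.

Lemma bounded_mul f g : bounded_fun f -> bounded_fun g -> bounded_fun (fun k => f k * g k).
Proof. by move=> [c fc] [c' gc]; exists (c * c') => k; rewrite normrM ler_pM. Qed.

Lemma bounded_opp f : bounded_fun f -> bounded_fun (fun k => - f k).
Proof. by move=> [c fc]; exists c => k; rewrite normrN. Qed.

Lemma bounded_bool (b : nat -> bool) : bounded_fun (fun k => (b k)%:R).
Proof. by exists 1 => k; case: (b k); rewrite ?normr1// normr0. Qed.

Lemma bounded_sum (r : seq nat) (F : nat -> nat -> R) : (forall m, bounded_fun (F m)) ->
  bounded_fun (fun k => \sum_(m <- r) F m k).
Proof.
move=> bF; elim: r => [|m r IH].
  by under [X in bounded_fun X]eq_fun do rewrite big_nil; exact: bounded_cst.
by under [X in bounded_fun X]eq_fun do rewrite big_cons; exact: bounded_add.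
Qed.

Lemma gap_mean_sum n (r : seq nat) (F : nat -> nat -> R) : (forall m, bounded_fun (F m)) ->
  \sum_(m <- r) gap_mean n (F m) = gap_mean n (fun k => \sum_(m <- r) F m k).
Proof.
move=> bF; elim: r => [|m r IH].
  rewrite big_nil; apply/esym; rewrite /gap_mean.
  under eq_Rintegral do rewrite big_nil.
  by rewrite Rintegral_cst// mul0r.
rewrite big_cons IH -gap_meanD//; last exact: bounded_sum.
by apply: eq_Rintegral => w _; rewrite big_cons.
Qed.

Lemma gap_meanB n f g : bounded_fun f -> bounded_fun g ->
  gap_mean n (fun k => f k - g k) = gap_mean n f - gap_mean n g.
Proof.
move=> bf bg; rewrite -mulN1r -gap_meanZ// -gap_meanD//; last first.
  by apply: bounded_mul => //; exact: bounded_cst.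
by congr (gap_mean n _); apply/funext => k; rewrite mulN1r.
Qed.

Lemma gap_mean_abs n f : bounded_fun f -> `|gap_mean n f| <= gap_mean n (fun k => `|f k|).
Proof. by move=> [c fc]; apply: le_normr_Rintegral => //; exact: gap_integrable. Qed.

Lemma gap_meanS n f : (forall k, 0 <= f k <= 1) ->
  gap_mean n.+1 f = gap_mean n (fun m => \int[mu]_w f (one_gap m w)).
Proof.
move=> f01; rewrite /gap_mean /Rintegral.
rewrite (@gap_markov _ _ _ mu_law (EFin \o f)); last first.
  by move=> m; rewrite /= lee_fin; case/andP: (f01 m).
congr fine; apply: eq_integral => w _; rewrite fineK//.
have := @bounded_integrable (one_gap (gap0 n w)) f 1 (mpred_one_gap _).
have f1 k : `|f k| <= 1 by have /andP[h0 h1] := f01 k; rewrite ger0_norm.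
by move=> /(_ f1) /integrable_fin_num; exact.
Qed.

Lemma gap_start w : gap0 0 w = 1%N.
Proof. by []. Qed.

Lemma one_gap0 w : one_gap 0 w = 0%N.
Proof. by rewrite /one_gap subrr. Qed.

Lemma gap_mean0 f : gap_mean 0 f = f 1%N.
Proof.
rewrite -[RHS]mulr1 -(gap_mean1 0) -gap_meanZ; last exact: bounded_cst.
by apply: eq_Rintegral => w _; rewrite gap_start mulr1.
Qed.

Definition survival n := gap_mean n (fun k => (0 < k)%N%:R).

Lemma survival_unit : unit_seq survival.
Proof.
move=> n; rewrite /survival; apply/andP; split.
  by apply: Rintegral_ge0 => w _; case: ltnP.
rewrite -[leRHS](gap_mean1 n); apply: gap_mean_le; [exact: bounded_bool|exact: bounded_cst|].
by move=> k; case: ltnP.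
Qed.

Lemma gap_absorbed n w : gap0 n w = 0%N -> gap0 n.+1 w = 0%N.
Proof.
move/eqP; rewrite absz_eq0 subr_eq0 => /eqP e.
by rewrite /gap !cflowS e subrr.
Qed.

Lemma survival_nonincreasing : nonincreasing_seq survival.
Proof.
have [c hc] := bounded_bool (fun k => (0 < k)%N).
apply/nonincreasing_seqP => n; apply: le_Rintegral => //.
- exact: (gap_integrable _ hc).
- exact: (gap_integrable _ hc).
move=> w _; rewrite ler_nat /=; case: (posnP (gap0 n w)) => [e|_].
  by rewrite gap_absorbed.
by case: ltnP.
Qed.

Definition occupation n m := gap_mean n (fun k => (k == m)%:R).

(* Each visit to [m] is followed by absorption at 0 with a fixed probability. *)
Lemma occupation_bound m : (0 < m)%N -> exists C, forall N,
  \sum_(n < N) occupation n m <= C.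
Proof.
move=> m0; pose r : R := \int[mu]_w ((one_gap m w == 0%N)%:R).
have rE : (r%:E = mu [set w | one_gap m w = 0%N])%E.
  rewrite /r /Rintegral fineK; last first.
    apply: integrable_fin_num => //.
    apply: (@bounded_integrable _ (fun k => (k == 0%N)%:R) 1 (mpred_one_gap m)) => j.
    by case: eqP; rewrite ?normr1 ?normr0.
  pose A : set config := [set w | one_gap m w = 0%N].
  rewrite -[RHS]/(mu A) -[A in RHS]setIT -integral_indic//; last exact: mpred_one_gap.
  apply: eq_integral => w _; rewrite indicE; congr (_%:R)%:E; congr nat_of_bool.
  by apply/eqP/idP; rewrite inE.
have r0 : 0 < r by rewrite -lte_fin rE; exact: coalescence_positive hp mu_law _ m0.
exists r^-1 => N.
pose z n := gap_mean n (fun k => (k == 0%N)%:R).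
have z01 n : 0 <= z n <= 1.
  apply/andP; split; first by apply: Rintegral_ge0 => w _.
  rewrite -[leRHS](gap_mean1 n); apply: gap_mean_le; [exact: bounded_bool|exact: bounded_cst|].
  by move=> k; case: eqP.
(* As [z] is bounded by 1, these increments telescope and bound the total occupation by 1 / r. *)
have step n : z n + r * occupation n m <= z n.+1.
  rewrite /z gap_meanS; last by move=> k; case: eqP; rewrite ?lexx ?ler01.
  rewrite /occupation -gap_meanZ; last exact: bounded_bool.
  rewrite -gap_meanD; [|exact: bounded_bool|]; last first.
    by apply: bounded_mul; [exact: bounded_cst|exact: bounded_bool].
  have ge0 k : 0 <= \int[mu]_w ((one_gap k w == 0%N)%:R : R).
    by apply: Rintegral_ge0 => w _.
  have le1 k : \int[mu]_w ((one_gap k w == 0%N)%:R : R) <= 1.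
    rewrite -[leRHS](gap_mean1 0); apply: le_Rintegral => //.
    + apply: (@bounded_integrable _ (fun k => (k == 0%N)%:R) 1 (mpred_one_gap k)) => j.
      by case: eqP; rewrite ?normr1 ?normr0.
    + exact: (finite_measure_integrable_cst mu 1 measurableT).
    + by move=> w _; case: eqP.
  apply: gap_mean_le.
  - apply: bounded_add; first exact: bounded_bool.
    by apply: bounded_mul; [exact: bounded_cst|exact: bounded_bool].
  - by exists 1 => k; rewrite ger0_norm; [exact: le1|exact: ge0].
  move=> k; case: eqP => [->|k0].
    rewrite eq_sym (gtn_eqF m0) mulr0 addr0.
    rewrite (_ : (fun w => _) = fun=> 1); first by rewrite -/(gap_mean 0 (fun=> 1)) gap_mean1.
    by apply/funext => w; rewrite one_gap0.
  rewrite add0r; case: eqP => [->|_]; first by rewrite mulr1.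
  by rewrite mulr0; exact: ge0.
rewrite -[leRHS]div1r ler_pdivlMr// mulrC.
have : z 0%N + r * \sum_(n < N) occupation n m <= z N.
  elim: N => [|N IH]; first by rewrite big_ord0 mulr0 addr0.
  rewrite big_ord_recr /= mulrDr addrA; apply: le_trans (step N).
  by rewrite lerD2r.
have /andP[h1 _] := z01 0%N; have /andP[_ h2] := z01 N; lra.
Qed.

Definition surviving_laplace (a : R) n :=
  gap_mean n (fun k => expR (- (a * k%:R)) * (0 < k)%N%:R).

Let lap (a : R) (k : nat) := expR (- (a * k%:R)).

Let lap01 a k : 0 < a -> 0 <= lap a k <= 1.
Proof.
by move=> a0; rewrite expR_ge0 /= expR_le1 oppr_le0 mulr_ge0// ltW.
Qed.

Let bounded_lap a : 0 < a -> bounded_fun (lap a).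
Proof. by move=> a0; exists 1 => k; have /andP[h0 h1] := lap01 k a0; rewrite ger0_norm. Qed.

Ltac bounded := solve [repeat first [exact: bounded_cst | exact: bounded_bool |
  apply: bounded_lap; assumption | assumption | apply: bounded_opp | apply: bounded_mul
  | apply: bounded_add]].

Lemma surviving_laplace_unit a n : 0 < a -> 0 <= surviving_laplace a n <= 1.
Proof.
move=> a0; apply/andP; split.
  by apply: Rintegral_ge0 => w _; rewrite mulr_ge0// expR_ge0.
rewrite -[leRHS](gap_mean1 n); apply: gap_mean_le; [|exact: bounded_cst|].
  by apply: bounded_mul; [exact: bounded_lap|exact: bounded_bool].
by move=> k; have /andP[h0 h1] := lap01 k a0; case: ltnP; rewrite ?mulr1// mulr0.
Qed.

(** The kernel error C / k + C a is at most [eta] for k >= M. For 0 < k < M the part C / k <= C is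
    charged to [wn], which is summable because each such state has finite expected occupation. *)
Lemma surviving_laplace_step : forall eta, 0 < eta -> exists (w : R^nat) (C a1 : R),
  [/\ 0 < a1, forall n, 0 <= w n, forall n, \sum_(k < n) w k <= C &
      forall a, 0 < a < a1 -> forall n,
      `|surviving_laplace a n.+1 - survival n.+1 + survival n -
         (1 + gamma0 p ^+ 2 * a ^+ 2) * surviving_laplace a n|
        <= a ^+ 2 * (eta * survival n + w n)].
Proof.
move=> eta eta0; have [C C0 HC] := laplace_kernel_expansion hp mu_law.
pose M := (Num.truncn (2 * C / eta)).+1.
have MC : C / M%:R <= eta / 2.
  rewrite ler_pdivrMr// mulrAC ler_pdivlMr// mulrC [eta * _]mulrC -ler_pdivrMr//.
  by rewrite ltW// -truncn_lt_nat// divr_ge0 ?(ltW eta0)// mulr_ge0.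
pose wn n := C * gap_mean n (fun k => (0 < k < M)%N%:R).
exists wn.
have [K HK] : exists K, forall N, \sum_(n < N) wn n <= K.
  have [F HF] : exists F : nat -> R, forall m, (0 < m)%N -> forall N, \sum_(n < N) occupation n m <= F m.
    have /choice[F HF] : forall m, exists c, (0 < m)%N -> forall N, \sum_(n < N) occupation n m <= c.
      move=> m; case: (posnP m) => [->|/occupation_bound[c hc]]; first by exists 0.
      by exists c.
    by exists F.
  exists (C * \sum_(1 <= m < M) F m) => N.
  rewrite -mulr_sumr ler_wpM2l//.
  apply: (@le_trans _ _ (\sum_(1 <= m < M) \sum_(n < N) occupation n m)); last first.
    by rewrite big_nat_cond [leRHS]big_nat_cond; apply: ler_sum => m /andP[/andP[m0 _] _]; exact: HF.
  rewrite exchange_big /= ler_sum// => n _.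
  have bF m : bounded_fun (fun k => (k == m)%:R) by exact: bounded_bool.
  rewrite (gap_mean_sum n (index_iota 1 M) bF).
  apply: gap_mean_le; [bounded|exact: bounded_sum|].
  move=> k; case: (boolP (0 < k < M)%N) => kM; last by rewrite sumr_ge0.
  by rewrite (bigD1_seq k) ?mem_index_iota ?iota_uniq//= eqxx lerDl sumr_ge0.
pose a1 : R := eta / (2 * (C + 1)).
have C1 : 0 < 2 * (C + 1) by rewrite mulr_gt0// ltr_wpDl.
exists K, a1; split=> //.
- by rewrite divr_gt0.
- by move=> n; rewrite mulr_ge0// Rintegral_ge0.
move=> a /andP[a0 aa1] n.
have Ca : C * a <= eta / 2.
  have : a * (2 * (C + 1)) <= eta by rewrite -ler_pdivlMr// ltW.
  by lra.
pose L k := laplace_kernel mu a k.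
pose lam := 1 + gamma0 p ^+ 2 * a ^+ 2.
have e1 : gap_mean n.+1 (lap a) = surviving_laplace a n.+1 + (1 - survival n.+1).
  rewrite /surviving_laplace /survival -[X in _ + (X - _)](gap_mean1 n.+1) -gap_meanB; last 2 first.
  - exact: bounded_cst.
  - exact: bounded_bool.
  rewrite -gap_meanD; last 2 first.
  - bounded.
  - bounded.
  congr (gap_mean _ _); apply/funext => k; case: (posnP k) => [->|k0].
    by rewrite /lap mulr0n !mulr0 oppr0 expR0 addr0 add0r.
  by rewrite mulr1 subrr addr0.
have e2 : gap_mean n.+1 (lap a) = gap_mean n L.
  by rewrite gap_meanS// => k; exact: lap01.
(* The ideal kernel: eigenvalue [lam] at positive gaps, and the value 1 at the absorbing state,
   where exp(-a * 0) is preserved. *)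
pose Q k := lam * (lap a k * (0 < k)%N%:R) + (1 - (0 < k)%N%:R).
have e3 : gap_mean n Q = lam * surviving_laplace a n + (1 - survival n).
  rewrite /Q gap_meanD; [|bounded|bounded]; rewrite gap_meanZ; last bounded.
  by rewrite gap_meanB; [rewrite gap_mean1|bounded|bounded].
have L01 k : 0 <= L k <= 1.
  apply/andP; split; first by apply: Rintegral_ge0 => w _; exact: expR_ge0.
  rewrite -[leRHS](gap_mean1 0); apply: le_Rintegral => //.
  - apply: (@bounded_integrable _ (lap a) 1 (mpred_one_gap k)) => j.
    by have /andP[h0 h1] := lap01 j a0; rewrite ger0_norm.
  - exact: (finite_measure_integrable_cst mu 1 measurableT).
  - by move=> w _; have /andP[] := lap01 (one_gap k w) a0.
have bL : bounded_fun L by exists 1 => k; have /andP[h0 h1] := L01 k; rewrite ger0_norm.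
have bQ : bounded_fun Q by rewrite /Q; bounded.
have -> : surviving_laplace a n.+1 - survival n.+1 + survival n - lam * surviving_laplace a n =
   gap_mean n (fun k => L k - Q k).
  rewrite gap_meanB// -e2 e3 e1; ring.
have bLQ : bounded_fun (fun k => L k - Q k) by bounded.
apply: (le_trans (gap_mean_abs n bLQ)).
have -> : a ^+ 2 * (eta * survival n + wn n) =
  gap_mean n (fun k => a ^+ 2 * (eta * (0 < k)%N%:R + C * (0 < k < M)%N%:R)).
  rewrite gap_meanZ; last bounded.
  by rewrite gap_meanD; [rewrite !gap_meanZ//|bounded|bounded]; bounded.
apply: gap_mean_le.
- by case: bLQ => c hc; exists c => k; rewrite normr_id.
- bounded.
move=> k; case: (posnP k) => [->|k0].
  rewrite /Q /= mulr0n !mulr0 subr0 !addr0 mulr0 add0r /L /laplace_kernel.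
  under eq_Rintegral do rewrite one_gap0 mulr0 oppr0 expR0.
  by rewrite -/(gap_mean 0 (fun=> 1)) gap_mean1 subrr normr0.
rewrite /Q k0 /= mulr1n mulr1 subrr addr0 /L; apply: (le_trans (HC a k a0 k0)).
rewrite ler_wpM2l ?sqr_ge0// mulr1.
have kR : (0 : R) < k%:R by rewrite ltr0n.
case: (ltnP k M) => kM /=.
  rewrite mulr1 addrC lerD//; first by lra.
  by rewrite ler_pdivrMr// ler_peMr// ler1n.
rewrite mulr0 addr0.
have : C / k%:R <= C / M%:R by rewrite ler_wpM2l// lef_pV2 ?posrE ?ltr0n// ler_nat.
by lra.
Qed.

End GapProcess.

(** * Mass transport and conclusion *)

Section MassTransport.
Context (R : realType) (p : R) (mu : probability config R).
Hypothesis mu_law : config_law p mu.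
Implicit Types (t x y : int) (n : nat) (w : config).

Lemma cflow_mono t n x y w : x <= y -> cflow t n x w <= cflow t n y w.
Proof. by apply: flow_mono; exact: signs_sign_of. Qed.

Lemma mpred_cflow2 t n x y (A : int -> int -> Prop) :
  mpred (fun w => A (cflow t n x w) (cflow t n y w)).
Proof.
apply: (mpred_comp (fun z : int * int => A z.1 z.2)
  (f := fun w => (cflow t n x w, cflow t n y w))) => z.
by apply: mpred_pair => i; exact: mpred_cflow.
Qed.

Lemma cflow_low_tail t n :
  mu [set w | cflow t n 0 w <= - k%:Z] @[k --> \oo] --> 0%E.
Proof.
rewrite -(measure0 mu).
have -> : set0 = \bigcap_k [set w | cflow t n 0 w <= - k%:Z].
  apply/seteqP; split=> // w /(_ (`|cflow t n 0 w|%N.+1) I) /=; lia.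
have mA k : measurable [set w | cflow t n 0 w <= - k%:Z].
  exact: (mpred_cflow2 t n 0 0 (fun x _ => x <= - k%:Z)).
apply: nonincreasing_cvg_mu => //.
- by rewrite ltey_eq fin_num_measure.
- exact: bigcap_measurable.
- by apply/nonincreasing_seqP => k; apply/subsetPset => w /=; lia.
Qed.

(** Otherwise walkers starting arbitrarily far to the right would all end at 0. By translation this
    is at most the probability that the walker from 0 ends at or below -k, for every large k. *)
Lemma constant_tail_null t n :
  mu [set w | exists x, forall y, x <= y -> cflow t n y w = 0] = 0%E.
Proof.
have mA x : mpred (fun w => forall y, x <= y -> cflow t n y w = 0).
  apply: mpred_forall => y; apply: mpred_imp; first exact: mpred_cst.
  exact: mpred_cflow.
apply: null_exists => // x; apply/eqP; rewrite eq_le measure_ge0 andbT.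
apply: (cvge_to_ge (cflow_low_tail t n)); near=> k.
have xk : (`|x| <= k)%N by near: k; exact: nbhs_infty_ge.
apply: (@le_trans _ _ (mu [set w | cflow t n k%:Z w = 0])).
  apply: le_measure; rewrite ?inE; [exact: mA|exact: mpred_cflow|].
  by move=> w /=; apply; lia.
have -> : [set w | cflow t n k%:Z w = 0] =
    shift_config (k%:Z, 0) @^-1` [set w | cflow t n 0 w = - k%:Z].
  apply/seteqP; split=> w /=; rewrite cflow_shift /= addr0 add0r; lia.
rewrite (shift_measure mu_law); last exact: mpred_cflow.
apply: le_measure; rewrite ?inE; first exact: mpred_cflow.
  exact: (mpred_cflow2 t n 0 0 (fun x _ => x <= - k%:Z)).
by move=> w /= ->.
Unshelve. all: by end_near. Qed.

(* A level set of the monotone map [cflow t n] that is bounded above has a unique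
   greatest element; shifting it to the origin is the mass transport. *)
Lemma measure_hit_zero t n :
  mu [set w | exists x, cflow t n x w = 0] = mu [set w | gap t n w <> 0%N].
Proof.
(* By monotonicity [A x] says that x is the greatest starting point sent to 0; [A' x] is the same
   event seen from x. Summed over x, the latter only says that the walkers from 0 and 1 end
   apart. *)
pose A x w := cflow t n x w = 0 /\ cflow t n (x + 1) w <> 0.
pose A' x w := cflow t n 0 w = - x /\ cflow t n 1 w <> - x.
have mA x : mpred (A x) by exact: (mpred_cflow2 t n x (x + 1) (fun u v => u = 0 /\ v <> 0)).
have mA' x : mpred (A' x) by exact: (mpred_cflow2 t n 0 1 (fun u v => u = - x /\ v <> - x)).
transitivity (mu [set w | exists x, A x w]).
  apply: (measure_eq_ae _ (constant_tail_null t n)).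
  - apply: mpred_exists => x; apply: mpred_forall => y.
    by apply: mpred_imp; [exact: mpred_cst|exact: mpred_cflow].
  - by apply: mpred_exists => x; exact: mpred_cflow.
  - exact: mpred_exists.
  move=> w nN; split=> [[x x0]|[x [x0 _]]]; last by exists x.
  (* Without a greatest starting point sent to 0, every point to the right of x is sent to 0 as
     well, by induction. *)
  apply: contrapT => nA; apply: nN; exists x => y xy.
  have -> : y = x + `|y - x|%N%:Z by lia.
  elim: `|y - x|%N => [|k IH]; first by rewrite addr0.
  apply: contrapT => nk; apply: nA; exists (x + k%:Z); split=> //.
  by rewrite (_ : x + k%:Z + 1 = x + k.+1%:Z)//; lia.
rewrite (measure_exists_eq (Q' := A'))//.
- congr (mu _); apply/seteqP; split=> w /=; rewrite /gap.
    by case=> x [h1 h2]; rewrite h1 => /eqP; rewrite absz_eq0 subr_eq0 => /eqP.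
  move=> h; exists (- cflow t n 0 w); split; first by rewrite opprK.
  by rewrite opprK => e; apply: h; rewrite e subrr.
- have key x y w : A x w -> A y w -> x < y -> False.
    move=> [x0 x1] [y0 _] xy; apply: x1.
    have h1 : cflow t n x w <= cflow t n (x + 1) w by apply: cflow_mono; lia.
    have h2 : cflow t n (x + 1) w <= cflow t n y w by apply: cflow_mono; lia.
    by rewrite x0 in h1; rewrite y0 in h2; lia.
  move=> x y w Ax Ay; have [xy|yx|//] := ltgtP x y.
    by case: (key x y w Ax Ay xy).
  by case: (key y x w Ay Ax yx).
- by move=> x y w [h1 _] [h2 _]; move: h2; rewrite h1; lia.
move=> x; apply: (etrans _ (shift_measure mu_law (x, 0) (mA' x))); congr (mu _).
apply/seteqP; split=> w; rewrite /A /A' /= !cflow_shift /= addr0 add0r [1 + x]addrC.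
  by case=> -> h; rewrite sub0r; split=> // /eqP; rewrite subr_eq addNr => /eqP.
case=> /eqP; rewrite subr_eq addNr => /eqP h1 h2; split=> // e.
by apply: h2; rewrite e sub0r.
Qed.

Lemma gap_shift t n w : gap t n w = gap 0 n (shift_config (0, t) w).
Proof. by rewrite /gap !cflow_shift /= !add0r !addr0 ?subr0. Qed.

Lemma measure_gap t n : mu [set w | gap t n w <> 0%N] = (survival mu n)%:E.
Proof.
pose A : set config := [set w | gap 0 n w <> 0%N].
have mA : measurable A by exact: (mpred_not (mpred_gap 0 n 0%N)).
transitivity (mu A).
  apply: (etrans _ (shift_measure mu_law (0, t) mA)); congr (mu _).
  by apply/seteqP; split=> w; rewrite /A /= (gap_shift t n w).
have [c hc] := bounded_bool R (fun k => (0 < k)%N).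
rewrite /survival /gap_mean /Rintegral fineK; last first.
  by apply: integrable_fin_num => //; exact: (gap_integrable mu n hc).
rewrite -[A in LHS]setIT -integral_indic//.
apply: eq_integral => w _; rewrite indicE; congr (_%:R)%:E; congr nat_of_bool.
by apply/idP/idP; rewrite inE /A /= lt0n => /eqP.
Qed.

End MassTransport.

Section SurvivalAsymptotics.
Context (R : realType) (p : R) (mu : probability config R).
Hypothesis hp : 0 < p < 1.
Hypothesis mu_law : config_law p mu.

Lemma gamma0_gt0 : 0 < gamma0 p.
Proof.
case/andP: hp => p0 p1; rewrite sqrtr_gt0 divr_gt0//.
  by rewrite mulr_gt0 ?subr_gt0//; nra.
by rewrite mulr_gt0// exprn_gt0//; lra.
Qed.

Lemma survival_asymptotic :
  Num.sqrt n%:R * survival mu n @[n --> \oo] --> 1 / gamma0 p / Num.sqrt pi.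
Proof.
apply: tauberian.
- exact: survival_unit.
- by rewrite divr_ge0// ltW// gamma0_gt0.
- move=> e e0; apply: (@gen_fun_asymptotic _ (survival mu) (surviving_laplace mu) _ gamma0_gt0) => //.
  + exact: survival_unit.
  + by rewrite /survival gap_mean0.
  + by move=> a n a0; exact: surviving_laplace_unit.
  + by move=> a; rewrite /surviving_laplace gap_mean0 !mulr1.
  + exact: surviving_laplace_step.
- exact: survival_nonincreasing.
Qed.

(** Length greater than n corresponds to n + 1 steps; the ratio sqrt(n / (n + 1)) is sqrt(1 -
    [harmonic n]), which tends to 1. *)
Lemma survival_asymptoticS :
  Num.sqrt n%:R * survival mu n.+1 @[n --> \oo] --> 1 / gamma0 p / Num.sqrt pi.
Proof.
have h1 : Num.sqrt n.+1%:R * survival mu n.+1 @[n --> \oo] --> 1 / gamma0 p / Num.sqrt pi.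
  by have := survival_asymptotic; rewrite -(cvg_shiftS _).
have h2 : Num.sqrt (1 - harmonic n) @[n --> \oo] --> (1 : R).
  rewrite -[X in _ --> X](@sqrtr1 R); apply: continuous_cvg.
    exact: sqrt_continuous.
  rewrite -[X in _ --> X](subr0 1).
  by apply: cvgB; [exact: cvg_cst|exact: cvg_harmonic].
rewrite -[X in _ --> X]mul1r.
apply: cvg_trans (cvgM h2 h1); apply: near_eq_cvg; apply: nearW => n /=.
rewrite mulrA -sqrtrM; last by rewrite /harmonic subr_ge0 invf_le1// ler1n.
by congr (Num.sqrt _ * _); rewrite /harmonic -(natr1 n); field; rewrite natr1 pnatr_eq0.
Qed.

End SurvivalAsymptotics.

Theorem theorem1p2 (R : realType) (p : R) (hp : 0 < p < 1)
    (d : measure_display) (T : measurableType d) (P : probability T R)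
    (B : vertex -> {RV P >-> bool}) (U : vertex -> {RV P >-> int})
    (hBU : drainage_network p B U) :
  (fun n : nat => Num.sqrt (n%:R : R) *
     fine (P [set w | (n%:R%:E <
       channel_length (fun u => B u w) (fun u => U u w) R (0, 0)%R)%E]))
    @ \oo --> (1 / (gamma0 p * Num.sqrt pi) : R).
Proof.
pose X : {mfun T >-> config} := mfun_Sub (mem_set (measurable_network_config B U)).
(* Transporting the law to the canonical space makes translations, reflections and resampling
   available. *)
pose mu : probability config R := distribution P X.
have mu_law : config_law p mu.
  by move=> J1 beta J2 eps; exact: (network_config_law hp hBU).
have mb u : mpred (fun w => B u w) by exact: mpred_B.
have ms u k : mpred (fun w => U u w = k) by exact: mpred_U.
pose closed_row w := exists t, ~ row_open (opens (network_config B U w)) t.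
have mclosed : mpred closed_row.
  by apply: mpred_exists => t; apply/mpred_not/mpred_row_open.
have closed_null : P [set w | closed_row w] = 0%E.
  apply: null_exists => [t|t]; first by apply/mpred_not/mpred_row_open.
  exact: (row_closed_null hp mu_law t).
have key n : P [set w | (n%:R%:E <
    channel_length (fun u => B u w) (fun u => U u w) R (0, 0)%R)%E] =
    (survival mu n.+1)%:E.
  rewrite -(measure_gap mu_law (- n.+1%:Z)) -(measure_hit_zero mu_law).
  pose H w := exists x, cflow (- n.+1%:Z) n.+1 x (network_config B U w) = 0.
  rewrite -[RHS]/(P [set w | H w]).
  have mhit : mpred (fun w => exists x, cflow (- n.+1%:Z) n.+1 x w = 0).
    by apply: mpred_exists => x; exact: mpred_cflow.
  have mH : mpred H.
    by have := measurable_network_config B U measurableT mhit; rewrite setTI.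
  (* Off this null set all rows contain an open vertex and [sign_of] recovers the given [U], so the
     deterministic equivalence applies to the original families. *)
  pose N w := closed_row w \/ (exists u, U u w <> 1 /\ U u w <> -1).
  have mN : mpred N by apply: mpred_or => //; exact: mpred_invalid_sign.
  have N0 : P [set w | N w] = 0%E.
    apply/eqP; rewrite eq_le measure_ge0 andbT.
    apply: (le_trans (measureU2 _ _ _)) => //; first exact: mpred_invalid_sign.
    by rewrite [X in (X + _)%E]closed_null [X in (_ + X)%E](invalid_sign_null hBU) adde0.
  apply: (measure_eq_ae mN N0) => //.
    exact: (mpred_channel_length_gt mb ms).
  move=> w /not_orP[nc ns].
  have es := sign_of_network_config B ns.
  have sg : signs (fun u => U u w) by rewrite -es; exact: signs_sign_of.
  have ro t : row_open (fun u => B u w) t.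
    by apply: contrapT => nt; apply: nc; exists t.
  rewrite /H /cflow es.
  exact: (@channel_length_flow _ _ (fun w u => B u w) (fun w u => U u w) R w n).
under eq_fun do rewrite key /=.
rewrite (_ : 1 / (gamma0 p * Num.sqrt pi) = 1 / gamma0 p / Num.sqrt pi).
  exact: survival_asymptoticS.
by rewrite invfM mulrA.
Qed.
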